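(* Let $Z=\{Z(t)\}_{t\ge 0}$, $Z(0)=0$, be a process with regenerative increments, with cycle epochs $0=T_0<T_1<T_2<\cdots$, cycle lengths $R_i=T_i-T_{i-1}$, cycle increments $\xi_i$, cycle suprema $\xi_i^*$ and within-cycle exceedance times $t_i(x)$ as defined in the context, and suppose $\mu=\mathbb{E}R_1<\infty$. Assume that: (1) there is a distribution $F$ on $[0,\infty)$ with finite mean such that $\mathbb{P}(\xi_1>x)\sim\mathbb{P}(\xi_1^*>x)\sim\overline F(x)$ as $x\to\infty$, and the integrated tail distribution $F^I$ is subexponential; (2) $\mathbb{E}\xi_1=-a<0$; (3) there is a function $e(x)\uparrow\infty$ such that for every $t>0$ $$\lim_{x\to\infty}\frac{\overline{F^I}(x+te(x))}{\overline{F^I}(x)}=\overline G(t)$$ for some distribution $G$, and $\limsup_{x\to\infty} e(x+e(x))/e(x)<\infty$; (4) for every $y>0$, $\mathbb{P}\bigl(t_1(x)>y\,e(x)\,\big|\,\xi_1>x\bigr)\to 0$ as $x\to\infty$. Let $M=\sup_{t\ge0}Z(t)$, $\tau(x)=\inf\{t\ge 0: Z(t)>x\}$, and let $W$ be a random variable with distribution $G$. Then, as $x\to\infty$, the conditional distribution of $\tau(x)/e(x)$ given $M>x$ converges weakly to the distribution of $\mu W/a$.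
   Context: Regenerative increments: there are random times $0=T_0<T_1<T_2<\cdots$ (with $T_n\to\infty$) such that, with $R_k=T_k-T_{k-1}$, the cycles $\bigl(R_{k+1},\{Z(t+T_k)-Z(T_k)\}_{0\le t\le R_{k+1}}\bigr)$, $k=0,1,2,\dots$, are i.i.d. For cycle $i\ge1$: $\xi_i=Z(T_i)-Z(T_{i-1})$; $\xi_i^*=\sup_{0\le t\le R_i}\bigl(Z(t+T_{i-1})-Z(T_{i-1})\bigr)$; and $t_i=t_i(x)=\inf\{t\le R_i: Z(t+T_{i-1})-Z(T_{i-1})>x\}$ if $\xi_i^*>x$, $t_i(x)=R_i$ otherwise. For a distribution $F$, $\overline F(x)=1-F(x)$, and the integrated tail distribution $F^I$ is given by $\overline{F^I}(x)=\min\bigl(1,\int_x^\infty\overline F(y)\,dy\bigr)$. A distribution $H$ on $[0,\infty)$ is subexponential if $\overline{H}(x)>0$ for all $x$ and $\overline{H*H}(x)\sim 2\overline H(x)$ as $x\to\infty$. The notation $f\sim g$ means $f(x)/g(x)\to1$; $e(x)\uparrow\infty$ means $e$ is positive, nondecreasing and tends to $\infty$. The limit $G$ is a probability distribution on $[0,\infty)$, with $\overline G=1-G$. *)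

(* Defs.v *)
From mathcomp Require Import all_boot all_order all_algebra.
From mathcomp Require Import all_classical all_reals all_analysis.

Set Implicit Arguments.
Unset Strict Implicit.
Unset Printing Implicit Defensive.

Import Order.TTheory GRing.Theory Num.Theory.
Import numFieldNormedType.Exports.

Local Open Scope classical_set_scope.
Local Open Scope ring_scope.

Definition tail (R : realType) (H : set R -> \bar R) (x : R) : R :=
  fine (H `]x, +oo[%classic).

Definition asymp (R : realType) (f g : R -> R) : Prop :=
  f x / g x @[x --> +oo] --> (1 : R).

Definition on_nonneg (R : realType) (H : probability R R) : Prop :=
  H `[0, +oo[%classic = 1%E.

(* The formula for the tail is imposed on the half-line [0, +oo) only: the
   integrated tail distribution is a distribution on [0, +oo), possibly with
   an atom at 0, and it is determined by these values. *)
Definition integrated_tail_of (R : realType) (F FI : probability R R) : Prop :=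
  on_nonneg FI /\
  forall x : R, 0 <= x ->
    FI `]x, +oo[%classic =
    Order.min 1%E
      (\int[lebesgue_measure]_(y in `]x, +oo[) F `]y, +oo[%classic)%E.

Definition convolution (R : realType) (H K : probability R R) :
    set R -> \bar R :=
  pushforward (H \x K)%E (fun p : R * R => p.1 + p.2).

Definition subexponential (R : realType) (H : probability R R) : Prop :=
  [/\ on_nonneg H,
      (forall x : R, 0 < tail H x) &
      asymp (tail (convolution H H)) (fun x => 2 * tail H x)].

Definition increases_to_infty (R : realType) (e : R -> R) : Prop :=
  [/\ (forall x, 0 <= x -> 0 < e x),
      (forall x y, 0 <= x -> x <= y -> e x <= e y) &
      e x @[x --> +oo] --> +oo].

Definition cond_prob d (Omega : measurableType d) (R : realType)
    (P : probability Omega R) (A B : set Omega) : R :=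
  fine (P (A `&` B)) / fine (P B).

Definition cond_law d (Omega : measurableType d) (R : realType)
    (P : probability Omega R) (B : set Omega) (X : Omega -> R) :
    set R -> \bar R :=
  fun A => (cond_prob P (X @^-1` A) B)%:E.

Definition weakly_converges (R : realType)
    (nu : R -> set R -> \bar R) (nu0 : set R -> \bar R) : Prop :=
  forall f : R -> R, continuous f -> (exists C, forall y, `|f y| <= C) ->
    (\int[nu x]_y (f y)%:E)%E @[x --> +oo] --> (\int[nu0]_y (f y)%:E)%E.

(* A cycle (r, z) is a length r together with a path z started at 0. Only the
   restriction of z to [0, r] matters: every functional below depends on z
   through this restriction alone. *)
Definition cycle_type (R : realType) : Type := (R * (R -> R))%type.

Section cycle_functionals.
Variable R : realType.
Implicit Types c : cycle_type R.

Definition cycle_length c : R := c.1.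

Definition cycle_at (t : R) c : R := c.2 (Num.min t c.1).

Definition cycle_increment c : R := c.2 c.1.

Definition cycle_sup c : \bar R :=
  ereal_sup [set (c.2 t)%:E | t in `[0, c.1]%classic].

Definition cycle_exceedance (x : R) c : R :=
  if (x%:E < cycle_sup c)%E
  then inf [set t | t \in `[0, c.1] /\ x < c.2 t]
  else c.1.

Definition cycle_observables : set (cycle_type R -> \bar R) :=
  [set EFin \o cycle_length]
  `|` [set EFin \o cycle_at t | t in `[0, +oo[%classic]
  `|` [set EFin \o cycle_increment]
  `|` [set cycle_sup]
  `|` [set EFin \o cycle_exceedance x | x in [set: R]].

(* The sigma-algebra on cycles. For paths that are right-continuous it is the
   usual one, generated by the length and the coordinates of the path stopped
   at the end of the cycle. Adjoining the other three kinds of observables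
   only makes the end-of-cycle value, the supremum and the exceedance times
   measurable when no regularity of the paths is assumed. *)
Definition cycle_event : set (set (cycle_type R)) :=
  <<s [set [set c | (y < f c)%E] | f in cycle_observables & y in [set: \bar R]] >>.

End cycle_functionals.

Section process.
Context d (Omega : measurableType d) (R : realType).
Variables (P : probability Omega R).
(* Only the values of Z at times t >= 0 are ever used. *)
Variables (Z : R -> {RV P >-> R}) (T : nat -> {RV P >-> R}).

(* [nth_cycle k] is the cycle from T_k to T_(k+1); its length, increment,
   supremum and exceedance times are R_(k+1), xi_(k+1), xi_(k+1)^* and
   t_(k+1)(x). Numbering thus starts at 0 here and at 1 for these quantities. *)
Definition nth_cycle (k : nat) (w : Omega) : cycle_type R :=
  (T k.+1 w - T k w, fun t => Z (t + T k w) w - Z (T k w) w).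

Definition cycle_measurable : Prop :=
  forall k A, cycle_event A -> measurable (nth_cycle k @^-1` A).

Definition cycles_independent : Prop :=
  forall (n : nat) (A : nat -> set (cycle_type R)),
    (forall k, cycle_event (A k)) ->
    P (\bigcap_(k in `I_n) (nth_cycle k @^-1` A k)) =
    (\prod_(k < n) P (nth_cycle k @^-1` A k))%E.

Definition cycles_identically_distributed : Prop :=
  forall k A, cycle_event A ->
    P (nth_cycle k @^-1` A) = P (nth_cycle 0 @^-1` A).

Record regenerative_increments : Prop := RegenerativeIncrements {
  epoch0 : forall w, T 0%N w = 0 ;
  epoch_lt : forall k w, T k w < T k.+1 w ;
  epoch_cvgy : forall w, T k w @[k --> \oo] --> +oo ;
  nth_cycle_measurable : cycle_measurable ;
  nth_cycle_independent : cycles_independent ;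
  nth_cycle_identically_distributed : cycles_identically_distributed
}.

Definition process_sup (w : Omega) : \bar R :=
  ereal_sup [set (Z t w)%:E | t in `[0, +oo[%classic].

(* Equal to +oo when the level x is never exceeded. *)
Definition hitting_time (x : R) (w : Omega) : \bar R :=
  ereal_inf [set t%:E | t in [set t : R | 0 <= t /\ x < Z t w]].

End process.

(* Main.v *)
(* The level x is exceeded because of a single big jump. By the strong law, the
   walk Z(T_n) stays close to the line - a n and T_n close to mu n, with high
   probability and uniformly in n; cycle n then takes Z above x as soon as its
   increment exceeds x + a n. Summing tails over the cycles n >= t e(x) / mu,
   the probability that M > x and tau(x) >= t e(x) is at least
   (1 - o(1)) / a * tail FI (x + a t e(x) / mu), which is asymptotic to
   tail G (a t / mu) / a * tail FI x. Summing over the cycles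
   n < t e(x) / mu gives a lower bound with 1 - tail G (a t / mu) for
   tau(x) <= t e(x), as by (3) and (4) the time spent within the cycle of the
   jump is negligible. Subexponentiality of FI yields
   P(M > x) <= (1 + o(1)) / a * tail FI x, so that both bounds are sharp. *)

Require Import Defs.
From mathcomp Require Import all_boot all_order all_algebra.
From mathcomp Require Import all_classical all_reals all_analysis.
From mathcomp Require Import measurable_realfun lra ring zify.
Set Implicit Arguments.
Unset Strict Implicit.
Unset Printing Implicit Defensive.
Import Order.TTheory GRing.Theory Num.Theory.
Import numFieldNormedType.Exports.
Local Open Scope classical_set_scope.
Local Open Scope ring_scope.

(** * Sequences of i.i.d. cycles and their random walks *)

(** The delicate point is the upper bound for P(M > x). That the walk leaves its linear bounds has
    small probability, but not small compared with tail H x ([H] being the integrated tail), so this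
    event cannot be discarded. It is handled by a renewal argument: stop at the first cycle whose
    supremum crosses the line K - n b, with b slightly below a. The walk is then still at most K + b
    - n b, so the crossing cycle alone reaches x with probability about tail H x / a, while crossing
    at all is unlikely when K is large. What follows is an independent copy of the problem; a bound
    c * tail H for it lets a variable with law [H] stand in for it, and convolution estimates
    improve c to 1/a + delta + c * delta. A crude pass makes c finite, one more gives 1/a + delta.
    The strong law is used only in a weak form: a walk with negative mean is bounded above,
    uniformly in n, with probability close to 1. This follows from a zero-one law and dominated
    convergence. The walk is studied on the space of sequences of cycles, where restarting is a
    shift; [Z] reappears when events are pulled back. *)

Definition image_measure {d d'} {T : measurableType d} {T' : measurableType d'}
    {R : realType} (m : {measure set T -> \bar R}) (f : T -> T')
    (mf : measurable_fun setT f) : {measure set T' -> \bar R}.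
Proof. by refine (pushforward m f : {measure set T' -> \bar R}). Defined.

Section sequence_space.
Context {dE : measure_display} {E : measurableType dE}.

Definition cylinder (N : nat) (A : nat -> set E) : set (nat -> E) :=
  [set s | forall k, (k < N)%N -> A k (s k)].

Definition cylinders : set (set (nat -> E)) :=
  [set C | exists N A, (forall k, measurable (A k)) /\ C = cylinder N A].

(** The countable product sigma-algebra. Cylinders constrain an initial segment of coordinates and
    are closed under intersection, so finite measures that agree on them are equal. *)
Definition seq_space := g_sigma_algebraType cylinders.

Lemma setI_closed_cylinders : setI_closed cylinders.
Proof.
move=> _ _ [N [A [mA ->]]] [N' [A' [mA' ->]]].
exists (maxn N N'), (fun k => (if (k < N)%N then A k else setT) `&`
  (if (k < N')%N then A' k else setT)); split=> [k|].
  by apply: measurableI; case: ifP.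
apply/seteqP; split=> s /=.
  move=> [sA sA'] k _; split; case: ifP => // kN; [exact: sA|exact: sA'].
move=> sAA; split=> k kN.
  by have [] := sAA k (leq_trans kN (leq_maxl _ _)); rewrite kN.
by have [] := sAA k (leq_trans kN (leq_maxr _ _)); rewrite kN.
Qed.

Lemma measurable_cylinder N A : (forall k, measurable (A k)) ->
  measurable (cylinder N A : set seq_space).
Proof. by move=> mA; apply: sub_sigma_algebra; exists N, A. Qed.

Lemma measurable_coord k : measurable_fun setT (fun s : seq_space => s k).
Proof.
move=> _ A mA; rewrite setTI.
rewrite (_ : _ @^-1` A =
    cylinder k.+1 (fun j => if j == k then A else setT)); last first.
  apply/seteqP; split=> s /=.
    by move=> As j _; case: eqP => // ->.
  by move=> /(_ k (ltnSn _)); rewrite eqxx.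
by apply: measurable_cylinder => j; case: ifP.
Qed.

Lemma measurable_seq_space d (T : measurableType d) (f : T -> seq_space) :
  (forall k, measurable_fun setT (fun t => f t k)) -> measurable_fun setT f.
Proof.
move=> mf; apply: (@measurability _ _ _ _ setT f cylinders) => //.
move=> _ [_ [N [A [mA ->]] <-]]; rewrite setTI.
rewrite (_ : f @^-1` cylinder N A =
    \bigcap_(k in `I_N) (fun t => f t k) @^-1` A k); last first.
  by apply/seteqP; split=> t /= h k; exact: h.
apply: bigcap_measurableType => k _.
by rewrite -[X in measurable X]setTI; exact: mf.
Qed.

(** Glues a past of length [n] to a fresh sequence; it turns independence of past and future into a
    statement about [Q \x Q]. *)
Definition splice n (p : seq_space * seq_space) : seq_space :=
  fun k => if (k < n)%N then p.1 k else p.2 (k - n)%N.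

Definition shift n (s : seq_space) : seq_space := fun k => s (n + k)%N.

Lemma measurable_shift n : measurable_fun setT (shift n).
Proof.
by apply: measurable_seq_space => k; exact: measurable_coord.
Qed.

Lemma measurable_splice n : measurable_fun setT (splice n).
Proof.
apply: measurable_seq_space => k; rewrite /splice; case: (k < n)%N.
  exact: measurableT_comp (measurable_coord k) measurable_fst.
exact: measurableT_comp (measurable_coord _) measurable_snd.
Qed.

Lemma shift_splice n p : shift n (splice n p) = p.2.
Proof.
by apply/funext => k; rewrite /shift /splice ltnNge leq_addr/= addKn.
Qed.

End sequence_space.
Arguments seq_space {dE} E.

Section iid.
Context {dE : measure_display} {E : measurableType dE} {R : realType}.
Variables (p : probability E R) (Q : probability (seq_space E) R).

Definition iid_law := forall N (A : nat -> set E),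
  (forall k, measurable (A k)) -> Q (cylinder N A) = (\prod_(k < N) p (A k))%E.

Hypothesis Qiid : iid_law.

(** The preimage of a cylinder of length n + N is a rectangle of two cylinders, on which both sides
    factor; uniqueness of measures does the rest. *)
Lemma iid_splice n (C : set (seq_space E)) : measurable C ->
  Q C = (Q \x Q)%E (splice n @^-1` C).
Proof.
move=> mC.
have H (D : set (seq_space E)) : cylinders D ->
    Q D = pushforward (Q \x Q)%E (splice n) D.
  move=> [N [A1 [mA ->]]]; rewrite /pushforward.
  (* Padding with [setT] makes every cylinder long enough to be split at [n]. *)
  pose A k := if (k < N)%N then A1 k else setT.
  have mA' k : measurable (A k) by rewrite /A; case: ifP.
  have -> : cylinder N A1 = cylinder (n + N) A.
    apply/seteqP; split=> s /= sA k kN.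
      by rewrite /A; case: ifP => // kN'; exact: sA.
    by have := sA k (leq_trans kN (leq_addl _ _)); rewrite /A kN.
  have -> : splice n @^-1` cylinder (n + N) A =
      cylinder n A `*` cylinder N (fun k => A (n + k)%N).
    apply/seteqP; split=> -[s s'] /=.
      move=> H; split=> k kn.
        have := H k (leq_trans kn (leq_addr _ _)).
        by rewrite /splice kn.
      have := H (n + k)%N; rewrite ltn_add2l => /(_ kn).
      by rewrite /splice ltnNge leq_addr/= addKn.
    move=> [sA sA'] k kn; rewrite /splice; case: ifPn => kn'.
      exact: sA.
    rewrite -leqNgt in kn'.
    have := sA' (k - n)%N; rewrite subnKC//; apply.
    by rewrite ltn_subLR.
  rewrite product_measure1E; [|exact: measurable_cylinder..].
  by rewrite Qiid// big_split_ord/= !Qiid.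
apply: (@measure_unique _ R (seq_space E) cylinders (fun=> setT) erefl
  setI_closed_cylinders _ _ Q
  (image_measure (Q \x Q)%E (@measurable_splice _ E n)) H _ _ mC).
- by move=> _; exists 0%N, (fun=> setT); split => //; apply/seteqP; split.
- by rewrite bigcup_const.
- by move=> _; rewrite (le_lt_trans (probability_le1 _ _))// ltry.
Qed.

(** Dependence of [A] on the coordinates below [n] is expressed as invariance under changes of the
    others; the preimage under [splice n] is then the rectangle of [A] and [B]. *)
Lemma iid_shift_indep n (A B : set (seq_space E)) :
  measurable A -> measurable B ->
  (forall s s', (forall k, (k < n)%N -> s k = s' k) -> A s -> A s') ->
  Q (A `&` shift n @^-1` B) = (Q A * Q B)%E.
Proof.
move=> mA mB An.
have mB' : measurable (shift n @^-1` B).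
  by rewrite -[X in measurable X]setTI; exact: measurable_shift.
rewrite (@iid_splice n); last exact: measurableI.
rewrite -product_measure1E//; congr (_ _).
apply/seteqP; split=> -[s s'] /=; rewrite shift_splice/=.
  by move=> [As ?]; split => //; apply: An As => k kn; rewrite /splice kn.
by move=> [As ?]; split => //; apply: An As => k kn; rewrite /splice kn.
Qed.

Lemma iid_shift n (B : set (seq_space E)) : measurable B ->
  Q (shift n @^-1` B) = Q B.
Proof.
move=> mB; have := @iid_shift_indep n setT B measurableT mB.
by rewrite setTI probability_setT mul1e; apply.
Qed.

Lemma iid_coord n (A : set E) : measurable A ->
  Q ((fun s : seq_space E => s n) @^-1` A) = p A.
Proof.
move=> mA; pose B k := if k == n then A else setT.
have -> : (fun s : seq_space E => s n) @^-1` A = cylinder n.+1 B.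
  apply/seteqP; split=> s /= As.
    by move=> k _; rewrite /B; case: eqP => // ->.
  by have := As n (ltnSn n); rewrite /B eqxx.
rewrite Qiid; last by move=> k; rewrite /B; case: ifP.
rewrite big_ord_recr/= big1 ?mul1e; last first.
  move=> i _; rewrite /B; case: eqP => [ni|_]; last exact: probability_setT.
  by have := ltn_ord i; rewrite ni ltnn.
by rewrite /B eqxx.
Qed.

End iid.

(** The target is a separate measure [m'] known to agree with the image on measurable sets, which is
    the form in which [iid_coord] and [iid_shift] give it. *)
Lemma integrable_image d d' (T : measurableType d) (T' : measurableType d')
    (R : realType) (m : {measure set T -> \bar R})
    (m' : {measure set T' -> \bar R}) (phi : T -> T') (f : T' -> \bar R) :
  measurable_fun setT phi ->
  (forall A, measurable A -> m (phi @^-1` A) = m' A) ->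
  m'.-integrable setT f ->
  m.-integrable setT (f \o phi) /\
  (\int[m]_x (f (phi x)) = \int[m']_y f y)%E.
Proof.
move=> mphi mm' intf; have mf := measurable_int _ intf.
have E g : (\int[pushforward m phi]_y g y = \int[m']_y g y)%E.
  by apply: (eq_measure_integral m' (m1 := image_measure m mphi)) => A mA _;
    exact: mm'.
have intg : m.-integrable setT (f \o phi).
  apply/integrableP; split; first exact: measurableT_comp.
  have /integrableP[_] := intf; rewrite -E ge0_integral_pushforward//.
  exact: measurableT_comp.
split => //; rewrite -E integral_pushforward//.
Qed.

Section iid_walk.
Context {dE : measure_display} {E : measurableType dE} {R : realType}.
Variables (p : probability E R) (Q : probability (seq_space E) R).
Hypothesis Qiid : iid_law p Q.

(** An event equal to its own shift by N is independent of every cylinder of length N. Hence [Q]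
    restricted to [B] and [Q B] times [Q] agree on cylinders, and so on [B] itself: [Q B] equals its
    square. *)
Lemma kolmogorov_zero_one (B : set (seq_space E)) : measurable B ->
  (forall n, shift n @^-1` B = B) -> Q B = 0%E \/ Q B = 1%E.
Proof.
move=> mB sB.
have Bfin : Q B \is a fin_num by exact: fin_num_measure.
have QBge0 : 0 <= fine (Q B) by rewrite fine_ge0.
have : mrestr Q mB B = mscale (NngNum QBge0) Q B.
  have H : forall A, cylinders A -> mrestr Q mB A = mscale (NngNum QBge0) Q A.
    move=> _ [N [A [mA ->]]]; rewrite /mrestr /mscale/= fineK// muleC.
    rewrite -[in LHS](sB N) (iid_shift_indep Qiid)//.
      exact: measurable_cylinder.
    by move=> s s' ss' As k kN; rewrite -ss'//; exact: As.
  apply: (@measure_unique _ R (seq_space E) cylinders (fun=> setT) erefl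
    setI_closed_cylinders _ _ (mrestr Q mB) (mscale (NngNum QBge0) Q) H _ _ mB).
  - by move=> _; exists 0%N, (fun=> setT); split => //; apply/seteqP; split.
  - by rewrite bigcup_const.
  - move=> _; rewrite /mrestr/= (le_lt_trans (probability_le1 _ _)) ?ltry//.
    exact: measurableI.
rewrite /mrestr /mscale/= setIid fineK//.
rewrite -(fineK Bfin) -EFinM => -[] /eqP.
rewrite -[X in X == _]mulr1 -subr_eq0 -mulrBr mulf_eq0 => /orP[/eqP ->|].
  by left.
by rewrite subr_eq0 => /eqP <-; right.
Qed.

Variable f : E -> R.

Definition partial_sum n (s : seq_space E) : R := \sum_(k < n) f (s k).

(** The maximum of the partial sums up to [n], built from the front so that it can be compared with
    the same maximum for the shifted walk. *)
Fixpoint running_max n (s : seq_space E) : R :=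
  if n is m.+1 then Num.max 0 (f (s 0%N) + running_max m (shift 1 s)) else 0.

Lemma partial_sumS n s :
  partial_sum n.+1 s = f (s 0%N) + partial_sum n (shift 1 s).
Proof. by rewrite /partial_sum big_ord_recl. Qed.

Lemma partial_sumD m n s :
  partial_sum (m + n) s = partial_sum m s + partial_sum n (shift m s).
Proof. by rewrite /partial_sum big_split_ord. Qed.

Lemma running_max_ge0 n s : 0 <= running_max n s.
Proof. by case: n => //= n; rewrite le_max lexx. Qed.

Lemma running_max_leS n s : running_max n s <= running_max n.+1 s.
Proof.
elim: n s => [|n ih] s; first exact: running_max_ge0.
rewrite /=; have := ih (shift 1 s); rewrite /= => ih'.
by rewrite ge_max !le_max lexx/= lerD2l ih' orbT.
Qed.

Lemma running_max_le m n s : (m <= n)%N -> running_max m s <= running_max n s.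
Proof.
move=> /subnKC <-; elim: (n - m)%N => [|k ih]; first by rewrite addn0.
by rewrite addnS (le_trans ih)//; exact: running_max_leS.
Qed.

Lemma partial_sum_le_running_max n s : partial_sum n s <= running_max n s.
Proof.
elim: n s => [|n ih] s; first by rewrite /partial_sum big_ord0.
by rewrite partial_sumS /= le_max lerD2l ih orbT.
Qed.

Hypothesis mf : measurable_fun setT f.

Lemma measurable_partial_sum n : measurable_fun setT (partial_sum n).
Proof.
apply: measurable_sum => i.
exact: (measurableT_comp mf (measurable_coord i)).
Qed.

Lemma measurable_running_max n : measurable_fun setT (running_max n).
Proof.
elim: n => [|n ih] /=; first exact: measurable_cst.
apply: measurable_maxr; first exact: measurable_cst.
apply: measurable_funD.
  exact: (measurableT_comp mf (measurable_coord 0)).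
exact: (measurableT_comp ih (measurable_shift 1)).
Qed.

Hypothesis intf : p.-integrable setT (EFin \o f).

Lemma integrable_coord : Q.-integrable setT (fun s => (f (s 0%N))%:E) /\
  (\int[Q]_s (f (s 0%N))%:E = \int[p]_x (f x)%:E)%E.
Proof.
apply: (integrable_image (phi := fun s : seq_space E => s 0%N) _ _ intf).
  exact: measurable_coord.
by move=> A mA; exact: iid_coord.
Qed.

Lemma integrable_shift n (g : seq_space E -> \bar R) :
  Q.-integrable setT g -> Q.-integrable setT (g \o shift n) /\
  (\int[Q]_s g (shift n s) = \int[Q]_s g s)%E.
Proof.
apply: integrable_image; first exact: measurable_shift.
by move=> A mA; exact: iid_shift Qiid n _ mA.
Qed.

Lemma integrable_running_max n : Q.-integrable setT (EFin \o running_max n).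
Proof.
elim: n => [|n ih]; first exact: finite_measure_integrable_cst.
have [i1 _] := integrable_coord; have [i2 _] := integrable_shift 1 ih.
apply: le_integrable (integrableD measurableT i1 i2) => //.
  by apply/measurable_EFinP; exact: measurable_running_max.
move=> s _ /=; rewrite lee_fin ger0_norm; last by rewrite le_max lexx.
by rewrite ge_max normr_ge0 ler_norm.
Qed.

Definition unbounded_walk : set (seq_space E) :=
  \bigcap_(K in [set: nat]) [set s | exists n, K%:R < partial_sum n s].

Lemma measurable_exceed (K : R) :
  measurable ([set s | exists n, K < partial_sum n s] : set (seq_space E)).
Proof.
rewrite (_ : [set s | _] = \bigcup_n [set s | K < partial_sum n s]).
  apply: bigcupT_measurable => n.
  rewrite -[X in measurable X]setTI.
  exact: (measurable_fun_ltr (measurable_cst K) (measurable_partial_sum n)).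
by apply/seteqP; split=> [s [n sn]|s [n _ sn]]; exists n.
Qed.

Lemma measurable_unbounded_walk : measurable unbounded_walk.
Proof. by apply: bigcapT_measurable => K; exact: measurable_exceed. Qed.

(** Dropping [n] steps changes the later partial sums by the constant S_n, and the finitely many
    earlier ones are bounded by [running_max n]. *)
Lemma unbounded_walk_shift n : shift n @^-1` unbounded_walk = unbounded_walk.
Proof.
apply/seteqP; split=> s /= sB K _.
  have [K' K'K] : exists K' : nat, K%:R - partial_sum n s <= K'%:R.
    exists (Num.truncn `|K%:R - partial_sum n s|).+1.
    by apply: le_trans (ler_norm _) _; apply/ltW; exact: truncnS_gt.
  have [m Km] := sB K' Logic.I; exists (n + m)%N.
  by rewrite partial_sumD; lra.
(* A level above [running_max n] can only be exceeded at an index beyond [n]. *)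
have [m Km] : exists m, K%:R + running_max n s + 1 < partial_sum m s.
  have [m mK] := sB (Num.truncn (K%:R + running_max n s + 1)).+1 Logic.I.
  by exists m; apply: le_lt_trans mK; apply/ltW; exact: truncnS_gt.
have [mn|/ltnW nm] := leqP m n.
  have := @running_max_le _ _ s mn; have := partial_sum_le_running_max m s.
  have : (0 : R) <= K%:R by [].
  lra.
exists (m - n)%N; move: Km; rewrite -(subnKC nm) partial_sumD addKn.
by have := partial_sum_le_running_max n s; lra.
Qed.

Hypothesis f_lt0 : (\int[p]_x (f x)%:E < 0)%E.

(* As M_(n+1) = max(0, f(s_0) + M_n o shift) >= M_n, the expectation of
   M_(n+1) - M_n o shift = max(- M_n o shift, f(s_0)) is nonnegative; on the
   event that the walk is unbounded the latter tends to f(s_0). *)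
Lemma unbounded_walk_null : Q unbounded_walk = 0%E.
Proof.
have [//|B1] := kolmogorov_zero_one measurable_unbounded_walk unbounded_walk_shift.
exfalso; move: f_lt0; rewrite ltNge => /negP; apply.
have [i1 <-] := integrable_coord.
pose g n (s : seq_space E) :=
  ((running_max n.+1 s)%:E - (running_max n (shift 1 s))%:E)%E.
have gE n s : g n s = (Num.max (- running_max n (shift 1 s)) (f (s 0%N)))%:E.
  rewrite /g /= -EFinB; congr EFin.
  by rewrite !maxEle; case: leP => ?; case: leP => ?; lra.
have mg n : measurable_fun setT (g n).
  apply: emeasurable_funB; apply/measurable_EFinP.
    exact: measurable_running_max.
  exact: (measurableT_comp (measurable_running_max n) (measurable_shift 1)).
have g_ge0 n : (0 <= \int[Q]_s g n s)%E.
  have [i2 E2] := integrable_shift 1 (integrable_running_max n).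
  rewrite integralB_EFin//; last exact: integrable_running_max.
  rewrite [X in (_ - X)%E]E2 sube_ge0; last first.
    by apply/orP; left; exact: integrable_fin_num (integrable_running_max n).
  apply: le_integral => //; [exact: (integrable_running_max n)|
    exact: (integrable_running_max n.+1)|] => s _.
  by rewrite lee_fin running_max_leS.
have := @dominated_convergence _ _ R Q setT measurableT g
  (fun s => (f (s 0%N))%:E) (fun s => `|(f (s 0%N))%:E|)%E mg.
case => //.
- exact: measurable_int i1.
- exists (~` unbounded_walk); split.
  + by apply: measurableC; exact: measurable_unbounded_walk.
  + by have := probability_setC Q measurable_unbounded_walk; rewrite B1 subee.
  + apply: subsetC => s sB _.
    have := sB; rewrite -{1}(unbounded_walk_shift 1) => /= sB1.
    have [n nf] : exists n, - f (s 0%N) < running_max n (shift 1 s).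
      have [n] := sB1 (Num.truncn `|f (s 0%N)|).+1 Logic.I.
      move=> nf; exists n.
      apply: lt_le_trans (partial_sum_le_running_max _ _).
      apply: lt_trans nf; apply: le_lt_trans (ler_norm _) _.
      by rewrite normrN truncnS_gt.
    apply: cvg_near_cst; exists n => // m /= nm.
    rewrite gE; congr EFin; apply/max_idPr.
    by have := running_max_le (shift 1 s) nm; lra.
- exact: integrable_abse.
(* The running maximum M is nonnegative, so max(- M, f) is either f or lies between f and 0. *)
- apply: aeW => s n _; rewrite gE /= lee_fin.
  have := running_max_ge0 n (shift 1 s).
  by case: (ltP (- running_max n (shift 1 s)) (f (s 0%N))) => // h h';
    rewrite ler_norml; have := ler_norm (- f (s 0%N)); rewrite normrN;
    have := ler_norm (f (s 0%N)); lra.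
move=> _ _ C; have <- := cvg_lim (@ereal_hausdorff R) C.
apply: lime_ge; last by apply: nearW => n; exact: g_ge0.
by apply/cvg_ex; eexists; exact: C.
Qed.

(** The events of exceeding the integer level K decrease to the null set [unbounded_walk];
    continuity from above gives one level that serves all n. *)
Lemma iid_walk_bound (eta : R) : 0 < eta ->
  exists2 K : R, 0 < K & (Q [set s | exists n, (K < partial_sum n s)%R] <= eta%:E)%E.
Proof.
move=> eta0.
pose F (K : nat) := [set s : seq_space E | exists n, K%:R < partial_sum n s].
have : (Q \o F) x @[x --> \oo] --> Q (\bigcap_n F n).
  apply: nonincreasing_cvg_mu => //.
  - by rewrite (le_lt_trans (probability_le1 _ _)) ?ltry//; exact: measurable_exceed.
  - by move=> K; exact: measurable_exceed.
  - exact: measurable_unbounded_walk.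
  - move=> m n mn; apply/subsetPset => s [k sk]; exists k.
    by rewrite (le_lt_trans _ sk)// ler_nat.
rewrite (_ : Q (\bigcap_n F n) = 0%E); last exact: unbounded_walk_null.
move=> /fine_cvgP[_ /cvgrPdist_le/(_ _ eta0)] [N _ /(_ N.+1 (leqnSn _))] /=.
rewrite sub0r normrN ger0_norm ?fine_ge0// => h; exists N.+1%:R => //.
rewrite -lee_fin fineK// in h; exact: fin_num_measure (measurable_exceed _).
Qed.

End iid_walk.

(** * Tails of subexponential distributions *)

Section pr.
Context {d : measure_display} {T : measurableType d} {R : realType}.
Variable P : probability T R.
Implicit Types A B : set T.

(** Real-valued, so that [lra] and [nra] apply; [tail H x] is convertible to [pr H] of a
    half-line. *)
Definition pr A : R := fine (P A).

Lemma prE A : measurable A -> P A = (pr A)%:E.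
Proof. by move=> mA; rewrite /pr fineK// fin_num_measure. Qed.

Lemma pr_ge0 A : 0 <= pr A. Proof. exact: fine_ge0. Qed.

Lemma le_pr A B : measurable A -> measurable B -> A `<=` B -> pr A <= pr B.
Proof.
by move=> mA mB AB; rewrite -lee_fin -!prE//; apply: le_measure; rewrite ?inE.
Qed.

Lemma pr_le1 A : measurable A -> pr A <= 1.
Proof. by move=> mA; rewrite -lee_fin -prE//; exact: probability_le1. Qed.

Lemma pr_setT : pr setT = 1. Proof. by rewrite /pr probability_setT. Qed.

Lemma pr_setU A B : measurable A -> measurable B -> A `&` B `<=` set0 ->
  pr (A `|` B) = pr A + pr B.
Proof.
move=> mA mB; rewrite subset0 => AB.
by rewrite /pr measureU ?fineD// ?fin_num_measure.
Qed.

Lemma pr_setU_le A B : measurable A -> measurable B ->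
  pr (A `|` B) <= pr A + pr B.
Proof.
move=> mA mB; rewrite -lee_fin EFinD -!prE//; last exact: measurableU.
exact: measureU2.
Qed.

Lemma pr_setC A : measurable A -> pr (~` A) = 1 - pr A.
Proof.
move=> mA; have := pr_setU mA (measurableC mA).
by rewrite setICr setUv pr_setT => /(_ (@subset_refl _ _)); lra.
Qed.

Lemma pr_bigcup_le (A : nat -> set T) (c : R) : (forall n, measurable (A n)) ->
  {homo A : n m / (n <= m)%N >-> n `<=` m} ->
  (forall n, pr (A n) <= c) -> pr (\bigcup_n A n) <= c.
Proof.
move=> mA ndA Ac; have mU : measurable (\bigcup_n A n) by exact: bigcupT_measurable.
rewrite -lee_fin -prE//.
have C : (P \o A) x @[x --> \oo] --> P (\bigcup_n A n).
  apply: nondecreasing_cvg_mu => // m n mn; exact/subsetPset/ndA.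
rewrite -(cvg_lim (@ereal_hausdorff R) C).
apply: lime_le; first by apply/cvg_ex; eexists; exact: C.
by apply: nearW => n; rewrite /= prE// lee_fin.
Qed.

Lemma pr_bigsetU_le (A : nat -> set T) n : (forall k, measurable (A k)) ->
  pr (\big[setU/set0]_(k < n) A k) <= \sum_(k < n) pr (A k).
Proof.
move=> mA; elim: n => [|n ih]; first by rewrite !big_ord0 /pr measure0.
rewrite !big_ord_recr/= (le_trans (pr_setU_le _ _))// ?lerD2r//.
by apply: bigsetU_measurable.
Qed.

Lemma pr_bigsetU (A : nat -> set T) n : (forall k, measurable (A k)) ->
  (forall i j, (i < j)%N -> A i `&` A j `<=` set0) ->
  pr (\big[setU/set0]_(k < n) A k) = \sum_(k < n) pr (A k).
Proof.
move=> mA dA; elim: n => [|n ih]; first by rewrite !big_ord0 /pr measure0.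
rewrite !big_ord_recr/= pr_setU ?ih//; first exact: bigsetU_measurable.
move=> t [+ At]; rewrite -bigcup_mkord => -[k /= kn Akt].
by apply: (dA _ _ kn); split; [exact: Akt|exact: At].
Qed.

End pr.

Lemma pr_setX d d' (T : measurableType d) (T' : measurableType d')
    (R : realType) (P : probability T R) (P' : probability T' R) A B :
  measurable A -> measurable B -> pr (P \x P')%E (A `*` B) = pr P A * pr P' B.
Proof.
by move=> mA mB; rewrite -fineM ?fin_num_measure// -product_measure1E.
Qed.

Section tails.
Context {R : realType}.
Implicit Types H : probability R R.

Lemma tail_ge0 H x : 0 <= tail H x. Proof. exact: pr_ge0. Qed.

Lemma tail_le1 H x : tail H x <= 1. Proof. exact: pr_le1. Qed.

Lemma tailE H x : H `]x, +oo[%classic = (tail H x)%:E.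
Proof. by rewrite -prE. Qed.

Lemma le_tail H x y : x <= y -> tail H y <= tail H x.
Proof.
move=> xy; apply: le_pr => // z /=; rewrite !in_itv/= !andbT.
exact: le_lt_trans.
Qed.

Lemma tail_cvg0 H (eps : R) : 0 < eps -> \forall x \near +oo, tail H x <= eps.
Proof.
move=> e0.
have C : (H \o (fun n : nat => `]n%:R, +oo[%classic)) x @[x --> \oo] -->
    H (\bigcap_n `](n%:R : R), +oo[%classic).
  apply: nonincreasing_cvg_mu => //.
  - by rewrite (le_lt_trans (probability_le1 _ _)) ?ltry.
  - exact: bigcapT_measurable.
  - move=> m n mn; apply/subsetPset => x /=; rewrite !in_itv/= !andbT.
    by apply: le_lt_trans; rewrite ler_nat.
have H0 : H (\bigcap_n `](n%:R : R), +oo[%classic) = 0%E.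
  rewrite (_ : \bigcap_n _ = set0) ?measure0//; apply/seteqP; split=> // x /=.
  move=> /(_ (Num.truncn `|x|).+1 Logic.I); rewrite /= in_itv/= andbT ltNge.
  by move/negP; apply; apply: le_trans (ler_norm _) _; exact/ltW/truncnS_gt.
rewrite {}H0 in C.
move: C => /fine_cvgP[_ /cvgrPdist_le/(_ _ e0)] [N _ /(_ N (leqnn _))] /=.
rewrite sub0r normrN ger0_norm ?fine_ge0// => HN.
near=> x; apply: le_trans HN; apply: le_tail.
by near: x; apply: nbhs_pinfty_ge; rewrite num_real.
Unshelve. all: by end_near. Qed.

Section subexponential.
Variable H : probability R R.
Hypothesis Hsub : subexponential H.

Let conv x := tail (convolution H H) x.

Lemma conv_near (eps : R) : 0 < eps ->
  \forall x \near +oo, conv x <= (2 + eps) * tail H x.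
Proof.
move=> e0; have [_ Hpos /cvgrPdist_le Has] := Hsub.
have e2 : 0 < eps / 2 by rewrite divr_gt0.
near=> x.
have : `|1 - conv x / (2 * tail H x)| <= eps / 2 by near: x; exact: Has.
rewrite distrC => /(le_trans (ler_norm _)).
by rewrite lerBlDr ler_pdivrMr ?mulr_gt0// => h; apply: le_trans h _; nra.
Unshelve. all: by end_near. Qed.

(* The three parts of the half-plane x < z + z' that are kept here are those
   where z is above x, where z is at most y, and where z is in between. *)
Lemma conv_lower x y (D : set (R * R)) : measurable D -> 0 <= y <= x ->
  D `<=` [set q | y < q.1 <= x /\ x < q.1 + q.2] ->
  pr (H \x H)%E D <= conv x - 2 * tail H x + tail H y * tail H x.
Proof.
move=> mD /andP[y0 yx] Dsub; have [H0 _ _] := Hsub.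
pose A1 := `]x, +oo[%classic `*` `[(0:R), +oo[%classic.
pose A2 := `[0, y]%classic `*` `]x, +oo[%classic.
have mA1 : measurable A1 by exact: measurableX.
have mA2 : measurable A2 by exact: measurableX.
have HY : pr H `[0, y]%classic = 1 - tail H y.
  have : pr H `[0, +oo[%classic = pr H `[0, y]%classic + tail H y.
    rewrite (@itv_bndbnd_setU _ _ (BLeft 0) (BRight y) +oo%O)// pr_setU//.
    by move=> z/= []; rewrite !in_itv/= andbT => /andP[_ zy]; rewrite ltNge zy.
  by rewrite (congr1 fine H0 : pr H `[0, +oo[%classic = 1); lra.
have -> : conv x - 2 * tail H x + tail H y * tail H x =
    conv x - pr (H \x H)%E A1 - pr (H \x H)%E A2.
  rewrite !pr_setX// HY (congr1 fine H0 : pr H `[0, +oo[%classic = 1).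
  by rewrite -[pr H `]x, +oo[%classic]/(tail H x); ring.
pose C := (fun q : R * R => q.1 + q.2) @^-1` `]x, +oo[%classic.
have mC : measurable C.
  rewrite -[X in measurable X]setTI.
  by apply: (measurable_funD measurable_fst measurable_snd).
have convE : conv x = pr (H \x H)%E C by [].
have -> : forall u v w t : R, (u <= v - w - t) = (u + w + t <= v).
  by move=> u v w t; lra.
rewrite convE -pr_setU//; last first.
  move=> -[z z'] [/Dsub/= [/andP[_ zx] _]] []; rewrite /= in_itv/= andbT.
  by rewrite ltNge zx.
rewrite -pr_setU//; last 2 first.
- exact: measurableU.
- move=> -[z z'] [DA [/=]]; rewrite !in_itv/= => /andP[_ zy] _.
  case: DA => [/Dsub/= [/andP[yz _] _]|[/=]].
    by move: yz; rewrite ltNge zy.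
  by rewrite in_itv/= andbT ltNge (le_trans zy).
apply: le_pr => //; first by apply: measurableU => //; exact: measurableU.
move=> -[z z'] [[/Dsub/= [_ //]|[/=]]|[/=]].
- by rewrite /C/= in_itv/= andbT.
- by rewrite /C/= !in_itv/= !andbT; lra.
- by rewrite /C/= !in_itv/= !andbT => /andP[]; lra.
Qed.

(** On the product of []K, x]] and []x - K, +oo[] the coordinates sum to more than x. So
    [conv_lower] with y = K bounds (tail K - tail x) * tail (x - K) by about tail K * tail x, and
    tail K is positive. *)
Lemma long_tailed (K delta : R) : 0 <= K -> 0 < delta ->
  \forall x \near +oo, tail H (x - K) <= (1 + delta) * tail H x.
Proof.
move=> K0 d0; have [H0 Hpos _] := Hsub.
have hK := Hpos K.
(* With these two tolerances, (1 + delta / 2) * tail K is at most (1 + delta) * (tail K - tail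
   x). *)
have e0 : 0 < delta * tail H K / 2 by rewrite divr_gt0// mulr_gt0.
have e1 : 0 < delta * tail H K / (2 * (1 + delta)).
  by rewrite divr_gt0 ?mulr_gt0//; lra.
near=> x.
have xK : K <= x by near: x; apply: nbhs_pinfty_ge; rewrite num_real.
pose D := `]K, x]%classic `*` `]x - K, +oo[%classic.
have mD : measurable D by exact: measurableX.
have := @conv_lower x K D mD; rewrite K0 xK => /(_ isT).
have DD : D `<=` [set q | K < q.1 <= x /\ x < q.1 + q.2].
  move=> -[z y] []; rewrite /= !in_itv/= andbT => /andP[Kz zx] xz.
  by rewrite Kz zx; split => //; lra.
move=> /(_ DD).
have -> : pr (H \x H)%E D = (tail H K - tail H x) * tail H (x - K).
  rewrite pr_setX//; congr (_ * _).
  have : tail H K = pr H `]K, x]%classic + tail H x.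
    rewrite {1}/tail (@itv_bndbnd_setU _ _ (BRight K) (BRight x) +oo%O)//.
    rewrite -/(pr _ _) pr_setU//.
    by move=> z/= []; rewrite !in_itv/= andbT => /andP[_ zy]; rewrite ltNge zy.
  by rewrite /tail -/(pr _ _); lra.
have h1 : conv x <= (2 + delta * tail H K / 2) * tail H x.
  by near: x; exact: conv_near.
have h2 : tail H x <= delta * tail H K / (2 * (1 + delta)).
  by near: x; exact: tail_cvg0.
have hx := Hpos x.
rewrite ler_pdivlMr in h2; last by lra.
move=> h3; have h4 : (tail H K - tail H x) * tail H (x - K) <=
    (tail H K + delta * tail H K / 2) * tail H x by nra.
have h5 : 0 < tail H K - tail H x by nra.
rewrite -(ler_pM2l h5); apply: le_trans h4 _.
by rewrite mulrA ler_pM2r//; nra.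
Unshelve. all: by end_near. Qed.

(** Apply [conv_lower] with y = A, and [conv_near] with eps = tail A: each contributes tail A * tail
    x. For large A, sums in which neither term alone accounts for the excess over x thus become
    negligible. *)
Lemma conv_middle (A : R) : 0 <= A -> \forall x \near +oo,
  forall D : set (R * R), measurable D ->
  D `<=` [set q | A < q.1 <= x - A /\ x < q.1 + q.2] ->
  pr (H \x H)%E D <= 2 * tail H A * tail H x.
Proof.
move=> A0; have [_ Hpos _] := Hsub; have hA := Hpos A.
near=> x => D mD Dsub.
have xA : A <= x by near: x; apply: nbhs_pinfty_ge; rewrite num_real.
have := @conv_lower x A D mD; rewrite A0 xA => /(_ isT).
have DD : D `<=` [set q | A < q.1 <= x /\ x < q.1 + q.2].
  by move=> q /Dsub/= [/andP[Az zx] ?]; rewrite Az /=; split => //; lra.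
move=> /(_ DD) /le_trans; apply.
have h1 : conv x <= (2 + tail H A) * tail H x by near: x; exact: conv_near.
by nra.
Unshelve. all: by end_near. Qed.

End subexponential.

(** Where tail H is at most 1/2 the minimum with 1 is inactive, so the increment is the integral of
    the nonincreasing tail of [F] over []x, x + b]]. The threshold on x is uniform in b. *)
Lemma integrated_tail_increment (F H : probability R R) :
  integrated_tail_of F H -> \forall x \near +oo, forall b : R, 0 <= b ->
  b * tail F (x + b) <= tail H x - tail H (x + b) <= b * tail F x.
Proof.
move=> [_ HE]; near=> x => b b0.
have x0 : 0 <= x by near: x; apply: nbhs_pinfty_ge; rewrite num_real.
have hx : tail H x <= 1 / 2 by near: x; apply: tail_cvg0; lra.
have mF : measurable_fun setT (fun y : R => F `]y, +oo[%classic).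
  apply: (eq_measurable_fun (EFin \o tail F : R -> \bar R)).
    by move=> y _; rewrite /= tailE.
  apply/measurable_EFinP; apply: nonincreasing_measurable => // y z yz.
  exact: le_tail.
have E y : x <= y -> ((tail H y)%:E =
    \int[lebesgue_measure]_(z in `]y, +oo[%classic) F `]z, +oo[%classic)%E.
  move=> xy; rewrite -tailE HE; last exact: le_trans xy.
  have := HE y (le_trans x0 xy); rewrite minEle; case: ifP => // _ h.
  have := le_tail H xy; rewrite -lee_fin -tailE h => h'.
  by exfalso; move: h' {h}; rewrite lee_fin; lra.
have Eb : (tail H x)%:E = ((\int[lebesgue_measure]_(z in `]x, (x + b)%R]%classic)
    F `]z, +oo[%classic) + (tail H (x + b))%:E)%E.
  rewrite !E ?lexx ?lerDl// -ge0_integral_setU//=.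
  - by rewrite -itv_bndbnd_setU// bnd_simp lerDl.
  - exact: measurable_funTS.
  - rewrite disj_set2E; apply/eqP/seteqP; split=> z//=.
    by rewrite !in_itv/= andbT => -[/andP[_ zy]]; rewrite ltNge zy.
have mu_itv : lebesgue_measure (`]x, (x + b)%R]%classic : set R) = b%:E.
  rewrite lebesgue_measure_itv/= lte_fin ltrDl; case: ifPn => [_|].
    by rewrite -EFinB addrC addKr.
  by rewrite -leNgt => b0'; congr EFin; apply/le_anti/andP.
have [lo up] : (b%:E * (tail F (x + b))%:E <= \int[lebesgue_measure]_(z in
    `]x, (x + b)%R]) F `]z, +oo[%classic)%E /\
    (\int[lebesgue_measure]_(z in `]x, (x + b)%R]%classic) F `]z, +oo[%classic
      <= b%:E * (tail F x)%:E)%E.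
  rewrite -mu_itv; split; rewrite muleC -integral_cst//.
    apply: ge0_le_integral => //.
    - by move=> *; rewrite lee_fin tail_ge0.
    - exact: measurable_funTS.
    - by move=> z /=; rewrite in_itv/= => /andP[_ zb]; rewrite tailE lee_fin le_tail.
  apply: ge0_le_integral => //.
  - exact: measurable_funTS.
  - move=> z /=; rewrite in_itv/= => /andP[xz _].
    by rewrite tailE lee_fin le_tail// ltW.
have Ifin : (\int[lebesgue_measure]_(z in `]x, (x + b)%R]%classic)
    F `]z, +oo[%classic)%E \is a fin_num.
  rewrite ge0_fin_numE; last exact: integral_ge0.
  by apply: le_lt_trans up _; rewrite -EFinM ltry.
move: Eb lo up; rewrite -(fineK Ifin) -!EFinM -EFinD !lee_fin => -[->] lo up.
by rewrite addrK lo up.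
Unshelve. all: by end_near. Qed.

End tails.

(** * Comparison of product probabilities by sections *)

Section fubini_pr.
Context {d d1 d2 : measure_display} {S : measurableType d}
  {T1 : measurableType d1} {T2 : measurableType d2} {R : realType}.
Variables (Q : probability S R) (P1 : probability T1 R) (P2 : probability T2 R).

(** Integrates a bound valid for each fixed past [s]; it serves to trade the walk restarted after
    [s] for an independent variable with law [H]. *)
Lemma pr_prod_le_xsection (D1 : set (S * T1)) (D2 : set (S * T2)) (c : R) :
  measurable D1 -> measurable D2 -> 0 <= c ->
  (forall s, pr P1 (xsection D1 s) <= c * pr P2 (xsection D2 s)) ->
  pr (Q \x P1)%E D1 <= c * pr (Q \x P2)%E D2.
Proof.
move=> mD1 mD2 c0 H; rewrite -lee_fin EFinM.
have -> : (pr (Q \x P1)%E D1)%:E = (\int[Q]_s (P1 \o xsection D1) s)%E.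
  exact: esym (prE _ _).
have -> : (pr (Q \x P2)%E D2)%:E = (\int[Q]_s (P2 \o xsection D2) s)%E.
  exact: esym (prE _ _).
rewrite -ge0_integralZl_EFin//; last exact: measurable_fun_xsection.
apply: ge0_le_integral => //.
- exact: measurable_fun_xsection.
- by apply: measurable_funeM; exact: measurable_fun_xsection.
- move=> s _ /=; rewrite (prE P1) ?(prE P2); [|exact: measurable_xsection..].
  by rewrite -EFinM lee_fin.
Qed.

(** Here the fixed coordinate is the second one, hence the product integrated in the other order.
    The indicator term covers those z for which only a constant bound is available. *)
Lemma pr_prod_le_ysection (D1 : set (S * T1)) (D2 : set (T1 * T2)) (B : set T1)
    (b c : R) :
  measurable D1 -> measurable D2 -> measurable B -> 0 <= b -> 0 <= c ->
  (forall z, pr Q (ysection D1 z) <= b * \1_B z + c * pr P2 (xsection D2 z)) ->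
  pr (Q \x P1)%E D1 <= b * pr P1 B + c * pr (P1 \x P2)%E D2.
Proof.
move=> mD1 mD2 mB b0 c0 H; rewrite -lee_fin EFinD !EFinM -(prE P1)//.
have -> : (pr (Q \x P1)%E D1)%:E = (\int[P1]_z (Q \o ysection D1) z)%E.
  rewrite -[LHS](prE (Q \x P1)%E mD1); transitivity ((Q \x^ P1)%E D1) => //.
  by apply: product_measure_unique => //= ? ? ? ?; rewrite product_measure2E.
have -> : (pr (P1 \x P2)%E D2)%:E = (\int[P1]_z (P2 \o xsection D2) z)%E.
  exact: esym (prE _ _).
rewrite -ge0_integralZl_EFin//; last exact: measurable_fun_xsection.
have -> : (b%:E * P1 B = \int[P1]_z (b%:E * (\1_B z)%:E))%E.
  rewrite ge0_integralZl_EFin//; last first.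
    by apply/measurable_EFinP; exact: measurable_indic.
  by rewrite integral_indic// setIT.
have mb : measurable_fun setT (fun z => (b%:E * (\1_B z)%:E)%E).
  by apply: measurable_funeM; apply/measurable_EFinP; exact: measurable_indic.
have mc : measurable_fun setT (fun z => (c%:E * (P2 \o xsection D2) z)%E).
  by apply: measurable_funeM; exact: measurable_fun_xsection.
rewrite -ge0_integralD//; last 2 first.
- by move=> z _; rewrite mule_ge0// lee_fin.
- by move=> z _; rewrite mule_ge0// lee_fin.
apply: ge0_le_integral => //.
- exact: measurable_fun_ysection.
- exact: emeasurable_funD.
- move=> z _ /=; rewrite (prE Q); last exact: measurable_ysection.
  rewrite (prE P2); last exact: measurable_xsection.
  by rewrite -!EFinM -EFinD lee_fin.
Qed.

End fubini_pr.

(** * Upper bound for the probability of exceedance *)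

Lemma asymp_near (R : realType) (f g : R -> R) (eta : R) :
  asymp f g -> (forall x, 0 <= g x) -> 0 < eta < 1 ->
  \forall x \near +oo, 0 < g x /\ (1 - eta) * g x <= f x <= (1 + eta) * g x.
Proof.
move=> + g0 /andP[e0 e1]; rewrite /asymp => /cvgrPdist_le/(_ _ e0); apply: filterS => x.
(* A quotient by 0 is 0, at distance 1 from the limit, which eta < 1 excludes. *)
have [gx|gx] := eqVneq (g x) 0.
  by rewrite gx invr0 mulr0 subr0 normr1; lra.
have {}gx : 0 < g x by rewrite lt_neqAle eq_sym gx g0.
by rewrite ler_distlC ler_pdivlMr// ler_pdivrMr.
Qed.

Section upper_bound.
Context {dE : measure_display} {E : measurableType dE} {R : realType}.
Variables (p : probability E R) (Q : probability (seq_space E) R).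
Hypothesis Qiid : iid_law p Q.
Variables (inc : E -> R) (sup : E -> \bar R).
Hypotheses (minc : measurable_fun setT inc) (msup : measurable_fun setT sup).
Hypothesis inc_le_sup : forall c, ((inc c)%:E <= sup c)%E.
Hypothesis sup_ge0 : forall c, (0 <= sup c)%E.

Local Notation S := (partial_sum inc).

(** This is S_n + sup > y; the partial sum is moved to the left because [sup] may be infinite. *)
Definition cycle_exceeds (y : R) n (s : seq_space E) : Prop :=
  ((y - S n s)%:E < sup (s n))%E.

Definition exceeds_before (y : R) N (s : seq_space E) : Prop :=
  exists2 n, (n < N)%N & cycle_exceeds y n s.

Lemma cycle_exceeds_le y y' n s : y' <= y ->
  cycle_exceeds y n s -> cycle_exceeds y' n s.
Proof.
by move=> yy'; apply: le_lt_trans; rewrite lee_fin lerD2r.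
Qed.

Lemma measurable_cycle_exceeds d (T : measurableType d) (Y : T -> R) n
    (f : T -> seq_space E) :
  measurable_fun setT Y -> measurable_fun setT f ->
  measurable [set t | cycle_exceeds (Y t) n (f t)].
Proof.
move=> mY mf; rewrite -[X in measurable X]setTI.
apply: measurable_lte => //.
  apply/measurable_EFinP; apply: measurable_funB => //.
  exact: (measurableT_comp (measurable_partial_sum minc n) mf).
apply: (measurableT_comp msup).
exact: (measurableT_comp (measurable_coord n) mf).
Qed.

Lemma measurable_exceeds_before d (T : measurableType d) (Y : T -> R) N
    (f : T -> seq_space E) :
  measurable_fun setT Y -> measurable_fun setT f ->
  measurable [set t | exceeds_before (Y t) N (f t)].
Proof.
move=> mY mf; rewrite (_ : [set t | _] =
    \bigcup_(n in `I_N) [set t | cycle_exceeds (Y t) n (f t)]).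
  by apply: bigcup_measurable => n _; exact: measurable_cycle_exceeds.
by apply/seteqP; split=> [t [n]|t [n]]; exists n.
Qed.

(** When S_n <= z, cycle n has to climb more than y - z by itself, and the law of cycle n is [p]. *)
Lemma pr_cycle_exceeds_le (y z : R) n (A : set (seq_space E)) : measurable A ->
  A `<=` [set s | cycle_exceeds y n s /\ S n s <= z] ->
  pr Q A <= pr p [set c | ((y - z)%:E < sup c)%E].
Proof.
move=> mA Asub.
have mB : measurable [set c | ((y - z)%:E < sup c)%E].
  by rewrite -[X in measurable X]setTI; exact: emeasurable_fun_o_infty.
rewrite /pr -(iid_coord Qiid n mB); apply: le_pr => //.
  by rewrite -[X in measurable X]setTI; exact: measurable_coord.
move=> s /Asub [sn Sz] /=; apply: le_lt_trans sn.
by rewrite lee_fin; lra.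
Qed.

Variables (F H : probability R R).
Hypothesis F_tail :
  asymp (fun x => pr p [set c | (x%:E < sup c)%E]) (tail F).
Hypotheses (HF : integrated_tail_of F H) (Hsub : subexponential H).

Let Hpos x : 0 < tail H x. Proof. by have [_ + _] := Hsub. Qed.

(* Summing [integrated_tail_increment] along an arithmetic progression. *)
Lemma sum_tail_le (b K delta : R) : 0 < b -> 0 <= K -> 0 < delta ->
  \forall y \near +oo, forall N,
  \sum_(n < N) pr p [set c | ((y - K + n%:R * b)%:E < sup c)%E] <=
  (1 + delta) / b * tail H y.
Proof.
move=> b0 K0 d0.
(* Two factors 1 + eta are spent, one on passing from [sup] to [F], one on moving the argument by K
   + b; their product is at most 1 + delta. *)
pose eta := delta / (2 + delta).
have eta0 : 0 < eta by rewrite divr_gt0//; lra.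
have eta1 : (1 + eta) * (1 + eta) <= 1 + delta.
  have : eta * (2 + delta) = delta by rewrite /eta divfK//; lra.
  have : eta <= 1 by rewrite /eta ler_pdivrMr; lra.
  nra.
have eta01 : 0 < eta < 1 by rewrite eta0 /eta ltr_pdivrMr; lra.
have [M1 [_ HM1]] := asymp_near F_tail (tail_ge0 F) eta01.
have [M2 [_ HM2]] := integrated_tail_increment HF.
have Kb : 0 <= K + b by lra.
near=> y => N.
have yM1 : M1 + K < y by near: y; apply: nbhs_pinfty_gt; rewrite num_real.
have yM2 : M2 + K + b < y by near: y; apply: nbhs_pinfty_gt; rewrite num_real.
have : tail H (y - (K + b)) <= (1 + eta) * tail H y.
  by near: y; exact: long_tailed.
set y0 := y - (K + b) => hy.
(* The additional shift by b places each argument at the right end of an interval of length b, where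
   b times the tail of [F] is below the increment of tail H. *)
have step n : pr p [set c | ((y - K + n%:R * b)%:E < sup c)%E] <=
    (1 + eta) / b * (tail H (y0 + n%:R * b) - tail H (y0 + n.+1%:R * b)).
  have nb : 0 <= n%:R * b by rewrite mulr_ge0// ltW.
  set z := y - K + n%:R * b.
  have zE : y0 + n.+1%:R * b = z by rewrite /y0 /z -[n.+1]addn1 natrD; lra.
  have zE' : y0 + n%:R * b + b = z by rewrite /y0 /z; lra.
  have /HM1 [_ /andP[_ h3]] : M1 < z by rewrite /z; lra.
  have /HM2 : M2 < y0 + n%:R * b by rewrite /y0; lra.
  move=> /(_ _ (ltW b0)) /andP[+ _]; rewrite zE' zE => h2.
  apply: le_trans h3 _; rewrite -mulrA ler_pM2l; last by lra.
  by rewrite mulrC ler_pdivlMr// mulrC.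
apply: (@le_trans _ _ (\sum_(i < N) ((1 + eta) / b *
    (tail H (y0 + i%:R * b) - tail H (y0 + i.+1%:R * b))))).
  by apply: ler_sum => i _; exact: step.
rewrite -mulr_sumr.
have -> : \sum_(i < N) (tail H (y0 + i%:R * b) - tail H (y0 + i.+1%:R * b)) =
    tail H y0 - tail H (y0 + N%:R * b).
  elim: N => [|N ih]; first by rewrite big_ord0 mul0r addr0 subrr.
  by rewrite big_ord_recr/= ih; lra.
apply: (@le_trans _ _ ((1 + eta) / b * tail H y0)).
  rewrite ler_pM2l; last by rewrite divr_gt0//; lra.
  by have := tail_ge0 H (y0 + N%:R * b); lra.
apply: (@le_trans _ _ ((1 + eta) / b * ((1 + eta) * tail H y))).
  by rewrite ler_pM2l// divr_gt0//; lra.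
rewrite mulrA ler_pM2r// mulrAC ler_pM2r ?invr_gt0//.
Unshelve. all: by end_near. Qed.
Variable a : R.
Hypotheses (a0 : 0 < a) (int_inc : p.-integrable setT (EFin \o inc)).
Hypothesis mean_inc : (\int[p]_c (inc c)%:E = (- a)%:E)%E.

(** An intermediate slope b' separates two causes. The walk rising above K1 - n b' is controlled by
    [iid_walk_bound]; otherwise some cycle has supremum above y + n (b' - b), and these
    probabilities are summed by [sum_tail_le]. *)
Lemma crossing_small (b eta : R) : 0 < b < a -> 0 < eta ->
  exists2 K, 0 <= K & forall N,
  pr Q [set s | exists2 n, (n < N)%N & cycle_exceeds (K - n%:R * b) n s] <= eta.
Proof.
move=> /andP[b0 ba] e0.
pose b' := (a + b) / 2.
have b'a : b' < a by rewrite /b'; lra.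
have bb' : 0 < b' - b by rewrite /b'; lra.
pose f c := inc c + b'.
have mf : measurable_fun setT f by exact: measurable_funD.
have intb : p.-integrable setT (EFin \o (fun=> b')).
  exact: (finite_measure_integrable_cst p b').
have intf : p.-integrable setT (EFin \o f).
  have := integrableD measurableT int_inc intb.
  exact: eq_integrable.
have f0 : (\int[p]_c (f c)%:E < 0)%E.
  under eq_integral do rewrite EFinD.
  rewrite integralD_EFin// mean_inc integral_cst//.
  by rewrite [X in (_ * X)%E]probability_setT mule1 -EFinD lte_fin; lra.
have fS n s : partial_sum f n s = S n s + n%:R * b'.
  by rewrite /partial_sum big_split/= sumr_const card_ord mulr_natl.
have e2 : 0 < eta / 2 by lra.
have [K1 K10 HK1] := iid_walk_bound Qiid mf intf f0 e2.
(* [sum_tail_le] with delta = 1 has the factor 2 / (b' - b); this tolerance on tail H y makes the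
   sum at most eta / 2. *)
have e3 : 0 < eta / 2 * (b' - b) / 2 by rewrite divr_gt0// mulr_gt0.
have [y [y0 Hy1 Hy2]] : exists y, [/\ 0 <= y, tail H y <= eta / 2 * (b' - b) / 2
    & forall N, \sum_(n < N) pr p [set c | ((y - 0 + n%:R * (b' - b))%:E < sup c)%E]
        <= (1 + 1) / (b' - b) * tail H y].
  near (+oo : set_system R) => y; exists y; split.
  - by near: y; apply: nbhs_pinfty_ge; rewrite num_real.
  - by near: y; exact: tail_cvg0.
  - by near: y; exact: sum_tail_le.
exists (K1 + y); first lra; move=> N.
pose B n := [set s | cycle_exceeds (K1 + y - n%:R * b) n s /\
  S n s <= K1 - n%:R * b'].
have mB n : measurable (B n).
  apply: measurableI; first exact: measurable_cycle_exceeds.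
  rewrite -[X in measurable X]setTI.
  exact: (measurable_fun_ler (measurable_partial_sum minc n) (measurable_cst _)).
have mW := measurable_exceed mf K1.
apply: (@le_trans _ _ (pr Q ([set s | exists n, (K1 < partial_sum f n s)%R] `|`
    \big[setU/set0]_(n < N) B n))).
  apply: le_pr.
  - rewrite (_ : [set s | _] = \bigcup_(n in `I_N)
       [set s | cycle_exceeds (K1 + y - n%:R * b) n s]).
      by apply: bigcup_measurable => n _; exact: measurable_cycle_exceeds.
    by apply/seteqP; split=> [t [n]|t [n]]; exists n.
  - by apply: measurableU => //; exact: bigsetU_measurable.
  - move=> s [n nN sn]; have [Kn|Kn] := ltP K1 (partial_sum f n s).
      by left; exists n.
    right; rewrite -bigcup_mkord; exists n => //; split => //.
    by move: Kn; rewrite fS; lra.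
apply: le_trans (pr_setU_le _ _ _) _ => //; first exact: bigsetU_measurable.
have h1 : pr Q [set s | exists n, K1 < partial_sum f n s] <= eta / 2.
  by rewrite -lee_fin -prE.
have h2 : pr Q (\big[setU/set0]_(n < N) B n) <= eta / 2.
  apply: le_trans (pr_bigsetU_le _ _ mB) _.
  apply: le_trans (_ : \sum_(n < N)
    pr p [set c | ((y - 0 + n%:R * (b' - b))%:E < sup c)%E] <= _).
    apply: ler_sum => n _.
    have -> : y - 0 + n%:R * (b' - b) =
      (K1 + y - n%:R * b) - (K1 - n%:R * b') by ring.
    exact: (@pr_cycle_exceeds_le _ _ n).
  apply: le_trans (Hy2 N) _.
  rewrite mulrAC ler_pdivrMr//; lra.
lra.
Unshelve. all: by end_near. Qed.

End upper_bound.

(** * Decomposition at the first crossing of a falling line *)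

Section first_crossing.
Context {dE : measure_display} {E : measurableType dE} {R : realType}.
Variables (p : probability E R) (Q : probability (seq_space E) R).
Hypothesis Qiid : iid_law p Q.
Variables (inc : E -> R) (sup : E -> \bar R).
Hypotheses (minc : measurable_fun setT inc) (msup : measurable_fun setT sup).
Hypothesis inc_le_sup : forall c, ((inc c)%:E <= sup c)%E.
Hypothesis sup_ge0 : forall c, (0 <= sup c)%E.
Variables (K b : R).
Hypotheses (K0 : 0 <= K) (b0 : 0 <= b).

Local Notation S := (partial_sum inc).
Local Notation exceeds := (cycle_exceeds inc sup).
Local Notation exceeds_before := (exceeds_before inc sup).

Definition first_crossing n (s : seq_space E) : Prop :=
  exceeds (K - n%:R * b) n s /\
  forall j, (j < n)%N -> ~ exceeds (K - j%:R * b) j s.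

Lemma first_crossing_exists n s : exceeds (K - n%:R * b) n s ->
  exists2 m, (m <= n)%N & first_crossing m s.
Proof.
elim/ltn_ind: n => n ih sn.
have [[m mn sm]|noex] := pselect
    (exists2 m, (m < n)%N & exceeds (K - m%:R * b) m s).
  by have [k km fk] := ih m mn sm; exists k => //; exact: leq_trans km (ltnW mn).
by exists n => //; split => // j jn sj; apply: noex; exists j.
Qed.

Lemma first_crossing_inj m n s : (m < n)%N -> first_crossing m s ->
  first_crossing n s -> False.
Proof. by move=> mn [sm _] [_ /(_ m mn)]. Qed.

(** For n > 0, cycle n - 1 did not cross, so its end value satisfies S_n <= K - (n - 1) b; this is
    the origin of K + b. For n = 0 the walk is at 0. *)
Lemma first_crossing_le n s : first_crossing n s -> S n s <= K + b - n%:R * b.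
Proof.
case: n => [|n] [_ sn]; first by rewrite /partial_sum big_ord0 mul0r subr0 addr_ge0.
have /negP := sn n (ltnSn n).
rewrite -leNgt => /(le_trans (inc_le_sup _)); rewrite lee_fin.
rewrite /partial_sum big_ord_recr/= -/(partial_sum inc n s).
by rewrite -[n.+1]addn1 natrD; lra.
Qed.

Lemma measurable_first_crossing n : measurable [set s | first_crossing n s].
Proof.
rewrite (_ : [set s | _] = [set s | exceeds (K - n%:R * b) n s] `&`
    \bigcap_(j in `I_n) ~` [set s | exceeds (K - j%:R * b) j s]).
  apply: measurableI; first exact: measurable_cycle_exceeds.
  apply: bigcap_measurableType => j _; apply: measurableC.
  exact: measurable_cycle_exceeds.
by apply/seteqP; split=> [s [sn sj]|s [sn sj]]; split => // j /sj.
Qed.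

Lemma eq_partial_sum n (s s' : seq_space E) :
  (forall k, (k < n)%N -> s k = s' k) -> S n s = S n s'.
Proof. by move=> ss'; apply: eq_bigr => i _; rewrite ss'. Qed.

Lemma eq_cycle_exceeds y n (s s' : seq_space E) :
  (forall k, (k <= n)%N -> s k = s' k) -> exceeds y n s -> exceeds y n s'.
Proof.
move=> ss'; rewrite /cycle_exceeds (@eq_partial_sum n s s') ?ss'// => k kn.
by rewrite ss'// ltnW.
Qed.

Lemma eq_first_crossing n (s s' : seq_space E) :
  (forall k, (k <= n)%N -> s k = s' k) -> first_crossing n s ->
  first_crossing n s'.
Proof.
move=> ss' [sn sj]; split; first exact: eq_cycle_exceeds sn.
move=> j jn s'j; apply: (sj j jn); apply: eq_cycle_exceeds s'j => k kj.
by rewrite ss'// (leq_trans kj)// ltnW.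
Qed.

(** At the first crossing S_n <= K + b - n b, so the crossing cycle needs a supremum above y - (K +
    b) + n b to reach y. By [sum_tail_le] the sum is of order tail H y / b. *)
Lemma pr_overshoot_le y N :
  pr Q [set s | exists2 n, (n < N)%N & first_crossing n s /\ exceeds y n s] <=
  \sum_(n < N) pr p [set c | ((y - (K + b) + n%:R * b)%:E < sup c)%E].
Proof.
pose B n := [set s | first_crossing n s /\ exceeds y n s].
have mB n : measurable (B n : set (seq_space E)).
  apply: measurableI; first exact: measurable_first_crossing.
  exact: measurable_cycle_exceeds.
rewrite (_ : [set s | _] = \big[setU/set0]_(n < N) B n); last first.
  by rewrite -bigcup_mkord; apply/seteqP; split=> [s [n]|s [n]]; exists n.
apply: le_trans (pr_bigsetU_le _ _ mB) _; apply: ler_sum => n _.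
have -> : y - (K + b) + n%:R * b = y - (K + b - n%:R * b) by ring.
apply: (@pr_cycle_exceeds_le _ _ _ _ _ Qiid inc sup msup _ _ n) => //.
by move=> s [sn sy]; split => //; exact: first_crossing_le.
Qed.

Variables (H : probability R R) (A x j gamma c mid : R) (N : nat).
Hypotheses (A0 : 0 <= A) (Ax : A <= x - A) (Kx : K <= x) (j0 : 0 <= j)
  (c0 : 0 <= c).
Hypothesis crossing_le : forall n, pr Q [set s | exists2 m, (m < n)%N &
  exceeds (K - m%:R * b) m s] <= gamma.
Hypothesis overshoot_le : forall y n, A <= y ->
  \sum_(m < n) pr p [set c | ((y - (K + b) + m%:R * b)%:E < sup c)%E] <=
  j * tail H y.
Hypothesis middle_le : forall D : set (R * R), measurable D ->
  D `<=` [set q | A < q.1 <= x - A /\ x < q.1 + q.2] ->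
  pr (H \x H)%E D <= mid.
Hypothesis bound : forall y, A <= y ->
  pr Q [set s | exceeds_before y N s] <= c * tail H y.

(** The highest level of cycle n, truncated at 0; on [G n] the supremum is finite, so [fine] keeps
    its value. *)
Let phi n (s : seq_space E) := Num.max 0 (S n s + fine (sup (s n))).

Let G n : set (seq_space E) :=
  [set s | first_crossing n s /\ ~ exceeds (x - A) n s].

Let C n : set (seq_space E) :=
  [set s | G n s /\ exceeds_before (x - phi n s) N (shift n.+1 s)].

(** [C n] with the restarted walk replaced by an independent variable with law [H]. *)
Let D n : set (seq_space E * R) := [set q | G n q.1 /\ x - phi n q.1 < q.2].

Let mphi n : measurable_fun setT (phi n).
Proof.
apply: measurable_maxr => //; apply: measurable_funD.
  exact: measurable_partial_sum.
apply: measurableT_comp => //.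
exact: (measurableT_comp msup (measurable_coord n)).
Qed.

Let mG n : measurable (G n).
Proof.
apply: measurableI; first exact: measurable_first_crossing.
by apply: measurableC; exact: measurable_cycle_exceeds.
Qed.

Let mC n : measurable (C n).
Proof.
apply: measurableI => //; apply: measurable_exceeds_before => //.
  exact: measurable_funB.
exact: measurable_shift.
Qed.

Let mD n : measurable (D n).
Proof.
rewrite (_ : D n = (G n `*` setT) `&` [set q | x - phi n q.1 < q.2]).
  apply: measurableI; first exact: measurableX.
  rewrite -[X in measurable X]setTI.
  apply: (measurable_fun_ltr _ measurable_snd) => //.
  by apply: measurable_funB => //; exact: (measurableT_comp (mphi n) measurable_fst).
by apply/seteqP; split=> [[s z] [? ?]|[s z] [[? _] ?]].
Qed.

Let G_fin n s : G n s -> 0 <= x - A /\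
  [/\ S n s + fine (sup (s n)) <= phi n s, phi n s <= x - A &
   sup (s n) = (fine (sup (s n)))%:E].
Proof.
move=> [_ /negP]; rewrite -leNgt => supn.
have supE : sup (s n) = (fine (sup (s n)))%:E.
  rewrite fineK// ge0_fin_numE//; apply: le_lt_trans supn _; exact: ltry.
move: supn; rewrite supE lee_fin => supn; rewrite -supE.
have x0 : 0 <= x - A by exact: le_trans Ax.
split => //; split => //.
  by rewrite le_max lexx orbT.
by rewrite ge_max x0 /=; lra.
Qed.

(** Given the first n + 1 cycles, the restarted walk has law [Q] and must exceed x - phi. On [G n]
    this level is at least A, so [bound] applies to each section. *)
Let prC n : pr Q (C n) <= c * pr (Q \x H)%E (D n).
Proof.
have -> : pr Q (C n) = pr (Q \x Q)%E (splice n.+1 @^-1` C n).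
  by rewrite /pr (iid_splice Qiid n.+1).
have mC' : measurable (splice n.+1 @^-1` C n).
  by rewrite -[X in measurable X]setTI; exact: measurable_splice.
apply: pr_prod_le_xsection => // s.
have splE s' k : (k <= n)%N -> splice n.+1 (s, s') k = s k.
  by rewrite /splice ltnS => ->.
have phiE s' : phi n (splice n.+1 (s, s')) = phi n s.
  rewrite /phi splE// (@eq_partial_sum n _ s)// => k kn.
  by rewrite splE// ltnW.
have GE s' : G n (splice n.+1 (s, s')) <-> G n s.
  split=> -[fs es]; split.
  - by apply: eq_first_crossing fs => k kn; rewrite splE.
  - by move=> es'; apply: es; apply: eq_cycle_exceeds es' => k kn; rewrite splE.
  - by apply: eq_first_crossing fs => k kn; rewrite splE.
  - by move=> es'; apply: es; apply: eq_cycle_exceeds es' => k kn; rewrite splE.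
have [Gs|Gs] := pselect (G n s); last first.
  rewrite (_ : xsection _ s = set0); last first.
    rewrite xsectionE; apply/seteqP; split=> // s' /= [].
    by rewrite GE.
  by rewrite /pr measure0 mulr_ge0// fine_ge0.
have -> : xsection (splice n.+1 @^-1` C n) s =
    [set s' | exceeds_before (x - phi n s) N s'].
  rewrite xsectionE; apply/seteqP; split=> s' /=.
    by move=> []; rewrite phiE shift_splice.
  by move=> h; split; [rewrite GE|rewrite phiE shift_splice].
have -> : xsection (D n) s = `]x - phi n s, +oo[%classic.
  rewrite xsectionE; apply/seteqP; split=> z /=; rewrite in_itv/= andbT.
    by case.
  by move=> ?; split.
have [_ [_ ? _]] := G_fin Gs.
by apply: bound; lra.
Qed.

(** Slice by the value z of the variable with law [H]. Values z <= A are impossible as phi <= x - A.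
    For A < z <= x - A the crossing cycle reaches above x - z, and integrating j * tail H (x - z)
    gives the middle part of the convolution. For z > x - A only the fact of crossing is used, at
    cost gamma. *)
Let prD : pr (Q \x H)%E (\big[setU/set0]_(n < N.+1) D n) <=
  gamma * tail H (x - A) + j * mid.
Proof.
pose D' : set (R * R) := [set q | A < q.1 <= x - A /\ x < q.1 + q.2].
have mD' : measurable D'.
  rewrite (_ : D' = (`]A, x - A]%classic `*` setT) `&`
      [set q | x < q.1 + q.2]); last first.
    apply/seteqP; split=> -[z z'] /=; rewrite in_itv/=.
      by move=> [zA xz].
    by move=> [[zA _] xz].
  apply: measurableI; first exact: measurableX.
  rewrite -[X in measurable X]setTI.
  apply: measurable_fun_ltr => //; apply: measurable_funD.
    exact: measurable_fst.
  exact: measurable_snd.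
have mU : measurable (\big[setU/set0]_(n < N.+1) D n).
  exact: bigsetU_measurable.
have gamma0 : 0 <= gamma by apply: le_trans (crossing_le 0); exact: pr_ge0.
apply: (@le_trans _ _ (gamma * tail H (x - A) + j * pr (H \x H)%E D')); last first.
  by rewrite lerD2l ler_wpM2l// middle_le.
apply: pr_prod_le_ysection => // z.
have mY : measurable (ysection (\big[setU/set0]_(n < N.+1) D n) z).
  exact: measurable_ysection.
have Dz s : ysection (\big[setU/set0]_(n < N.+1) D n) z s ->
    exists2 n, (n < N.+1)%N & G n s /\ x - phi n s < z.
  by rewrite ysectionE -bigcup_mkord => -[n nN ?]; exists n.
have [zA|Az] := leP z A.
  rewrite (_ : ysection _ z = set0); last first.
    apply/seteqP; split=> // s /Dz [n _ [Gs]].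
    by have [_ [_ ? _]] := G_fin Gs; lra.
  by rewrite {1}/pr measure0 addr_ge0// mulr_ge0// pr_ge0.
have mW y : measurable [set s | exists2 n, (n < N.+1)%N &
    first_crossing n s /\ exceeds y n s].
  rewrite (_ : [set s | _] = \bigcup_(n in `I_N.+1)
       ([set s | first_crossing n s] `&` [set s | exceeds y n s])).
    apply: bigcup_measurable => n _; apply: measurableI.
      exact: measurable_first_crossing.
    exact: measurable_cycle_exceeds.
  by apply/seteqP; split=> [t [n]|t [n]]; exists n.
have [zx|xz] := leP z (x - A).
  apply: (@le_trans _ _ (j * tail H (x - z))).
    apply: le_trans (overshoot_le N.+1 (_ : A <= x - z)); last by lra.
    apply: le_trans (pr_overshoot_le _ _); apply: le_pr => //.
    move=> s /Dz [n nN [Gs xz]]; exists n => //; split; first by case: Gs.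
    have [_ [_ _ supE]] := G_fin Gs.
    rewrite /cycle_exceeds supE lte_fin.
    by move: xz; rewrite /phi; have := A0;
      case: (leP 0 (S n s + fine (sup (s n)))) => ? ? ?; lra.
  rewrite -[leLHS]add0r lerD//; first by rewrite mulr_ge0.
  rewrite ler_wpM2l//; apply: le_pr => //; first exact: measurable_xsection.
  move=> z'; rewrite xsectionE /= in_itv/= andbT => ?; split; last by rewrite /=; lra.
  by rewrite /= Az zx.
rewrite indicE mem_set/=; last by rewrite in_itv/= andbT.
rewrite mulr1 -[leLHS]addr0 lerD//; last by rewrite mulr_ge0// pr_ge0.
apply: le_trans (crossing_le N.+1); apply: le_pr => //.
  rewrite (_ : [set s | _] = \bigcup_(n in `I_N.+1)
       [set s | exceeds (K - n%:R * b) n s]).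
    by apply: bigcup_measurable => n _; exact: measurable_cycle_exceeds.
  by apply/seteqP; split=> [t [n]|t [n]]; exists n.
by move=> s /Dz [n nN [[[]]]]; exists n.
Qed.

(* Decompose according to the first cycle n that crosses the line K - n b:
   either its overshoot phi already exceeds x - A, or the walk restarted after
   it has to exceed x - phi. *)
Lemma exceeds_before_step :
  pr Q [set s | exceeds_before x N.+1 s] <=
  j * tail H (x - A) + c * (gamma * tail H (x - A) + j * mid).
Proof.
pose W : set (seq_space E) := [set s | exists2 n, (n < N.+1)%N &
  first_crossing n s /\ exceeds (x - A) n s].
have mW : measurable W.
  rewrite (_ : W = \bigcup_(n in `I_N.+1)
       ([set s | first_crossing n s] `&` [set s | exceeds (x - A) n s])).
    apply: bigcup_measurable => n _; apply: measurableI.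
      exact: measurable_first_crossing.
    exact: measurable_cycle_exceeds.
  by apply/seteqP; split=> [t [n]|t [n]]; exists n.
have mCU : measurable (\big[setU/set0]_(n < N.+1) C n).
  exact: bigsetU_measurable.
apply: (@le_trans _ _ (pr Q (W `|` \big[setU/set0]_(n < N.+1) C n))).
  apply: le_pr; [exact: measurable_exceeds_before|exact: measurableU|].
  move=> s [i iN si].
  have /first_crossing_exists[n ni fn] : exceeds (K - i%:R * b) i s.
    apply: cycle_exceeds_le si.
    have : 0 <= i%:R * b by rewrite mulr_ge0.
    by have := Kx; lra.
  have nN := leq_ltn_trans ni iN.
  have [xn|xn] := pselect (exceeds (x - A) n s); first by left; exists n.
  right; rewrite -bigcup_mkord; exists n => //.
  have Gs : G n s by [].
  split => //; have [_ [phi1 _ supE]] := G_fin Gs.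
  (* If the crossing cycle were itself the one that exceeds x, it would exceed x - A as well,
     contrary to [xn]. *)
  move: ni; rewrite leq_eqVlt => /orP[/eqP ni|ni].
    exfalso; apply: xn; rewrite ni; apply: cycle_exceeds_le si; have := A0; lra.
  have iE : i = (n.+1 + (i - n.+1))%N by rewrite subnKC.
  exists (i - n.+1)%N; first by rewrite ltn_subLR//; lia.
  move: si; rewrite /cycle_exceeds /shift -iE; apply: le_lt_trans.
  rewrite lee_fin {2}iE partial_sumD -/(shift n.+1 s).
  rewrite /(partial_sum inc n.+1 s) big_ord_recr/= -/(partial_sum inc n s).
  have : inc (s n) <= fine (sup (s n)) by rewrite -lee_fin -supE.
  by rewrite /shift; lra.
apply: le_trans (pr_setU_le _ mW mCU) _; apply: lerD.
  apply: le_trans (pr_overshoot_le _ _) _; exact: overshoot_le.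
apply: le_trans (pr_bigsetU_le _ _ mC) _.
apply: le_trans (ler_sum _ (fun (n : 'I_N.+1) _ => prC n)) _.
(* The index of the first crossing is unique, so the [D n] are disjoint and their probabilities add
   up to that of the union in [prD]. *)
rewrite -mulr_sumr ler_wpM2l// -pr_bigsetU//.
move=> m n mn [s z] [[[fm _] _] [[fn _] _]].
exact: (first_crossing_inj mn fm fn).
Qed.

End first_crossing.

Section exceedance_upper_bound.
Context {dE : measure_display} {E : measurableType dE} {R : realType}.
Variables (p : probability E R) (Q : probability (seq_space E) R).
Hypothesis Qiid : iid_law p Q.
Variables (inc : E -> R) (sup : E -> \bar R).
Hypotheses (minc : measurable_fun setT inc) (msup : measurable_fun setT sup).
Hypothesis inc_le_sup : forall c, ((inc c)%:E <= sup c)%E.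
Hypothesis sup_ge0 : forall c, (0 <= sup c)%E.
Variables (F H : probability R R).
Hypothesis F_tail :
  asymp (fun x => pr p [set c | (x%:E < sup c)%E]) (tail F).
Hypotheses (HF : integrated_tail_of F H) (Hsub : subexponential H).
Variable a : R.
Hypotheses (a0 : 0 < a) (int_inc : p.-integrable setT (EFin \o inc)).
Hypothesis mean_inc : (\int[p]_c (inc c)%:E = (- a)%:E)%E.

Local Notation exceeds_before := (exceeds_before inc sup).

(** The crossing cycle alone contributes 1/a; the old constant c comes back only with a small
    factor. The threshold on x is chosen before N and c, which is what permits induction on N. *)
Lemma exceeds_before_recursion (delta : R) : 0 < delta ->
  exists2 A0 : R, 0 <= A0 & forall A, A0 <= A -> \forall x \near +oo,
  forall N c, 0 <= c ->
  (forall y, A <= y -> pr Q [set s | exceeds_before y N s] <= c * tail H y) ->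
  pr Q [set s | exceeds_before x N.+1 s] <=
  (a^-1 + delta + c * delta) * tail H x.
Proof.
have a_gt0 := a0 => d0; have [_ Hpos _] := Hsub.
(* For e <= 1 one has (1 + e)^3 <= 1 + 7 e; the three factors come from the slope b, from
   [sum_tail_le], and from replacing tail H (x - A) by tail H x. *)
pose e := Num.min 1 (delta * a / 7).
have e0 : 0 < e by rewrite lt_min ltr01 divr_gt0// mulr_gt0.
have e1 : e <= 1 by rewrite ge_min lexx.
have ed : e <= delta * a / 7 by rewrite ge_min lexx orbT.
pose b := a / (1 + e).
have b0 : 0 < b by apply: divr_gt0 => //; lra.
have ba : b < a by rewrite ltr_pdivrMr ?ltr_pMr//; lra.
pose j := (1 + e) / b.
have j0 : 0 < j by apply: divr_gt0 => //; lra.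
have jle : j * (1 + e) <= a^-1 + delta.
  have -> : j * (1 + e) = (1 + e) * (1 + e) * (1 + e) / a.
    have e1_neq0 : 1 + e != 0 by rewrite gt_eqF//; lra.
    have a_neq0 : a != 0 by rewrite gt_eqF.
    by rewrite /j /b; field; rewrite a_neq0 e1_neq0.
  rewrite ler_pdivrMr// [leRHS]mulrDl mulVf ?gt_eqF//.
  have := mulr_ge0 (ltW e0) (ltW e0); nra.
(* The coefficient delta of c has two halves: the crossing probability delta / 4 times 1 + e <= 2,
   and the middle part 2 * j * tail H A with tail H A <= delta / (4 * j). *)
have g0 : 0 < delta / 4 by lra.
have b01 : 0 < b < a by rewrite b0.
have [K K0 HK] := crossing_small Qiid minc msup F_tail HF Hsub int_inc mean_inc b01 g0.
have Kb0 : 0 <= K + b by lra.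
have [M1 [_ HM1]] := sum_tail_le F_tail HF Hsub b0 Kb0 e0.
have j4_gt0 : 0 < 4 * j by lra.
have t0 : 0 < delta / (4 * j) by exact: divr_gt0.
have [M2 [_ HM2]] := tail_cvg0 H t0.
exists (Num.max 0 (Num.max (M1 + 1) (M2 + 1))); first by rewrite le_max lexx.
move=> A; rewrite !ge_max => /and3P[A0 AM1 AM2].
near=> x => N c c0 bound.
have Ax : A <= x - A.
  suff : A + A <= x by lra.
  by near: x; apply: nbhs_pinfty_ge; rewrite num_real.
have Kx : K <= x by near: x; apply: nbhs_pinfty_ge; rewrite num_real.
have lt : tail H (x - A) <= (1 + e) * tail H x by near: x; exact: long_tailed.
have mid : forall D : set (R * R), measurable D ->
    D `<=` [set q | A < q.1 <= x - A /\ x < q.1 + q.2] ->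
    pr (H \x H)%E D <= 2 * tail H A * tail H x.
  by near: x; exact: conv_middle.
have J y n : A <= y ->
    \sum_(m < n) pr p [set c | ((y - (K + b) + m%:R * b)%:E < sup c)%E] <=
    j * tail H y.
  by move=> Ay; apply: HM1; lra.
have := exceeds_before_step Qiid minc msup inc_le_sup sup_ge0 K0 (ltW b0) A0 Ax
  Kx (ltW j0) c0 HK J mid bound.
move=> /le_trans; apply.
have tA : tail H A <= delta / (4 * j) by apply: HM2; lra.
rewrite ler_pdivlMr ?j4_gt0// in tA.
have hx := Hpos x.
have s1 : j * tail H (x - A) <= (a^-1 + delta) * tail H x.
  apply: le_trans (_ : j * ((1 + e) * tail H x) <= _).
    by rewrite ler_pM2l.
  by rewrite mulrA ler_pM2r.
have s2 : delta / 4 * tail H (x - A) <= delta / 2 * tail H x.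
  have -> : delta / 2 * tail H x = delta / 4 * (2 * tail H x) by field.
  rewrite ler_pM2l//; apply: le_trans lt _; rewrite ler_pM2r//; lra.
have s3 : j * (2 * tail H A * tail H x) <= delta / 2 * tail H x.
  by rewrite !mulrA ler_pM2r//; nra.
rewrite [leRHS]mulrDl lerD// -[leRHS]mulrA ler_wpM2l//.
have -> : delta * tail H x = delta / 2 * tail H x + delta / 2 * tail H x by field.
exact: lerD.
Unshelve. all: by end_near. Qed.

(** Two passes of the recursion: induction on N with tolerance 1/2 yields some c valid for all N and
    x; a single application with tolerance delta / (1 + c) then lowers it to 1/a + delta. *)
Lemma exceeds_before_le (delta : R) : 0 < delta ->
  \forall x \near +oo, forall N,
  pr Q [set s | exceeds_before x N s] <= (a^-1 + delta) * tail H x.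
Proof.
move=> d0; have [_ Hpos _] := Hsub; have ai0 : 0 < a^-1 by rewrite invr_gt0.
have E0 x : pr Q [set s | exceeds_before x 0 s] = 0.
  rewrite (_ : [set s | _] = set0) ?/pr ?measure0//.
  by apply/seteqP; split=> // s [].
have mE x N : measurable [set s | exceeds_before x N s].
  exact: measurable_exceeds_before.
have [c [c0 Hc]] : exists c, 0 <= c /\ forall N x,
    pr Q [set s | exceeds_before x N s] <= c * tail H x.
  have h0 : 0 < 1 / 2 :> R by lra.
  have [A A0 HA] := exceeds_before_recursion h0.
  have [x0 [_ Hx0]] := HA A (lexx A).
  (* 2 / a + 1 is the fixed point of c -> 1/a + 1/2 + c / 2; the second entry makes the bound
     trivial for x <= x0. *)
  exists (Num.max (2 * a^-1 + 1) (tail H x0)^-1).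
  set c := Num.max _ _.
  have c1 : 2 * a^-1 + 1 <= c by rewrite le_max lexx.
  have c2 : (tail H x0)^-1 <= c by rewrite le_max lexx orbT.
  have c0 : 0 <= c by lra.
  split => // N; elim: N => [|N ih] x; first by rewrite E0 mulr_ge0// tail_ge0.
  have [xx0|xx0] := leP x x0.
    apply: le_trans (pr_le1 _ (mE _ _)) _.
    rewrite -ler_pdivrMr// mul1r; apply: le_trans c2.
    by rewrite lef_pV2// ?posrE// le_tail.
  apply: le_trans (Hx0 x xx0 N c c0 (fun y _ => ih y)) _.
  by rewrite ler_pM2r//; lra.
pose eta := delta / (1 + c).
have eta0 : 0 < eta by rewrite divr_gt0//; lra.
have etaE : eta + c * eta = delta.
  by rewrite /eta -{1}[delta / _]mul1r -mulrDl mulrC divfK// gt_eqF//; lra.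
have [A A0 HA] := exceeds_before_recursion eta0.
have HA' := HA A (lexx A).
near=> x; case=> [|N].
  by rewrite E0 mulr_ge0 ?tail_ge0//; lra.
have Hx : forall N c, 0 <= c ->
  (forall y, A <= y -> pr Q [set s | exceeds_before y N s] <= c * tail H y) ->
  pr Q [set s | exceeds_before x N.+1 s] <=
  (a^-1 + eta + c * eta) * tail H x by near: x; exact: HA'.
by apply: le_trans (Hx N c c0 (fun y _ => Hc N y)) _; rewrite -addrA etaE.
Unshelve. all: by end_near. Qed.

Lemma exceedance_upper_bound (delta : R) : 0 < delta ->
  \forall x \near +oo,
  pr Q [set s | exists n, cycle_exceeds inc sup x n s] <=
  (a^-1 + delta) * tail H x.
Proof.
move=> d0; near=> x.
have Hx : forall N,
  pr Q [set s | exceeds_before x N s] <= (a^-1 + delta) * tail H x.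
  by near: x; exact: exceeds_before_le.
rewrite (_ : [set s | _] = \bigcup_N [set s | exceeds_before x N s]).
  apply: pr_bigcup_le => //.
    by move=> N; exact: measurable_exceeds_before.
  by move=> m n mn s [k km sk]; exists k => //; exact: leq_trans mn.
apply/seteqP; split=> [s [n sn]|s [N _ [n _ sn]]]; last by exists n.
by exists n.+1 => //; exists n.
Unshelve. all: by end_near. Qed.

End exceedance_upper_bound.

(** * Lower bound from a single big jump *)

Section lower_bound.
Context {dE : measure_display} {E : measurableType dE} {R : realType}.
Variables (p : probability E R) (Q : probability (seq_space E) R).
Hypothesis Qiid : iid_law p Q.

(** Subtracting m + eps from each step leaves a walk with mean - eps, to which [iid_walk_bound]
    applies. *)
Lemma partial_sum_drift (f : E -> R) (m eps eta : R) : measurable_fun setT f ->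
  p.-integrable setT (EFin \o f) -> (\int[p]_c (f c)%:E = m%:E)%E ->
  0 < eps -> 0 < eta ->
  exists2 K, 0 < K &
  pr Q [set s | exists n, K < partial_sum f n s - n%:R * (m + eps)] <= eta.
Proof.
move=> mf intf fm e0 eta0; pose g c := f c - (m + eps).
have mg : measurable_fun setT g by exact: measurable_funB.
have intm : p.-integrable setT (EFin \o (fun=> m + eps)).
  exact: (finite_measure_integrable_cst p (m + eps)).
have intg : p.-integrable setT (EFin \o g).
  have := integrableB measurableT intf intm.
  exact: eq_integrable.
have g0 : (\int[p]_c (g c)%:E < 0)%E.
  under eq_integral do rewrite EFinB.
  rewrite integralB_EFin// fm integral_cst//.
  by rewrite [X in (_ * X)%E]probability_setT mule1 -EFinB lte_fin; lra.
have gS n s : partial_sum g n s = partial_sum f n s - n%:R * (m + eps).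
  by rewrite /partial_sum sumrB/= sumr_const card_ord mulr_natl.
have [K K0 HK] := iid_walk_bound Qiid mg intg g0 eta0.
exists K => //; rewrite (_ : [set s | _] =
    [set s | exists n, K < partial_sum g n s]).
  by rewrite -lee_fin -prE//; exact: measurable_exceed.
by apply/seteqP; split=> s [n]; rewrite ?gS => sn; exists n; rewrite ?gS.
Qed.

Variables (inc len : E -> R) (sup : E -> \bar R).
Hypotheses (minc : measurable_fun setT inc) (mlen : measurable_fun setT len)
  (msup : measurable_fun setT sup).
Hypothesis inc_le_sup : forall c, ((inc c)%:E <= sup c)%E.

Local Notation S := (partial_sum inc).
Local Notation L := (partial_sum len).

(* The strong law, in the form: up to a small probability, the increments and
   the epochs stay within linear bounds for all n. *)
Definition linear_bounds (a mu eps K : R) n (s : seq_space E) : Prop :=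
  [/\ - (a + eps) * n%:R - K <= S n s, (mu - eps) * n%:R - K <= L n s &
      L n s <= (mu + eps) * n%:R + K].

Lemma measurable_linear_bounds a mu eps K n :
  measurable [set s | linear_bounds a mu eps K n s].
Proof.
rewrite (_ : [set s | _] = [set s | - (a + eps) * n%:R - K <= S n s] `&`
  ([set s | (mu - eps) * n%:R - K <= L n s] `&`
   [set s | L n s <= (mu + eps) * n%:R + K])).
  apply: measurableI; [|apply: measurableI]; rewrite -[X in measurable X]setTI.
  - exact: (measurable_fun_ler (measurable_cst _) (measurable_partial_sum minc n)).
  - exact: (measurable_fun_ler (measurable_cst _) (measurable_partial_sum mlen n)).
  - exact: (measurable_fun_ler (measurable_partial_sum mlen n) (measurable_cst _)).
by apply/seteqP; split=> s [] // ? [].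
Qed.

(** Three one-sided estimates, from [partial_sum_drift] for [- inc], [len] and [- len], each with a
    third of eta. *)
Lemma linear_bounds_large (a mu eps eta : R) :
  p.-integrable setT (EFin \o inc) -> (\int[p]_c (inc c)%:E = (- a)%:E)%E ->
  p.-integrable setT (EFin \o len) -> (\int[p]_c (len c)%:E = mu%:E)%E ->
  0 < eps -> 0 < eta -> exists2 K, 0 < K &
  1 - eta <= pr Q [set s | forall n, linear_bounds a mu eps K n s].
Proof.
move=> iinc einc ilen elen e0 eta0.
have mean_opp (f : E -> R) m : p.-integrable setT (EFin \o f) ->
    (\int[p]_c (f c)%:E = m%:E)%E ->
    p.-integrable setT (EFin \o (\- f)) /\
    (\int[p]_c ((- f c)%:E) = (- m)%:E)%E.
  move=> intf fm; split.
    by have := integrableN intf; exact: eq_integrable.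
  under eq_integral do rewrite EFinN.
  by rewrite integralN ?fm//; exact: integrable_add_def intf.
have [iinc' einc'] := mean_opp _ _ iinc einc; rewrite opprK in einc'.
have [ilen' elen'] := mean_opp _ _ ilen elen.
have minc' : measurable_fun setT (\- inc) by exact: measurableT_comp.
have mlen' : measurable_fun setT (\- len) by exact: measurableT_comp.
have eta3 : 0 < eta / 3 by lra.
have [K1 K10 H1] := partial_sum_drift minc' iinc' einc' e0 eta3.
have [K2 K20 H2] := partial_sum_drift mlen ilen elen e0 eta3.
have [K3 K30 H3] := partial_sum_drift mlen' ilen' elen' e0 eta3.
have mW f m K : measurable_fun setT f ->
    measurable ([set s | exists n, K < partial_sum f n s - n%:R * (m + eps)]
      : set (seq_space E)).
  move=> mf; rewrite (_ : [set s | _] = \bigcup_n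
    [set s | K < partial_sum f n s - n%:R * (m + eps)]).
    apply: bigcupT_measurable => n; rewrite -[X in measurable X]setTI.
    apply: measurable_fun_ltr => //; apply: measurable_funB => //.
    exact: measurable_partial_sum.
  by apply/seteqP; split=> [s [n]|s [n _]]; exists n.
exists (K1 + K2 + K3); first by rewrite !addr_gt0.
set W := [set s | _].
have mWc : measurable W.
  rewrite (_ : W = \bigcap_(n in setT)
      [set s | linear_bounds a mu eps (K1 + K2 + K3) n s]).
    by apply: bigcapT_measurable => n; exact: measurable_linear_bounds.
  by apply/seteqP; split=> [s h n _|s h n]; exact: h.
have sumN f n s : partial_sum (\- f) n s = - partial_sum f n s.
  by rewrite /partial_sum sumrN.
suff : pr Q (~` W) <= eta by rewrite pr_setC//; lra.
apply: (@le_trans _ _ (pr Q (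
    [set s | exists n, K1 < partial_sum (\- inc) n s - n%:R * (a + eps)] `|`
    [set s | exists n, K2 < partial_sum len n s - n%:R * (mu + eps)] `|`
    [set s | exists n, K3 < partial_sum (\- len) n s - n%:R * (- mu + eps)]))).
  apply: le_pr; first exact: measurableC.
    by apply: measurableU; [apply: measurableU|]; exact: mW.
  move=> s; apply: contra_notP => /not_orP[/not_orP[N1 N2] N3] n.
  have := fun h => N1 (ex_intro _ n h); have := fun h => N2 (ex_intro _ n h).
  have := fun h => N3 (ex_intro _ n h).
  rewrite !sumN => /negP; rewrite -leNgt => h3 /negP; rewrite -leNgt => h2 /negP.
  by rewrite -leNgt => h1; split; lra.
apply: le_trans (pr_setU_le _ _ _) _; [|exact: mW|].
  by apply: measurableU; exact: mW.
apply: (@le_trans _ _ (eta / 3 + eta / 3 + eta / 3)); last by lra.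
rewrite lerD//; apply: le_trans (pr_setU_le _ _ _) _; [exact: mW..|].
exact: lerD.
Qed.

Variables (a mu eps K x : R) (U : nat -> set E).
Hypothesis mU : forall n, measurable (U n).
Hypothesis U_inc : forall n c, U n c -> x + K + (a + eps) * n%:R < inc c.

(** [U n] is left open: late hitting asks for a large increment, early hitting also for a short
    exceedance time. The first two clauses depend only on the cycles before n, and the second makes
    the events disjoint in n. *)
Definition first_big_jump n (s : seq_space E) : Prop :=
  [/\ linear_bounds a mu eps K n s,
      (forall j, (j < n)%N -> ~ cycle_exceeds inc sup x j s) & U n (s n)].

Lemma first_big_jump_exceeds n s : first_big_jump n s ->
  cycle_exceeds inc sup x n s.
Proof.
move=> [[Sn _ _] _ /U_inc sn]; apply: lt_le_trans (inc_le_sup _).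
by rewrite lte_fin; lra.
Qed.

Lemma measurable_first_big_jump n : measurable [set s | first_big_jump n s].
Proof.
rewrite (_ : [set s | _] = [set s | linear_bounds a mu eps K n s] `&`
  (\bigcap_(j in `I_n) (~` [set s | cycle_exceeds inc sup x j s]) `&`
   (fun s : seq_space E => s n) @^-1` U n)).
  apply: measurableI; first exact: measurable_linear_bounds.
  apply: measurableI.
    apply: bigcap_measurableType => j _; apply: measurableC.
    exact: measurable_cycle_exceeds.
  by rewrite -[X in measurable X]setTI; exact: measurable_coord.
by apply/seteqP; split=> s [] // ? [].
Qed.

(** The clauses on the past are independent of cycle n. They can fail only if a linear bound fails
    or if x is exceeded in some cycle. *)
Lemma pr_first_big_jump_ge eta n :
  1 - eta <= pr Q [set s | forall n, linear_bounds a mu eps K n s] ->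
  (1 - eta - pr Q [set s | exists n, cycle_exceeds inc sup x n s]) *
    pr p (U n) <= pr Q [set s | first_big_jump n s].
Proof.
move=> Heta; set V := [set s | exists n, _].
pose A : set (seq_space E) := [set s | linear_bounds a mu eps K n s /\
  forall j, (j < n)%N -> ~ cycle_exceeds inc sup x j s].
have mA : measurable A.
  rewrite (_ : A = [set s | linear_bounds a mu eps K n s] `&`
    \bigcap_(j in `I_n) (~` [set s | cycle_exceeds inc sup x j s])).
    apply: measurableI; first exact: measurable_linear_bounds.
    apply: bigcap_measurableType => j _; apply: measurableC.
    exact: measurable_cycle_exceeds.
  by [].
have mV : measurable V.
  rewrite (_ : V = \bigcup_n [set s | cycle_exceeds inc sup x n s]).
    by apply: bigcupT_measurable => j; exact: measurable_cycle_exceeds.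
  by apply/seteqP; split=> [s [j]|s [j _]]; exists j.
have mB : measurable ((fun s : seq_space E => s 0%N) @^-1` U n).
  by rewrite -[X in measurable X]setTI; exact: measurable_coord.
have eqL (f : E -> R) m (s s' : seq_space E) : (m <= n)%N ->
    (forall k, (k < n)%N -> s k = s' k) -> partial_sum f m s = partial_sum f m s'.
  by move=> mn ss'; apply: eq_bigr => i _; rewrite ss'// (leq_trans _ mn).
have -> : pr Q [set s | first_big_jump n s] = pr Q A * pr p (U n).
  rewrite /pr -fineM ?fin_num_measure// -(iid_coord Qiid 0 (mU n)).
  rewrite -(iid_shift_indep Qiid mA mB (n := n)).
    congr (fine (Q _)); apply/seteqP; split=> s [].
      by move=> h1 h2 h3; split; [split|rewrite /= /shift addn0].
    by move=> [h1 h2]; rewrite /= /shift addn0 => h3; split.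
  move=> s s' ss' [[h1 h2 h3] h4]; split.
    by split; rewrite -(eqL _ _ s).
  move=> j jn; have := h4 j jn; rewrite /cycle_exceeds.
  by rewrite (eqL inc j s s') ?ss'// ltnW.
rewrite ler_wpM2r ?pr_ge0//.
have mG : measurable [set s | forall n, linear_bounds a mu eps K n s].
  rewrite (_ : [set s | _] = \bigcap_n [set s | linear_bounds a mu eps K n s]).
    by apply: bigcapT_measurable => j; exact: measurable_linear_bounds.
  by apply/seteqP; split=> [s h j _|s h j]; exact: h.
have : pr Q [set s | forall n, linear_bounds a mu eps K n s] <= pr Q (A `|` V).
  apply: le_pr => //; first exact: measurableU.
  move=> s h; have [[j sj]|N] := pselect (V s); first by right; exists j.
  by left; split=> // j _ sj; apply: N; exists j.
by move=> /le_trans/(_ (pr_setU_le _ mA mV)); lra.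
Qed.

(** A first big jump exceeds x, which the second clause forbids to cycles before a later one; so the
    events are disjoint and their probabilities add. *)
Lemma pr_some_big_jump_ge eta n1 n2 :
  1 - eta <= pr Q [set s | forall n, linear_bounds a mu eps K n s] ->
  (1 - eta - pr Q [set s | exists n, cycle_exceeds inc sup x n s]) *
    (\sum_(n1 <= n < n2) pr p (U n)) <=
  pr Q [set s | exists2 n, (n1 <= n < n2)%N & first_big_jump n s].
Proof.
move=> Heta; pose B n := if (n1 <= n)%N then [set s | first_big_jump n s] else set0.
have mB n : measurable (B n).
  by rewrite /B; case: ifP => // _; exact: measurable_first_big_jump.
have -> : [set s | exists2 n, (n1 <= n < n2)%N & first_big_jump n s] =
    \big[setU/set0]_(n < n2) B n.
  rewrite -bigcup_mkord; apply/seteqP; split=> [s [n /andP[n1n nn2] sn]|s [n nn2]].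
    by exists n => //; rewrite /B n1n.
  by rewrite /B; case: ifP => // n1n sn; exists n => //; rewrite n1n.
rewrite pr_bigsetU//; last first.
  move=> i j ij s []; rewrite /B; case: ifP => // _ si; case: ifP => // _ sj.
  by have [_ + _] := sj; apply; [exact: ij|exact: first_big_jump_exceeds].
rewrite big_geq_mkord big_mkcond/= mulr_sumr; apply: ler_sum => n _; rewrite /B.
case: ifP => _; last by rewrite mulr0 pr_ge0.
exact: pr_first_big_jump_ge.
Qed.

End lower_bound.

Section tail_sums.
Context {R : realType}.
Variables (F H : probability R R) (f : R -> R).
Hypotheses (HF : integrated_tail_of F H) (fF : asymp f (tail F)).

(** Each term dominates (1 - eta) / b times the increment of tail H over the interval of length b
    that starts at its argument, and these increments telescope. The threshold is uniform in n1 and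
    n2, which will depend on x. *)
Lemma sum_tail_ge (eta : R) : 0 < eta < 1 -> \forall x0 \near +oo,
  forall x b n1 n2, x0 <= x -> 0 < b -> (n1 <= n2)%N ->
  (1 - eta) / b * (tail H (x + b * n1%:R) - tail H (x + b * n2%:R)) <=
  \sum_(n1 <= n < n2) f (x + b * n%:R).
Proof.
move=> e01; have [M1 [_ HM1]] := asymp_near fF (tail_ge0 F) e01.
have [M2 [_ HM2]] := integrated_tail_increment HF.
near=> x0 => x b n1 n2 x0x b0 n12.
have xM1 : M1 < x0 by near: x0; apply: nbhs_pinfty_gt; rewrite num_real.
have xM2 : M2 < x0 by near: x0; apply: nbhs_pinfty_gt; rewrite num_real.
elim: n2 n12 => [|n2 ih].
  by rewrite leqn0 => /eqP ->; rewrite subrr mulr0 big_geq.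
rewrite leq_eqVlt => /orP[/eqP <-|]; first by rewrite subrr mulr0 big_geq.
rewrite ltnS => n12; rewrite big_nat_recr//=.
have bn : 0 <= b * n2%:R by rewrite mulr_ge0// ltW.
have /HM1[_ /andP[h1 _]] : M1 < x + b * n2%:R by lra.
have /HM2 : M2 < x + b * n2%:R by lra.
move=> /(_ b (ltW b0)) /andP[_ h2].
have E : x + b * n2.+1%:R = x + b * n2%:R + b by rewrite -[n2.+1]addn1 natrD; ring.
have := ih n12; rewrite E.
suff : (1 - eta) / b * (tail H (x + b * n2%:R) - tail H (x + b * n2%:R + b)) <=
  f (x + b * n2%:R) by lra.
apply: le_trans h1; rewrite -mulrA ler_pM2l; last by lra.
by rewrite ler_pdivrMl.
Unshelve. all: by end_near. Qed.

End tail_sums.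

Lemma partial_sum_recr (dE : measure_display) (E : measurableType dE)
    (R : realType) (f : E -> R) n (s : seq_space E) :
  partial_sum f n.+1 s = partial_sum f n s + f (s n).
Proof. by rewrite /partial_sum big_ord_recr. Qed.

(** * Cycles of the process *)

Definition cycle_space (R : realType) := g_sigma_algebraType
  [set [set c : cycle_type R | (y < f c)%E] |
     f in cycle_observables (R:=R) & y in [set: \bar R]].

Section cycle_space.
Context {R : realType}.
Implicit Types (c : cycle_space R).

Lemma measurable_observable (f : cycle_space R -> \bar R) :
  cycle_observables f -> measurable_fun setT f.
Proof.
move=> fobs.
apply: (@measurability _ _ _ _ setT f (ErealGenOInfty.G (R:=R))).
  exact: ErealGenOInfty.measurableE.
move=> _ [_ [r ->] <-]; rewrite setTI; apply: sub_sigma_algebra.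
exists f => //; exists r%:E => //.
by apply/seteqP; split=> c /=; rewrite in_itv/= andbT.
Qed.

Lemma measurable_cycle_length :
  measurable_fun setT (@cycle_length R : cycle_space R -> R).
Proof.
apply/measurable_EFinP; apply: measurable_observable.
by do 4 left.
Qed.

Lemma measurable_cycle_increment :
  measurable_fun setT (@cycle_increment R : cycle_space R -> R).
Proof.
apply/measurable_EFinP; apply: measurable_observable.
by left; left; right.
Qed.

Lemma measurable_cycle_sup :
  measurable_fun setT (@cycle_sup R : cycle_space R -> \bar R).
Proof. by apply: measurable_observable; left; right. Qed.

Lemma measurable_cycle_exceedance (x : R) :
  measurable_fun setT (cycle_exceedance x : cycle_space R -> R).
Proof.
apply/measurable_EFinP; apply: measurable_observable.
by right; exists x.
Qed.

(* Only for genuine cycles is the supremum at least 0 and at least the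
   increment, whence this truncation. *)
Definition cycle_top c : \bar R :=
  maxe (cycle_sup c) (maxe 0%E (cycle_increment c)%:E).

Lemma measurable_cycle_top : measurable_fun setT cycle_top.
Proof.
apply: measurable_maxe; first exact: measurable_cycle_sup.
apply: measurable_maxe => //.
by apply/measurable_EFinP; exact: measurable_cycle_increment.
Qed.

Lemma cycle_top_ge0 c : (0 <= cycle_top c)%E.
Proof. by rewrite !le_max lexx orbT. Qed.

Lemma cycle_increment_le_top c : ((cycle_increment c)%:E <= cycle_top c)%E.
Proof. by rewrite !le_max lexx !orbT. Qed.

Lemma cycle_sup_gtP (x : R) c : (x%:E < cycle_sup c)%E <->
  exists t, 0 <= t <= c.1 /\ x < c.2 t.
Proof.
split=> [/ereal_sup_gt[_ [t /= tc <-]]|[t [tc xt]]].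
  by rewrite lte_fin in_itv/= in tc * => xt; exists t.
apply: lt_le_trans (_ : (c.2 t)%:E <= _)%E; first by rewrite lte_fin.
by apply: ereal_sup_ubound; exists t => //=; rewrite in_itv.
Qed.

(** The premise excludes the default value, so the exceedance time is an infimum over a nonempty set
    and a strict inequality passes to some member. *)
Lemma cycle_exceedance_ltP (x r : R) c : (x%:E < cycle_sup c)%E ->
  cycle_exceedance x c < r <-> exists t, [/\ 0 <= t <= c.1, x < c.2 t & t < r].
Proof.
move=> xc; rewrite /cycle_exceedance xc.
set A := [set t | _].
have lbA : has_lbound A by exists 0 => t /= [+ _]; rewrite in_itv/= => /andP[].
split=> [|[t [tc xt tr]]].
  have [t [tc xt]] := (cycle_sup_gtP x c).1 xc.
  have A0 : A !=set0 by exists t; split => //; rewrite in_itv.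
  move=> /(inf_lt A0)[u [uc xu] ur].
  by exists u; split => //; rewrite in_itv in uc.
by apply: le_lt_trans tr; apply: ge_inf => //; split => //; rewrite in_itv.
Qed.

End cycle_space.

Definition image_probability d d' (T : measurableType d)
    (T' : measurableType d') (R : realType) (P : probability T R) (f : T -> T')
    (mf : measurable_fun setT f) : probability T' R :=
  distribution P (mfun_Sub (mem_set mf)).

Section cycles.
Context d (Omega : measurableType d) (R : realType) (P : probability Omega R).
Variables (Z : R -> {RV P >-> R}) (T : nat -> {RV P >-> R}).
Hypotheses (Z0 : forall w, Z 0 w = 0) (reg : regenerative_increments Z T).

Local Notation inc := (@cycle_increment R : cycle_space R -> R).
Local Notation len := (@cycle_length R : cycle_space R -> R).
Local Notation top := (cycle_top (R:=R)).

Definition cycle_seq (w : Omega) : seq_space (cycle_space R) :=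
  fun k => nth_cycle Z T k w.

Lemma measurable_nth_cycle k :
  measurable_fun setT (nth_cycle Z T k : Omega -> cycle_space R).
Proof.
by move=> _ A mA; rewrite setTI; exact: (nth_cycle_measurable reg).
Qed.

Lemma measurable_cycle_seq : measurable_fun setT cycle_seq.
Proof. by apply: measurable_seq_space => k; exact: measurable_nth_cycle. Qed.

Definition cycle_law : probability (cycle_space R) R :=
  image_probability P (measurable_nth_cycle 0).

Definition cycle_seq_law : probability (seq_space (cycle_space R)) R :=
  image_probability P measurable_cycle_seq.

Lemma iid_cycles : iid_law cycle_law cycle_seq_law.
Proof.
move=> N A mA.
transitivity (P (\bigcap_(k in `I_N) (nth_cycle Z T k @^-1` A k))) => //.
rewrite (nth_cycle_independent reg)//; apply: eq_bigr => k _.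
exact: (nth_cycle_identically_distributed reg k (mA k)).
Qed.

Lemma epoch_ge0 n w : 0 <= T n w.
Proof.
elim: n => [|n ih]; first by rewrite (epoch0 reg).
by apply: le_trans ih _; exact/ltW/(epoch_lt reg).
Qed.

Lemma partial_sum_inc n w : partial_sum inc n (cycle_seq w) = Z (T n w) w.
Proof.
elim: n => [|n ih]; first by rewrite /partial_sum big_ord0 (epoch0 reg) Z0.
rewrite partial_sum_recr ih.
by rewrite /cycle_increment /cycle_seq /nth_cycle /= subrK addrC subrK.
Qed.

Lemma partial_sum_len n w : partial_sum len n (cycle_seq w) = T n w.
Proof.
elim: n => [|n ih]; first by rewrite /partial_sum big_ord0 (epoch0 reg).
rewrite partial_sum_recr ih.
by rewrite /cycle_length /cycle_seq /nth_cycle /= addrC subrK.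
Qed.

(** In a cycle of the process the times 0 and R enter the supremum, with values 0 and the increment,
    so the truncation changes nothing. *)
Lemma cycle_top_nth k w : top (nth_cycle Z T k w) = cycle_sup (nth_cycle Z T k w).
Proof.
have Tk := epoch_lt reg k w.
apply/max_idPl; rewrite ge_max; apply/andP; split.
  apply: ereal_sup_ubound; exists 0 => /=.
    by rewrite in_itv/= lexx subr_ge0 ltW.
  by rewrite add0r subrr.
apply: ereal_sup_ubound; exists (T k.+1 w - T k w) => //=.
by rewrite in_itv/= lexx subr_ge0 ltW.
Qed.

Lemma cycle_of_time (t : R) w : 0 <= t ->
  exists n, T n w <= t <= T n.+1 w.
Proof.
move=> t0; have /cvgryPgt/(_ t) [N _ HN] := epoch_cvgy reg w.
have {HN} := HN N (leqnn N); elim: N => [|N ih].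
  by rewrite /= (epoch0 reg) ltNge t0.
move=> /= tN; have [/ih//|Nt] := ltP t (T N w).
by exists N; rewrite Nt ltW.
Qed.

Lemma exceeds_cycleP (x : R) n w :
  cycle_exceeds inc top x n (cycle_seq w) <->
  exists u, 0 <= u <= T n.+1 w - T n w /\ x < Z (u + T n w) w.
Proof.
rewrite /cycle_exceeds cycle_top_nth partial_sum_inc cycle_sup_gtP.
by split=> -[u [uT xu]]; exists u; split => //; move: xu => /=; lra.
Qed.

Lemma exceeds_timeP (x : R) w :
  (exists2 t, 0 <= t & x < Z t w) <->
  exists n, cycle_exceeds inc top x n (cycle_seq w).
Proof.
split=> [[t t0 xt]|[n /exceeds_cycleP[u [/andP[u0 _] xu]]]]; last first.
  by exists (u + T n w) => //; rewrite addr_ge0// epoch_ge0.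
have [n /andP[nt tn]] := cycle_of_time w t0.
exists n; apply/exceeds_cycleP; exists (t - T n w); rewrite subrK; split => //.
lra.
Qed.

Lemma process_sup_gtP (x : R) w : (x%:E < process_sup Z w)%E <->
  exists n, cycle_exceeds inc top x n (cycle_seq w).
Proof.
rewrite -exceeds_timeP; split=> [/ereal_sup_gt[_ [t /= t0 <-]]|[t t0 xt]].
  by rewrite lte_fin => xt; exists t => //; move: t0; rewrite in_itv/= andbT.
apply: lt_le_trans (_ : (Z t w)%:E <= _)%E; first by rewrite lte_fin.
by apply: ereal_sup_ubound; exists t => //=; rewrite in_itv/= t0.
Qed.

(** The cycles before n cover every time before T_n. *)
Lemma hitting_time_ge (x : R) n w :
  (forall j, (j < n)%N -> ~ cycle_exceeds inc top x j (cycle_seq w)) ->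
  ((T n w)%:E <= hitting_time Z x w)%E.
Proof.
move=> noex; rewrite leNgt; apply/negP => /ereal_inf_lt[_ [t [t0 xt] <-]].
rewrite lte_fin => tn.
have Tmono i j : (i <= j)%N -> T i w <= T j w.
  move=> /subnKC <-; elim: (j - i)%N => [|k ih]; first by rewrite addn0.
  by rewrite addnS (le_trans ih)//; exact/ltW/(epoch_lt reg).
have [j /andP[jt tj]] := cycle_of_time w t0.
have jn : (j < n)%N.
  by rewrite ltnNge; apply/negP => /Tmono; lra.
apply: (noex j jn); apply/exceeds_cycleP.
by exists (t - T j w); rewrite subrK; split => //; lra.
Qed.

(** The level x - S_n depends on the past, whereas y will be deterministic. Passing to the higher
    level y is what allows assumption (4) to be applied to a single cycle. *)
Lemma hitting_time_le (x y r : R) n w :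
  x - partial_sum inc n (cycle_seq w) <= y ->
  y < inc (nth_cycle Z T n w) ->
  cycle_exceedance y (nth_cycle Z T n w) < r ->
  (hitting_time Z x w <= (T n w + r)%:E)%E.
Proof.
rewrite partial_sum_inc => xy yinc.
have ysup : (y%:E < cycle_sup (nth_cycle Z T n w))%E.
  rewrite -cycle_top_nth; apply: lt_le_trans (cycle_increment_le_top _).
  by rewrite lte_fin.
move=> /(cycle_exceedance_ltP _ ysup)[t [/= /andP[t0 _] yt tr]].
apply: (@le_trans _ _ (t + T n w)%:E); last by rewrite lee_fin; lra.
apply: ereal_inf_lbound; exists (t + T n w) => //; split.
  by rewrite addr_ge0// epoch_ge0.
by move: yt => /=; lra.
Qed.

(** Measurability is given for exceedance times of fixed levels, but x - S_n is random. Rationals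
    inserted for the level and for the time within the cycle turn the event into a countable
    union. *)
Lemma hitting_timeP (x r : R) w : (hitting_time Z x w < r%:E)%E <->
  exists n (q1 q2 : rat), [/\ x - partial_sum inc n (cycle_seq w) <= ratr q1,
    partial_sum len n (cycle_seq w) + ratr q2 <= r,
    ((ratr q1)%:E < cycle_sup (nth_cycle Z T n w))%E &
    cycle_exceedance (ratr q1) (nth_cycle Z T n w) < ratr q2].
Proof.
split=> [/ereal_inf_lt[_ [t [t0 xt] <-]]|[n [q1 [q2 [xq1 q2r q1s]]]]].
  rewrite lte_fin => tr.
  have [n /andP[nt tn]] := cycle_of_time w t0.
  have : x - Z (T n w) w < Z t w - Z (T n w) w by lra.
  move=> /rat_in_itvoo[q1]; rewrite in_itv/= => /andP[xq1 q1t].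
  have : t - T n w < r - T n w by lra.
  move=> /rat_in_itvoo[q2]; rewrite in_itv/= => /andP[tq2 q2r].
  have tin : 0 <= t - T n w <= (nth_cycle Z T n w).1 by rewrite /=; lra.
  have q1z : ratr q1 < (nth_cycle Z T n w).2 (t - T n w) by rewrite /= subrK.
  have q1s : ((ratr q1)%:E < cycle_sup (nth_cycle Z T n w))%E.
    by apply/cycle_sup_gtP; exists (t - T n w).
  exists n, q1, q2; split => //.
  - by rewrite partial_sum_inc ltW.
  - by rewrite partial_sum_len; lra.
  - by apply/(cycle_exceedance_ltP _ q1s); exists (t - T n w).
move=> /(cycle_exceedance_ltP _ q1s)[t [/andP[t0 _] q1t tq2]].
rewrite partial_sum_inc in xq1; rewrite partial_sum_len in q2r.
apply: (@le_lt_trans _ _ (t + T n w)%:E); last by rewrite lte_fin; lra.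
apply: ereal_inf_lbound; exists (t + T n w) => //; split.
  by rewrite addr_ge0// epoch_ge0.
by move: q1t => /=; lra.
Qed.

Lemma measurable_hitting_time (x : R) : measurable_fun setT (hitting_time Z x).
Proof.
apply: (@measurability _ _ _ _ setT _ (ErealGenCInfty.G (R:=R))).
  exact: ErealGenCInfty.measurableE.
move=> _ [_ [r ->] <-]; rewrite setTI.
rewrite (_ : _ @^-1` _ = ~` \bigcup_n \bigcup_q1 \bigcup_q2
  ([set w | x - partial_sum inc n (cycle_seq w) <= ratr q1] `&`
   ([set w | partial_sum len n (cycle_seq w) + ratr q2 <= r] `&`
    (nth_cycle Z T n @^-1`
      ([set c : cycle_space R | ((ratr q1)%:E < cycle_sup c)%E] `&`
       [set c : cycle_space R | cycle_exceedance (ratr q1) c < ratr q2]))))).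
  apply: measurableC; apply: bigcupT_measurable => n.
  apply: bigcupT_measurable_rat => q1; apply: bigcupT_measurable_rat => q2.
  have mS (f : cycle_space R -> R) : measurable_fun setT f ->
      measurable_fun setT (fun w => partial_sum f n (cycle_seq w)).
    move=> mf; apply: (measurableT_comp (measurable_partial_sum mf n)).
    exact: measurable_cycle_seq.
  apply: measurableI; [|apply: measurableI];
    rewrite -[X in measurable X]setTI.
  - apply: (measurable_fun_ler (measurable_funB _ (mS _ _)) _) => //.
    exact: measurable_cycle_increment.
  - apply: (measurable_fun_ler (measurable_funD (mS _ _) _) _) => //.
    exact: measurable_cycle_length.
  - apply: measurable_nth_cycle => //; apply: measurableI;
      rewrite -[X in measurable X]setTI.
      exact: emeasurable_fun_o_infty measurable_cycle_sup _.
    apply: measurable_fun_ltr => //; exact: measurable_cycle_exceedance.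
apply/seteqP; split=> w /=.
  rewrite in_itv/= andbT leNgt => /negP + [n _ [q1 _ [q2 _ [? [? []]]]]].
  by move=> h *; apply: h; apply/hitting_timeP; exists n, q1, q2.
move=> h; rewrite in_itv/= andbT leNgt; apply/negP => /hitting_timeP.
move=> [n [q1 [q2 [? ? ? ?]]]]; apply: h.
by exists n => //; exists q1 => //; exists q2.
Qed.

End cycles.

(** * Weak convergence from distribution functions *)

Section weak_convergence.
Context {R : realType}.

(** The atoms are countably many, while a nondegenerate interval is not Lebesgue null. *)
Lemma exists_nonatom (nu : probability R R) (a b : R) : a < b ->
  exists2 t, a < t < b & pr nu [set t] = 0.
Proof.
move=> ab; apply: contrapT => natom.
have : lebesgue_measure (`]a, b[%classic : set R) = 0%E.
  apply: countable_lebesgue_measure0.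
  apply: sub_countable (pmf_gt0_countable (P := nu) (mfun_Sub
    (mem_set (@measurable_id _ _ setT)))).
  apply: subset_card_le => t /=; rewrite in_itv/= => tab.
  rewrite lt_neqAle pmf_ge0 andbT; apply/eqP => t0; apply: natom.
  by exists t.
rewrite lebesgue_measure_itv/= lte_fin ab => /eqP; rewrite eqe subr_eq0.
by rewrite gt_eqF.
Qed.

(** Only y is confined to the compact interval; z may lie outside it, so the radius is obtained from
    a covering argument. *)
Lemma uniform_continuity (f : R -> R) (a b eps : R) : continuous f -> 0 < eps ->
  exists2 rho, 0 < rho & forall y z, a <= y <= b -> `|y - z| < rho ->
  `|f y - f z| <= eps.
Proof.
move=> cf e0; have e2 : 0 < eps / 2 by lra.
have : \forall rho \near 0^'+, `[a, b]%classic `<=`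
    [set y | forall z, `|y - z| < rho -> `|f y - f z| <= eps].
  have /compact_near_coveringP := @segment_compact R a b.
  apply => x _.
  have /cvgrPdist_le/(_ _ e2)/nbhs_ballP[r /= r0 Hr] := cf x.
  exists (ball x (r / 2), [set rho | rho < r / 2]) => /=.
    split; first by apply: nbhsx_ballx; rewrite divr_gt0.
    by apply: nbhs_right_lt; rewrite divr_gt0.
  move=> [y rho] /= [xy rhor] z yz.
  have /= fy : `|f x - f y| <= eps / 2.
    by apply: Hr; apply: lt_trans xy _; lra.
  have /= fz : `|f x - f z| <= eps / 2.
    apply: Hr; rewrite /ball/=.
    have -> : x - z = (x - y) + (y - z) by ring.
    apply: le_lt_trans (ler_normD _ _) _; rewrite /ball/= in xy; lra.
  have -> : f y - f z = (f x - f z) - (f x - f y) by ring.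
  by apply: le_trans (ler_normB _ _) _; lra.
move=> H; near (0 : R)^'+ => rho.
exists rho; first by near: rho; exact: nbhs_right_gt.
have H' : `[a, b]%classic `<=`
    [set y | forall z, `|y - z| < rho -> `|f y - f z| <= eps].
  by near: rho; exact: H.
by move=> y z yab; apply: H'; rewrite /= in_itv.
Unshelve. all: by end_near. Qed.

Section step_approximation.
Variables (nu : probability R R) (f : R -> R) (C : R).
Hypotheses (cf : continuous f) (fC : forall y, `|f y| <= C).

Let mf : measurable_fun setT f. Proof. exact: continuous_measurable_fun. Qed.

Lemma bounded_integrable (A : set R) : measurable A ->
  nu.-integrable A (EFin \o f).
Proof.
move=> mA; apply: (le_integrable mA _ _ (finite_measure_integrable_cst nu C mA)).
  by apply/measurable_EFinP; exact: measurable_funTS.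
by move=> y _; rewrite /= lee_fin (le_trans (fC y))// ler_norm.
Qed.

Lemma integral_bounded_fin (A : set R) : measurable A ->
  (\int[nu]_(y in A) (f y)%:E = (\int[nu]_(y in A) f y)%:E)%E.
Proof.
move=> mA; rewrite /Rintegral fineK//.
exact: integrable_fin_num (bounded_integrable mA).
Qed.

Lemma Rintegral_near_cst (A : set R) (c eps : R) : measurable A ->
  (forall y, A y -> `|f y - c| <= eps) ->
  `|\int[nu]_(y in A) f y - c * pr nu A| <= eps * pr nu A.
Proof.
move=> mA H.
have icst k : nu.-integrable A (EFin \o cst k).
  exact: finite_measure_integrable_cst.
have <- : \int[nu]_(y in A) (cst c y) = c * pr nu A by rewrite Rintegral_cst.
have <- : \int[nu]_(y in A) (cst eps y) = eps * pr nu A by rewrite Rintegral_cst.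
rewrite -RintegralB//; last exact: bounded_integrable.
have iB : nu.-integrable A (EFin \o (f \- cst c)).
  by have := integrableB mA (bounded_integrable mA) (icst c); exact: eq_integrable.
apply: le_trans (le_normr_Rintegral mA iB) _.
apply: le_Rintegral => //.
by have := integrable_abse iB; exact: eq_integrable.
Qed.

(** A Riemann-Stieltjes sum that involves only values of the distribution function at the [s n],
    hence stable under their convergence. The last two error terms come from the mass outside []s 0,
    s m]]. *)
Lemma step_approximation (s : nat -> R) (eps : R) m : 0 <= eps ->
  (forall n, s n <= s n.+1) ->
  (forall n y, (n < m)%N -> s n < y <= s n.+1 -> `|f y - f (s n.+1)| <= eps) ->
  `|\int[nu]_y f y -
    \sum_(n < m) f (s n.+1) * (pr nu `]-oo, s n.+1] - pr nu `]-oo, s n])| <=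
  eps + C * pr nu `]-oo, s 0%N] + C * (1 - pr nu `]-oo, s m]).
Proof.
move=> e0 sS fs.
pose J n := \int[nu]_(y in `]-oo, s n]) f y.
have J0 : `|J 0%N| <= C * pr nu `]-oo, s 0%N].
  have := @Rintegral_near_cst `]-oo, s 0%N] 0 C (measurable_itv _).
  by rewrite mul0r subr0; apply => y _; rewrite subr0.
have prS n : pr nu `]-oo, s n.+1] - pr nu `]-oo, s n] = pr nu `]s n, s n.+1].
  have := @pr_setU _ _ _ nu `]-oo, s n] `]s n, s n.+1] (measurable_itv _) (measurable_itv _).
  rewrite -itv_bndbnd_setU ?bnd_simp// => ->; first by rewrite addrC addKr.
  by move=> y [] /=; rewrite !in_itv/= => ys /andP[]; rewrite ltNge ys.
have JS n : (n < m)%N ->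
    `|J n.+1 - J n - f (s n.+1) * (pr nu `]-oo, s n.+1] - pr nu `]-oo, s n])| <=
    eps * (pr nu `]-oo, s n.+1] - pr nu `]-oo, s n]).
  move=> nm; rewrite prS.
  have -> : J n.+1 - J n = \int[nu]_(y in `]s n, s n.+1]) f y.
    rewrite /J (@itv_bndbnd_setU _ _ -oo%O (BRight (s n)) (BRight (s n.+1))) ?bnd_simp//.
    rewrite Rintegral_setU//; first by rewrite addrC addKr.
      rewrite -itv_bndbnd_setU// ?bnd_simp//; exact: bounded_integrable.
    rewrite disj_set2E; apply/eqP/seteqP; split => // y [] /=.
    by rewrite !in_itv/= => ys /andP[]; rewrite ltNge ys.
  apply: Rintegral_near_cst => // y /=; rewrite in_itv/=; exact: fs.
have Jm k : (k <= m)%N ->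
    `|J k - \sum_(n < k) f (s n.+1) * (pr nu `]-oo, s n.+1] - pr nu `]-oo, s n])|
    <= C * pr nu `]-oo, s 0%N] + eps * (pr nu `]-oo, s k] - pr nu `]-oo, s 0%N]).
  elim: k => [|k ih] km.
    by rewrite big_ord0 subr0 subrr mulr0 addr0.
  rewrite big_ord_recr/=; have := JS k km; have := ih (ltnW km).
  rewrite !ler_norml => /andP[? ?] /andP[? ?]; lra.
have IJ : `|\int[nu]_y f y - J m| <= C * (1 - pr nu `]-oo, s m]).
  have -> : \int[nu]_y f y - J m = \int[nu]_(y in `]s m, +oo[) f y.
    rewrite (_ : setT = `]-oo, s m] `|` `]s m, +oo[)%classic.
      rewrite Rintegral_setU//; first by rewrite addrC addKr.
        by rewrite -itv_bndbnd_setU//; exact: bounded_integrable.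
      rewrite disj_set2E; apply/eqP/seteqP; split => // y [] /=.
      by rewrite !in_itv/= andbT => ys; rewrite ltNge ys.
    by rewrite -itv_bndbnd_setU// set_itvE.
  have -> : 1 - pr nu `]-oo, s m] = pr nu `]s m, +oo[.
    by rewrite -pr_setC// setCitvl.
  have := @Rintegral_near_cst `]s m, +oo[ 0 C (measurable_itv _).
  by rewrite mul0r subr0; apply => y _; rewrite subr0.
have := Jm m (leqnn m).
have h : eps * (pr nu `]-oo, s m] - pr nu `]-oo, s 0%N]) <= eps.
  apply: ler_piMr => //; have := pr_le1 nu (measurable_itv `]-oo, s m]).
  by have := pr_ge0 nu `]-oo, s 0%N]; lra.
move: IJ; rewrite !ler_norml => /andP[? ?] /andP[? ?]; lra.
Qed.

End step_approximation.

(** The partition points are non-atoms of [nu], where convergence is assumed; convergence at its two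
    ends also controls the mass of [kappa x] outside the partition. *)
Lemma helly_bray (kappa : R -> probability R R) (nu : probability R R)
    (f : R -> R) (C : R) :
  on_nonneg nu ->
  (forall t, pr nu [set t] = 0 -> forall eps : R, 0 < eps -> \forall x \near +oo,
    `|pr (kappa x) `]-oo, t] - pr nu `]-oo, t]| <= eps) ->
  continuous f -> (forall y, `|f y| <= C) ->
  (\int[kappa x]_y (f y)%:E)%E @[x --> +oo] --> (\int[nu]_y (f y)%:E)%E.
Proof.
move=> nu0 Hcdf cf fC.
have E (k : probability R R) : (\int[k]_y (f y)%:E = (\int[k]_y f y)%:E)%E.
  exact: (integral_bounded_fin k cf fC measurableT).
rewrite E (_ : (fun x => _) = (fun x => (\int[kappa x]_y f y)%:E)); last first.
  by apply/funext => x; exact: E.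
apply: cvg_EFin; first by near=> x.
rewrite (_ : fine \o _ = (fun x => \int[kappa x]_y f y)) //.
apply/cvgrPdist_le => eps eps0.
have C0 : 0 <= C by exact: le_trans (fC 0).
have nuneg t : t < 0 -> pr nu `]-oo, t] = 0.
  move=> t0; apply/eqP; rewrite eq_le pr_ge0 andbT.
  have := @pr_setU _ _ _ nu `]-oo, t] `[0, +oo[ (measurable_itv _) (measurable_itv _).
  have -> : pr nu `[0, +oo[ = 1 by rewrite /pr nu0.
  have := pr_le1 nu (measurableU _ _ (measurable_itv `]-oo, t])
    (measurable_itv `[(0:R), +oo[)).
  move=> + Hadd; rewrite Hadd; first by lra.
  by move=> y [] /=; rewrite !in_itv/= andbT; lra.
have d0 : 0 < eps / (10 * (C + 1)) by rewrite divr_gt0//; lra.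
set d := eps / (10 * (C + 1)) in d0.
have dC : C * d <= eps / 10.
  rewrite /d mulrA ler_pdivrMr; last by lra.
  by nra.
have [B B0 HB] : exists2 B : R, 0 <= B & tail nu B <= d.
  near (+oo : set_system R) => B; exists B.
    by near: B; apply: nbhs_pinfty_ge; rewrite num_real.
  by near: B; exact: tail_cvg0.
have e10 : 0 < eps / 10 by lra.
have [rho rho0 Hrho] := @uniform_continuity f (-1) (B + 1) (eps / 10) cf e10.
pose r := Num.min rho 1 / 2.
have r0 : 0 < r by rewrite divr_gt0// lt_min rho0/=.
have rE : 2 * r = Num.min rho 1 by rewrite /r mulrC divfK.
have r2 : 2 * r <= rho by rewrite rE ge_min lexx.
have r1 : 2 * r <= 1 by rewrite rE ge_min lexx orbT.
(* These windows make the points increasing with gaps below 2 r <= rho, and put s_0 below 0, where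
   [nu] has no mass. *)
have /choice[s Hs] : forall i : nat, exists t,
    i%:R * r - 2 * r < t < i%:R * r - r /\ pr nu [set t] = 0.
  move=> i; have : i%:R * r - 2 * r < i%:R * r - r by lra.
  by move=> /(exists_nonatom nu)[t ? ?]; exists t.
pose m := (Num.truncn ((B + 2 * r) / r)).+1.
have Bm : B <= s m.
  have [/andP[sm _] _] := Hs m; apply: le_trans (ltW sm).
  rewrite lerBrDr -ler_pdivrMr//; exact/ltW/truncnS_gt.
have mB : m%:R * r <= B + 3 * r.
  rewrite -[m]addn1 natrD mulrDl mul1r.
  suff : (Num.truncn ((B + 2 * r) / r))%:R * r <= B + 2 * r by lra.
  by rewrite -ler_pdivlMr// truncn_le// divr_ge0//; lra.
have sS n : s n <= s n.+1.
  have [/andP[_ s1] _] := Hs n; have [/andP[s2 _] _] := Hs n.+1.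
  by move: s2; rewrite -[in n.+1%:R]addn1 natrD; lra.
have fs n y : (n < m)%N -> s n < y <= s n.+1 -> `|f y - f (s n.+1)| <= eps / 10.
  move=> nm /andP[sy ys]; rewrite distrC.
  have [/andP[s1 _] _] := Hs n; have [/andP[s2 s3] _] := Hs n.+1.
  have nmr : n.+1%:R * r <= m%:R * r by rewrite ler_pM2r// ler_nat.
  move: s2 s3 nmr; rewrite -[in n.+1%:R]addn1 natrD => s2 s3 nmr.
  have n0 : 0 <= n%:R * r by rewrite mulr_ge0// ltW.
  apply: Hrho; first by lra.
  by rewrite ltr_norml; lra.
have e10' : 0 <= eps / 10 by lra.
have A k := @step_approximation k f C cf fC s (eps / 10) m e10' sS fs.
pose D x n := pr (kappa x) `]-oo, s n] - pr nu `]-oo, s n].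
have Cm0 : 0 <= C * m%:R by exact: mulr_ge0.
have m0 : 0 < 2 * C * m%:R + 1 by lra.
(* Each of the m terms is at most C times a difference of two values of [D]; the second entry keeps
   the total below eps / 10. *)
pose dd := Num.min d (eps / (10 * (2 * C * m%:R + 1))).
have dd0 : 0 < dd by rewrite lt_min d0 divr_gt0//; lra.
have near_all M : \forall x \near +oo, forall n, (n <= M)%N -> `|D x n| <= dd.
  elim: M => [|M ih].
    have [_ /Hcdf/(_ dd dd0)] := Hs 0%N.
    by apply: filterS => x Dx n; rewrite leqn0 => /eqP ->.
  have [_ /Hcdf/(_ dd dd0)] := Hs M.+1.
  move: ih; apply: filterS2 => x ih Dx n.
  by rewrite leq_eqVlt => /orP[/eqP ->//|]; rewrite ltnS; exact: ih.
near=> x.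
have Dx : forall n, (n <= m)%N -> `|D x n| <= dd by near: x; exact: near_all.
have ddd : dd <= d by rewrite ge_min lexx.
have ddm : 2 * C * m%:R * dd <= eps / 10.
  have : dd <= eps / (10 * (2 * C * m%:R + 1)) by rewrite ge_min lexx orbT.
  rewrite ler_pdivlMr; last by lra.
  by have := ltW dd0; lra.
have Adiff : `|\sum_(n < m) f (s n.+1) * (pr (kappa x) `]-oo, s n.+1] -
      pr (kappa x) `]-oo, s n]) - \sum_(n < m) f (s n.+1) *
      (pr nu `]-oo, s n.+1] - pr nu `]-oo, s n])| <= eps / 10.
  apply: le_trans ddm; rewrite -sumrB.
  apply: le_trans (ler_norm_sum _ _ _) _.
  have -> : 2 * C * m%:R * dd = \sum_(n < m) (2 * C * dd).
    by rewrite sumr_const card_ord -mulr_natr; ring.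
  apply: ler_sum => n _.
  have -> : f (s n.+1) * (pr (kappa x) `]-oo, s n.+1] - pr (kappa x) `]-oo, s n]) -
      f (s n.+1) * (pr nu `]-oo, s n.+1] - pr nu `]-oo, s n]) =
      f (s n.+1) * (D x n.+1 - D x n) by rewrite /D; ring.
  rewrite normrM -mulrA [2 * _]mulrC -mulrA; apply: ler_pM => //.
  apply: le_trans (ler_normB _ _) _.
  have := Dx n.+1 (ltn_ord n); have := Dx n (ltnW (ltn_ord n)); lra.
have s00 : pr nu `]-oo, s 0%N] = 0.
  by apply: nuneg; have [/andP[_ +] _] := Hs 0%N; rewrite mul0r; lra.
have smd : 1 - pr nu `]-oo, s m] <= d.
  have -> : 1 - pr nu `]-oo, s m] = tail nu (s m).
    by rewrite -pr_setC// setCitvl.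
  by apply: le_trans HB; exact: le_tail.
have := A nu; have := A (kappa x); move: Adiff.
have := Dx 0%N (leq0n m); have := Dx m (leqnn m).
rewrite /D s00 !ler_norml => /andP[? ?] /andP[? ?] /andP[? ?] /andP[? ?] /andP[? ?].
have h1 : C * pr (kappa x) `]-oo, s 0%N] <= eps / 10.
  by apply: le_trans dC; rewrite ler_wpM2l//; lra.
have h2 : C * (1 - pr (kappa x) `]-oo, s m]) <= 2 * (eps / 10).
  apply: le_trans (_ : C * (2 * d) <= _); last by lra.
  by rewrite ler_wpM2l//; lra.
have h3 : C * (1 - pr nu `]-oo, s m]) <= eps / 10.
  by apply: le_trans dC; rewrite ler_wpM2l//; lra.
lra.
Unshelve. all: by end_near. Qed.

End weak_convergence.

Section integral_agreement.
Import HBNNSimple.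

(** The integral is built from simple functions, which evaluate the set function on measurable sets
    only. This lets [cond_law], a bare set function, be compared with a measure. *)
Lemma eq_integral_measurable d (T : measurableType d) (R : realType)
    (m1 m2 : set T -> \bar R) (f : T -> \bar R) :
  (forall A, measurable A -> m1 A = m2 A) ->
  (\int[m1]_x f x = \int[m2]_x f x)%E.
Proof.
move=> m12.
have E : (fun h : {nnsfun T >-> R} => sintegral m1 h) =
    (fun h : {nnsfun T >-> R} => sintegral m2 h).
  by apply/funext => h; apply: eq_fsbigr => r _; rewrite m12.
by rewrite /integral E.
Qed.

End integral_agreement.

Section conditioning.
Context d (T : measurableType d) (R : realType) (P : probability T R).
Variables (B : set T) (X : T -> R).
Hypotheses (mB : measurable B) (mX : measurable_fun setT X).

(** [mnormalize] falls back on [P] when [B] is null, so this is a probability for every [B]. *)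
Definition cond_law_probability : probability R R :=
  image_probability (mnormalize (mrestr P mB) P) mX.

Hypothesis B_gt0 : 0 < pr P B.

Lemma cond_law_probabilityE (A : set R) : measurable A ->
  pr cond_law_probability A = pr P (X @^-1` A `&` B) / pr P B.
Proof.
move=> mA; have mXA : measurable (X @^-1` A).
  by rewrite -[X in measurable X]setTI; exact: mX.
transitivity (fine (mnormalize (mrestr P mB) P (X @^-1` A))) => //.
rewrite /mnormalize /= /mrestr setTI.
have -> : (P B == 0%E) = false.
  by rewrite (prE P mB) eqe gt_eqF.
have -> : (P B == +oo%E) = false by rewrite (prE P mB).
rewrite /= fineM//; first by rewrite fin_num_measure//; exact: measurableI.
Qed.

Lemma cond_law_integral (f : R -> \bar R) :
  (\int[cond_law P B X]_y f y = \int[cond_law_probability]_y f y)%E.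
Proof.
apply: eq_integral_measurable => A mA.
by rewrite (prE cond_law_probability mA) cond_law_probabilityE.
Qed.

End conditioning.

Section tail_continuity.
Context {R : realType}.

Lemma tail_right_continuous (G : probability R R) (s delta : R) : 0 < delta ->
  exists2 t, s < t & tail G s - delta <= tail G t.
Proof.
move=> d0; apply: contrapT => H.
have /= : pr G (\bigcup_n `]s + n.+1%:R^-1, +oo[%classic) <= tail G s - delta.
  apply: pr_bigcup_le => //.
    move=> m n mn x /=; rewrite !in_itv/= !andbT; apply: le_lt_trans.
    by rewrite lerD2l lef_pV2 ?posrE// ler_nat.
  move=> n; rewrite leNgt; apply/negP => sn; apply: H.
  exists (s + n.+1%:R^-1); first by rewrite ltrDl invr_gt0.
  exact: ltW.
rewrite (_ : \bigcup_n _ = `]s, +oo[%classic).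
  by rewrite -[pr G _]/(tail G s); lra.
apply/seteqP; split=> x /=; rewrite in_itv/= andbT.
  by move=> [n _ /=]; rewrite in_itv/= andbT; apply: lt_trans; rewrite ltrDl invr_gt0.
move=> sx; have xs : 0 < x - s by lra.
have [n Hn] := ltr_add_invr sx.
by exists n => //=; rewrite in_itv/= andbT.
Qed.

(** The left limit of the tail at s is the mass of [[s, +oo[], which equals the tail at s as s is
    not an atom. *)
Lemma tail_left_continuous (G : probability R R) (s s0 delta : R) :
  pr G [set s] = 0 -> s0 < s -> 0 < delta ->
  exists2 t, s0 < t < s & tail G t <= tail G s + delta.
Proof.
move=> Gs s0s d0; apply: contrapT => H.
have C t : pr G `]-oo, t]%classic = 1 - tail G t.
  by rewrite -setCitvr pr_setC.
have /= : pr G (\bigcup_n `]-oo, s - n.+1%:R^-1]%classic) <= 1 - tail G s - delta.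
  apply: pr_bigcup_le => //.
    move=> m n mn x /=; rewrite !in_itv/= => /le_trans; apply.
    by rewrite lerD2l lerN2 lef_pV2 ?posrE// ler_nat.
  (* The midpoint keeps t in []s0, s[] when n is small. *)
  move=> n; pose t := Num.max (s - n.+1%:R^-1) ((s0 + s) / 2).
  have tn : s - n.+1%:R^-1 <= t by rewrite le_max lexx.
  have ts : s0 < t < s.
    have n0 : 0 < n.+1%:R^-1 :> R by rewrite invr_gt0.
    rewrite /t gt_max lt_max; apply/andP; split; last first.
      by rewrite ltrBlDr ltrDl n0/=; lra.
    by apply/orP; right; lra.
  have Ht : tail G s + delta < tail G t.
    by rewrite ltNge; apply/negP => h; apply: H; exists t.
  by rewrite C; have := le_tail G tn; lra.
rewrite (_ : \bigcup_n _ = `]-oo, s[%classic); last first.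
  apply/seteqP; split=> x /=; rewrite in_itv/=.
    move=> [n _ /=]; rewrite in_itv/= => /le_lt_trans; apply.
    by rewrite ltrBlDr ltrDl invr_gt0.
  move=> xs; have [n Hn] := ltr_add_invr xs.
  by exists n => //=; rewrite in_itv/= lerBrDr ltW.
suff : 1 - tail G s = pr G `]-oo, s[%classic by lra.
rewrite -C (_ : `]-oo, s]%classic = `]-oo, s[%classic `|` [set s]).
  rewrite pr_setU ?Gs ?addr0// => x [] /=; rewrite in_itv/= => xs xs'.
  by rewrite xs' ltxx in xs.
by rewrite setUitv1.
Qed.

End tail_continuity.

Lemma asymp_trans (R : realType) (f g h : R -> R) : asymp f g -> asymp g h -> asymp f h.
Proof.
move=> fg gh; rewrite /asymp -(mul1r 1).
apply: cvg_trans (cvgM fg gh); apply: near_eq_cvg.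
have h1 : 0 < 1 / 2 :> R by lra.
have /cvgrPdist_le/(_ _ h1) := gh; apply: filterS => x /= ghx.
have g0 : g x != 0.
  by apply: contraTneq ghx => ->; rewrite mul0r subr0 normr1 -ltNge; lra.
by rewrite mulrA divfK.
Qed.

(** Replacing x by x + e x costs a bounded factor and, e being nondecreasing, covers at least one
    more step of length e x. Exceedance times at levels in the window from x to x + k * e x can thus
    be measured in units of e x. *)
Lemma increases_growth (R : realType) (e : R -> R) (k : nat) : increases_to_infty e ->
  (limf_esup (fun x : R => (e (x + e x) / e x)%:E) +oo%R < +oo)%E ->
  exists2 C, 0 < C & \forall x \near +oo, e (x + k%:R * e x) <= C * e x.
Proof.
move=> [epos emono _] Hsup.
have [c c0 Hc] : exists2 c, 0 < c & \forall x \near +oo, e (x + e x) <= c * e x.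
  (* A finite upper limit gives a supremum below +oo on some half-line; the value -oo is impossible
     because the half-line is not empty. *)
  have [_ [A [M [_ HM]] <-]] := ereal_inf_lt Hsup.
  case Es : (ereal_sup _) => [c| |] // _.
    exists (Num.max c 1); first by rewrite lt_max ltr01 orbT.
    near=> x; have x0 : 0 <= x by near: x; apply: nbhs_pinfty_ge; rewrite num_real.
    rewrite -ler_pdivrMr; last exact: epos.
    rewrite le_max -lee_fin -Es; apply/orP; left.
    apply: ereal_sup_ubound; exists x => //; apply: HM.
    by near: x; apply: nbhs_pinfty_gt; rewrite num_real.
  exfalso.
  have : ((e (Num.max M 0 + 1 + e (Num.max M 0 + 1)) / e (Num.max M 0 + 1))%:E <= -oo)%E.
    rewrite -Es; apply: ereal_sup_ubound; exists (Num.max M 0 + 1) => //.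
    by apply: HM; apply: le_lt_trans (_ : Num.max M 0 < _); rewrite ?le_max ?lexx//; lra.
  by rewrite leeNy_eq.
elim: k => [|k [C C0 HC]].
  by exists 1 => //; apply: nearW => x; rewrite mul0r addr0 mul1r.
have [M1 [_ HM1]] := HC.
exists (C * c); first exact: mulr_gt0.
near=> x.
have x0 : 0 <= x by near: x; apply: nbhs_pinfty_ge; rewrite num_real.
have xM : M1 < x by near: x; apply: nbhs_pinfty_gt; rewrite num_real.
have ex := epos x x0.
have h1 : e (x + e x) <= c * e x by near: x; exact: Hc.
have h2 : e x <= e (x + e x) by apply: emono => //; lra.
have h3 : e (x + e x + k%:R * e (x + e x)) <= C * e (x + e x) by apply: HM1; lra.
have k0 : (0 : R) <= k%:R by [].
apply: le_trans (_ : e (x + e x + k%:R * e (x + e x)) <= _).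
  apply: emono; first by rewrite addr_ge0// mulr_ge0// ltW.
  rewrite -[k.+1]addn1 natrD mulrDl mul1r -addrA [k%:R * _ + _]addrC lerD2l lerD2l.
  exact: ler_wpM2l.
by apply: le_trans h3 _; rewrite -mulrA ler_pM2l.
Unshelve. all: by end_near. Qed.

(** * Distribution of the hitting time *)

(** Arithmetic shared by both lower bounds: h is tail H x, D an increment of tails, S a sum of jump
    probabilities, V the probability of exceeding x. Three factors 1 - theta (two from S, one from b
    against a) and 1 - theta - V >= 1 - 2 theta cost 5 theta; g - 2 theta costs 2 more. *)
Lemma jump_bound (R : realType) (a b theta g h V S D pr : R) :
  0 < a -> 0 < theta <= 1 / 8 -> 0 < b <= a * (1 + theta) -> g <= 1 ->
  0 <= h -> V <= theta -> (1 - theta) * ((1 - theta) / b * D) <= S ->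
  (g - 2 * theta) * h <= D -> (1 - theta - V) * S <= pr -> 0 <= pr ->
  a^-1 * (g - 7 * theta) * h <= pr.
Proof.
move=> a0 /andP[t0 t8] /andP[b0 ba] g1 h0 Vt DS gD Spr pr0.
have ai0 : 0 < a^-1 by rewrite invr_gt0.
have [g0|g0] := leP (g - 2 * theta) 0.
  apply: le_trans pr0; rewrite -mulrA pmulr_rle0//.
  by rewrite mulr_le0_ge0//; lra.
have D0 : 0 <= D by apply: le_trans gD; rewrite mulr_ge0// ltW.
have ab : a^-1 * (1 - theta) <= b^-1.
  rewrite -(ler_pM2r b0) mulVf ?gt_eqF// -(ler_pM2l a0) mulrA mulrA divff ?gt_eqF//.
  by rewrite mul1r mulr1; nra.
have S1 : (1 - theta) * (1 - theta) * (1 - theta) * (a^-1 * D) <= S.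
  apply: le_trans DS.
  have -> : (1 - theta) * ((1 - theta) / b * D) = (1 - theta) * (1 - theta) * (b^-1 * D).
    by ring.
  rewrite -[leLHS]mulrA; apply: ler_wpM2l; first by rewrite mulr_ge0//; lra.
  by rewrite mulrA [_ * a^-1]mulrC ler_wpM2r.
have aD : 0 <= a^-1 * D by rewrite mulr_ge0// ltW.
have S0 : 0 <= S by apply: le_trans S1; rewrite !mulr_ge0//; lra.
have S2 : (1 - 2 * theta) * ((1 - theta) * (1 - theta) * (1 - theta) * (a^-1 * D)) <= pr.
  apply: le_trans (_ : (1 - 2 * theta) * S <= _).
    by rewrite ler_wpM2l//; lra.
  by apply: le_trans Spr; rewrite ler_wpM2r//; lra.
apply: le_trans S2.
have -> : (1 - 2 * theta) * ((1 - theta) * (1 - theta) * (1 - theta) * (a^-1 * D)) =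
  a^-1 * ((1 - 2 * theta) * ((1 - theta) * (1 - theta) * (1 - theta)) * D) by ring.
rewrite -mulrA ler_pM2l//.
have F5 : 1 - 5 * theta <= (1 - 2 * theta) * ((1 - theta) * (1 - theta) * (1 - theta)).
  have h1 : 1 - 2 * theta <= (1 - theta) * (1 - theta) by nra.
  have h2 : 1 - 3 * theta <= (1 - theta) * (1 - theta) * (1 - theta) by nra.
  nra.
apply: le_trans (_ : (1 - 5 * theta) * D <= _); last by rewrite ler_wpM2r.
apply: le_trans (_ : (1 - 5 * theta) * ((g - 2 * theta) * h) <= _).
  by rewrite mulrA ler_wpM2r//; nra.
by rewrite ler_wpM2l//; lra.
Qed.

Lemma add_linear_le (R : realType) (x K b bn s e c t : R) :
  bn <= b + (s * e + c) -> K + b + c <= e * (t - s) ->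
  x + K + bn <= x + t * e.
Proof. by lra. Qed.

Section hitting_lower_bounds.
Context d (Omega : measurableType d) (R : realType) (P : probability Omega R).
Variables (Z : R -> {RV P >-> R}) (T : nat -> {RV P >-> R}).
Hypotheses (Z0 : forall w, Z 0 w = 0) (reg : regenerative_increments Z T).

Local Notation inc := (@cycle_increment R : cycle_space R -> R).
Local Notation len := (@cycle_length R : cycle_space R -> R).
Local Notation top := (cycle_top (R:=R)).
Local Notation p := (cycle_law reg).
Local Notation Q := (cycle_seq_law reg).

Variables (mu a : R) (F H G : probability R R) (e : R -> R).
Hypotheses (mu0 : 0 < mu) (a0 : 0 < a).
Hypotheses (int_inc : p.-integrable setT (EFin \o inc))
  (mean_inc : (\int[p]_c (inc c)%:E = (- a)%:E)%E)
  (int_len : p.-integrable setT (EFin \o len))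
  (mean_len : (\int[p]_c (len c)%:E = mu%:E)%E).
Hypotheses (HF : integrated_tail_of F H) (Hsub : subexponential H).
Hypothesis inc_tail : asymp (fun x => pr p [set c | x < inc c]) (tail F).
Hypothesis e_inf : increases_to_infty e.
Hypothesis HG : forall t : R, 0 < t ->
  tail H (x + t * e x) / tail H x @[x --> +oo] --> tail G t.
Hypothesis exceeds_small : forall eta, 0 < eta -> \forall x \near +oo,
  pr Q [set s | exists n, cycle_exceeds inc top x n s] <= eta.

Definition sup_exceeds (x : R) : set Omega := [set w | (x%:E < process_sup Z w)%E].

Lemma measurable_sup_exceeds x : measurable (sup_exceeds x).
Proof.
rewrite (_ : sup_exceeds x =
    cycle_seq Z T @^-1` \bigcup_n [set s | cycle_exceeds inc top x n s]).
  rewrite -[X in measurable X]setTI; apply: (measurable_cycle_seq reg) => //.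
  apply: bigcupT_measurable => n; apply: measurable_cycle_exceeds => //.
    exact: measurable_cycle_increment.
  exact: measurable_cycle_top.
apply/seteqP; split=> w; rewrite /sup_exceeds /= (process_sup_gtP Z0 reg).
  by move=> [n ?]; exists n.
by move=> [n _ ?]; exists n.
Qed.

Let Hpos x : 0 < tail H x. Proof. by have [_ + _] := Hsub. Qed.

Let e_near (M : R) : \forall x \near +oo, M <= e x.
Proof. by have [_ _ /cvgryPge] := e_inf. Qed.

Let tail_ratio (t eta : R) : 0 < t -> 0 < eta -> \forall x \near +oo,
  (tail G t - eta) * tail H x <= tail H (x + t * e x) <=
  (tail G t + eta) * tail H x.
Proof.
move=> t0 eta0; have /cvgrPdist_le/(_ _ eta0) := HG t0; apply: filterS => x.
by rewrite ler_distlC ler_pdivlMr// ler_pdivrMr.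
Qed.

Lemma pr_big_jump_le (eps K x : R) (U : nat -> set (cycle_space R)) n1 n2
    (A : set Omega) : measurable A -> (forall n, measurable (U n)) ->
  (forall w n, (n1 <= n < n2)%N ->
    first_big_jump inc len top a mu eps K x U n (cycle_seq Z T w) -> A w) ->
  pr Q [set s | exists2 n, (n1 <= n < n2)%N &
    first_big_jump inc len top a mu eps K x U n s] <= pr P A.
Proof.
move=> mA mU UA.
have mE : measurable [set s | exists2 n, (n1 <= n < n2)%N &
    first_big_jump inc len top a mu eps K x U n s].
  rewrite (_ : [set s | _] = \bigcup_(n in [set n | (n1 <= n < n2)%N])
      [set s | first_big_jump inc len top a mu eps K x U n s]).
    apply: bigcup_measurable => n _; apply: measurable_first_big_jump => //.
    - exact: measurable_cycle_increment.
    - exact: measurable_cycle_length.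
    - exact: measurable_cycle_top.
  by apply/seteqP; split=> s' [n]; exists n.
apply: (@le_trans _ _ (pr P (cycle_seq Z T @^-1` [set s | exists2 n,
    (n1 <= n < n2)%N & first_big_jump inc len top a mu eps K x U n s]))) => //.
apply: le_pr => //.
  by rewrite -[X in measurable X]setTI; exact: (measurable_cycle_seq reg).
by move=> w [n n12 jn]; exact: UA jn.
Qed.

(** Under the linear bounds T_n >= t * e x from cycle n1 on, so a first big jump there is late. The
    room between a t / mu and t' absorbs eps, K and the rounding of n1. *)
Lemma late_hitting_ge (t t' delta : R) : 0 < t -> a * t / mu < t' -> 0 < delta ->
  \forall x \near +oo, a^-1 * (tail G t' - delta) * tail H x <=
  pr P (sup_exceeds x `&` [set w | ((t * e x)%:E <= hitting_time Z x w)%E]).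
Proof.
have mu_gt0 := mu0; have a_gt0 := a0.
move=> t0; rewrite ltr_pdivrMr// => att' d0.
have t'0 : 0 < t'.
  by rewrite -(pmulr_lgt0 _ mu0); apply: lt_trans att'; rewrite mulr_gt0.
pose theta := Num.min (1 / 8) (delta / 7).
have th0 : 0 < theta by rewrite lt_min; lra.
have th8 : theta <= 1 / 8 by rewrite ge_min lexx.
have thd : 7 * theta <= delta.
  have : theta <= delta / 7 by rewrite ge_min lexx orbT.
  lra.
have r0 : 0 < (t' * mu - a * t) / (2 * (t + t')) by rewrite divr_gt0//; lra.
(* The three entries give a + eps <= a (1 + theta), mu - eps > 0 and (a + eps) t / (mu - eps) <
   t'. *)
pose eps := Num.min (theta * a) (Num.min (mu / 2) ((t' * mu - a * t) / (2 * (t + t')))).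
have eps0 : 0 < eps by rewrite !lt_min r0 mulr_gt0//=; lra.
have eps1 : eps <= theta * a by rewrite ge_min lexx.
have eps2 : eps <= mu / 2 by rewrite !ge_min lexx !orbT.
have eps3 : eps * (2 * (t + t')) <= t' * mu - a * t.
  by rewrite -ler_pdivlMr; [rewrite !ge_min lexx !orbT|lra].
pose b := a + eps; pose m := mu - eps.
have b0 : 0 < b by rewrite /b; lra.
have m0 : 0 < m by rewrite /m; lra.
pose s := b * t / m.
have st' : s < t' by rewrite /s ltr_pdivrMr// /b /m; lra.
have [K K0 HK] := linear_bounds_large (iid_cycles reg) measurable_cycle_increment
  measurable_cycle_length int_inc mean_inc int_len mean_len eps0 th0.
have th01 : 0 < theta < 1 by rewrite th0; lra.
have th1 : 0 <= 1 - theta by lra.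
have sums := sum_tail_ge HF inc_tail th01.
near=> x.
have x0 : 0 <= x by near: x; apply: nbhs_pinfty_ge; rewrite num_real.
have sx : forall y c n1 n2, x <= y -> 0 < c -> (n1 <= n2)%N ->
  (1 - theta) / c * (tail H (y + c * n1%:R) - tail H (y + c * n2%:R)) <=
  \sum_(n1 <= n < n2) pr p [set c0 | y + c * n%:R < inc c0] by near: x.
have Vx : pr Q [set s | exists n, cycle_exceeds inc top x n s] <= theta.
  by near: x; exact: exceeds_small.
have /andP[Gx _] : (tail G t' - theta) * tail H x <= tail H (x + t' * e x) <=
  (tail G t' + theta) * tail H x by near: x; exact: tail_ratio.
have ex : (K + b + b * K / m) / (t' - s) <= e x by near: x; exact: e_near.
rewrite ler_pdivrMr ?subr_gt0// in ex.
have ex0 : 0 < e x by have [+ _ _] := e_inf; exact.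
pose n1 := (Num.truncn ((t * e x + K) / m)).+1.
have n1_ge : t * e x + K <= m * n1%:R.
  by rewrite [m * _]mulrC -ler_pdivrMr//; exact/ltW/truncnS_gt.
have n1_le : b * n1%:R <= b + (s * e x + b * K / m).
  have : n1%:R <= 1 + (t * e x + K) / m.
    rewrite -[n1]add1n natrD lerD2l truncn_le// divr_ge0 ?ltW//.
    by rewrite addr_gt0 ?mulr_gt0.
  have -> : b + (s * e x + b * K / m) = b * (1 + (t * e x + K) / m).
    by rewrite /s; field; rewrite gt_eqF.
  by rewrite ler_pM2l.
have Hn1 : (tail G t' - theta) * tail H x <= tail H (x + K + b * n1%:R).
  by apply: le_trans Gx _; apply: le_tail; exact: add_linear_le n1_le ex.
(* The sum has to be finite; n2 may depend on x and is taken so far out that the remaining tail is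
   at most theta * tail H x. *)
have [n2 n12 Hn2] : exists2 n2, (n1 <= n2)%N &
    tail H (x + K + b * n2%:R) <= theta * tail H x.
  have thx : 0 < theta * tail H x by rewrite mulr_gt0.
  have [M [_ HM]] := tail_cvg0 H thx.
  exists (maxn n1 (Num.truncn (`|M| / b)).+1); first exact: leq_maxl.
  apply: HM; apply: le_lt_trans (ler_norm M) _.
  have : `|M| < b * (maxn n1 (Num.truncn (`|M| / b)).+1)%:R.
    rewrite [b * _]mulrC -ltr_pdivrMr//; apply: lt_le_trans (truncnS_gt _) _.
    by rewrite ler_nat leq_maxr.
  by move=> /lt_le_trans; apply; rewrite lerDr addr_ge0// ltW.
pose U n : set (cycle_space R) := [set c | x + K + b * n%:R < inc c].
have mU n : measurable (U n).
  rewrite -[X in measurable X]setTI.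
  by apply: measurable_fun_ltr => //; exact: measurable_cycle_increment.
have big := pr_some_big_jump_ge (iid_cycles reg) measurable_cycle_increment
  measurable_cycle_length measurable_cycle_top cycle_increment_le_top mU
  (fun n c h => h) n1 n2 HK.
apply: (@le_trans _ _ (a^-1 * (tail G t' - 7 * theta) * tail H x)).
  by rewrite ler_pM2r// ler_pM2l ?invr_gt0// lerD2l lerN2.
have xK : x <= x + K by rewrite lerDl ltW.
have S1 := sx (x + K) b n1 n2 xK b0 n12.
have hth : 0 < theta <= 1 / 8 by rewrite th0.
have hb : 0 < b <= a * (1 + theta) by rewrite b0 /b mulrDr mulr1 lerD2l mulrC.
have Hn12 : 0 <= tail H (x + K + b * n1%:R) - tail H (x + K + b * n2%:R).
  by rewrite subr_ge0 le_tail// lerD2l ler_pM2l// ler_nat.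
have hS : (1 - theta) * ((1 - theta) / b *
    (tail H (x + K + b * n1%:R) - tail H (x + K + b * n2%:R))) <=
    \sum_(n1 <= n < n2) pr p (U n).
  apply: le_trans S1; apply: ler_piMl; last by rewrite gerBl ltW.
  by rewrite mulr_ge0// divr_ge0// ltW.
have hD : (tail G t' - 2 * theta) * tail H x <=
    tail H (x + K + b * n1%:R) - tail H (x + K + b * n2%:R).
  by rewrite mulr_natl mulr2n opprD addrA mulrBl; exact: lerB.
apply: (jump_bound a0 hth hb (tail_le1 G t') (ltW (Hpos x)) Vx hS hD _ (pr_ge0 _ _)).
apply: le_trans big _.
apply: pr_big_jump_le => //.
  apply: measurableI; first exact: measurable_sup_exceeds.
  rewrite -[X in measurable X]setTI.
  exact: emeasurable_fun_c_infty (measurable_hitting_time Z0 reg x) _.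
move=> w n /andP[n1n _] jn; split.
  apply/(process_sup_gtP Z0 reg); exists n.
  exact: (first_big_jump_exceeds cycle_increment_le_top _ jn).
have [[_ Ln _] noex _] := jn.
apply: le_trans (hitting_time_ge Z0 reg noex).
rewrite lee_fin -(partial_sum_len reg).
apply: le_trans Ln; rewrite lerBrDr; apply: le_trans n1_ge _.
by rewrite ler_pM2l// ler_nat.
Unshelve. all: by end_near. Qed.

Hypothesis e_limsup :
  (limf_esup (fun x : R => (e (x + e x) / e x)%:E) +oo%R < +oo)%E.
Hypothesis exceedance_small : forall y eta : R, 0 < y -> 0 < eta ->
  \forall x \near +oo,
  pr p [set c | y * e x < cycle_exceedance x c /\ x < inc c] <=
  eta * pr p [set c | x < inc c].

(** In the cycles n < n2, with b * n2 about t' * e x, the linear bounds give T_n <= s * e x + K with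
    s < t. The slack t - s is halved: v * e x for K, v * e x for the time inside the jump cycle. *)
Lemma early_hitting_ge (t t' delta : R) : 0 < t' -> t' < a * t / mu ->
  0 < delta ->
  \forall x \near +oo, a^-1 * (1 - tail G t' - delta) * tail H x <=
  pr P (sup_exceeds x `&`
    [set w | (hitting_time Z x w <= (t * e x)%:E)%E]).
Proof.
have mu_gt0 := mu0; have a_gt0 := a0.
move=> t'0; rewrite ltr_pdivlMr// => t'at d0.
have t0 : 0 < t.
  by rewrite -(pmulr_rgt0 _ a0); apply: lt_trans t'at; rewrite mulr_gt0.
pose theta := Num.min (1 / 8) (delta / 7).
have th0 : 0 < theta by rewrite lt_min; lra.
have th8 : theta <= 1 / 8 by rewrite ge_min lexx.
have thd : 7 * theta <= delta.
  have : theta <= delta / 7 by rewrite ge_min lexx orbT.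
  lra.
have th01 : 0 < theta < 1 by rewrite th0; lra.
have th1 : 0 <= 1 - theta by lra.
have r0 : 0 < (a * t - t' * mu) / (2 * t') by rewrite divr_gt0//; lra.
pose eps := Num.min (theta * a) ((a * t - t' * mu) / (2 * t')).
have eps0 : 0 < eps by rewrite lt_min r0 mulr_gt0.
have eps1 : eps <= theta * a by rewrite ge_min lexx.
have eps2 : eps * (2 * t') <= a * t - t' * mu.
  by rewrite -ler_pdivlMr; [rewrite ge_min lexx orbT|lra].
pose b := a + eps.
have b0 : 0 < b by rewrite addr_gt0.
pose s := (mu + eps) * t' / b.
have st : s < t.
  rewrite /s ltr_pdivrMr// /b.
  have : 0 < eps * t by rewrite mulr_gt0.
  lra.
pose v := (t - s) / 2.
have v0 : 0 < v by rewrite divr_gt0// subr_gt0.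
have vE : s + v + v = t by rewrite /v; field.
have [K K0 HK] := linear_bounds_large (iid_cycles reg) measurable_cycle_increment
  measurable_cycle_length int_inc mean_inc int_len mean_len eps0 th0.
have sums := sum_tail_ge HF inc_tail th01.
(* Once K <= e x, every level y = x + K + b n used below lies in the window from x to x + k * e x,
   where e y <= C * e x. Then (4) at level y with constant v / (2 C) limits the exceedance time to v
   * e x / 2. *)
pose k := (Num.truncn (t' + 1)).+1.
have kt' : t' + 1 <= k%:R by exact/ltW/truncnS_gt.
have [C C0 HC] := increases_growth k e_inf e_limsup.
have vC0 : 0 < v / (2 * C) by rewrite divr_gt0// mulr_gt0.
have [M4 [_ HM4]] := exceedance_small vC0 th0.
have [M5 [_ HM5]] := long_tailed Hsub (ltW K0) th0.
near=> x.
have x0 : 0 <= x by near: x; apply: nbhs_pinfty_ge; rewrite num_real.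
have xM4 : M4 < x by near: x; apply: nbhs_pinfty_gt; rewrite num_real.
have xM5 : M5 < x by near: x; apply: nbhs_pinfty_gt; rewrite num_real.
have sx : forall y c n1 n2, x <= y -> 0 < c -> (n1 <= n2)%N ->
  (1 - theta) / c * (tail H (y + c * n1%:R) - tail H (y + c * n2%:R)) <=
  \sum_(n1 <= n < n2) pr p [set c0 | y + c * n%:R < inc c0] by near: x.
have Vx : pr Q [set s | exists n, cycle_exceeds inc top x n s] <= theta.
  by near: x; exact: exceeds_small.
have /andP[_ Gx] : (tail G t' - theta) * tail H x <= tail H (x + t' * e x) <=
  (tail G t' + theta) * tail H x by near: x; exact: tail_ratio.
have exK : K <= e x by near: x; exact: e_near.
have exv : K / v <= e x by near: x; exact: e_near.
rewrite ler_pdivrMr// in exv.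
have Cx : e (x + k%:R * e x) <= C * e x by near: x; exact: HC.
have ex0 : 0 < e x by have [+ _ _] := e_inf; exact.
have xK : x <= x + K by rewrite lerDl ltW.
pose n2 := (Num.truncn (t' * e x / b)).+1.
have n2_ge : t' * e x <= b * n2%:R.
  by rewrite [b * _]mulrC -ler_pdivrMr//; exact/ltW/truncnS_gt.
have n2_le n : (n < n2)%N -> b * n%:R <= t' * e x.
  rewrite ltnS => nn2; rewrite [b * _]mulrC -ler_pdivlMr//.
  apply: (@le_trans _ _ (Num.truncn (t' * e x / b))%:R); first by rewrite ler_nat.
  by rewrite truncn_le// divr_ge0 ?ltW// mulr_gt0.
have bn0 n : 0 <= b * n%:R by rewrite mulr_ge0// ltW.
have Hx1 : (1 - theta) * tail H x <= tail H (x + K).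
  have h : tail H x <= (1 + theta) * tail H (x + K).
    by rewrite -{1}(addrK K x); apply: HM5; exact: lt_le_trans xK.
  apply: le_trans (_ : (1 - theta) * ((1 + theta) * tail H (x + K)) <= _).
    exact: ler_wpM2l.
  rewrite mulrA; apply: ler_piMl; first exact: tail_ge0.
  by rewrite -subr_sqr expr1n gerBl sqr_ge0.
have Hx2 : tail H (x + K + b * n2%:R) <= (tail G t' + theta) * tail H x.
  apply: le_trans Gx; apply: le_tail.
  by rewrite -addrA lerD2l; apply: le_trans n2_ge _; rewrite lerDr ltW.
pose U n : set (cycle_space R) := [set c | x + K + b * n%:R < inc c /\
  cycle_exceedance (x + K + b * n%:R) c < v * e x].
have mI y : measurable [set c : cycle_space R | y < inc c].
  rewrite -[X in measurable X]setTI.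
  by apply: measurable_fun_ltr => //; exact: measurable_cycle_increment.
have mU n : measurable (U n).
  apply: measurableI; first exact: mI.
  rewrite -[X in measurable X]setTI.
  by apply: measurable_fun_ltr => //; exact: measurable_cycle_exceedance.
have big := pr_some_big_jump_ge (iid_cycles reg) measurable_cycle_increment
  measurable_cycle_length measurable_cycle_top cycle_increment_le_top mU
  (fun n c h => h.1) 0 n2 HK.
apply: (@le_trans _ _ (a^-1 * ((1 - tail G t') - 7 * theta) * tail H x)).
  by rewrite ler_pM2r// ler_pM2l ?invr_gt0// lerD2l lerN2.
have hth : 0 < theta <= 1 / 8 by rewrite th0.
have hb : 0 < b <= a * (1 + theta) by rewrite b0 /b mulrDr mulr1 lerD2l mulrC.
have hg : 1 - tail G t' <= 1 by rewrite gerBl tail_ge0.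
have S1 := sx (x + K) b 0%N n2 xK b0 (leq0n n2); rewrite mulr0 addr0 in S1.
have hU n : (n < n2)%N ->
    (1 - theta) * pr p [set c | x + K + b * n%:R < inc c] <= pr p (U n).
  move=> nn2; set y := x + K + b * n%:R.
  have xy : x <= y by rewrite /y -addrA lerDl addr_ge0// ltW.
  have y_le : y <= x + k%:R * e x.
    rewrite /y -addrA lerD2l; apply: le_trans (_ : (t' + 1) * e x <= _).
      by rewrite addrC [leRHS]mulrDl mul1r lerD// n2_le.
    by rewrite ler_pM2r.
  have ey : v / (2 * C) * e y < v * e x.
    apply: le_lt_trans (_ : v / (2 * C) * (C * e x) < _).
      rewrite ler_pM2l//; apply: le_trans Cx.
      by have [_ + _] := e_inf; apply => //; exact: le_trans xy.
    have -> : v / (2 * C) * (C * e x) = v * e x / 2 by field; rewrite gt_eqF.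
    have vex : 0 < v * e x by exact: mulr_gt0.
    by rewrite ltr_pdivrMr// ltr_pMr// ltr1n.
  have := HM4 y (lt_le_trans xM4 xy).
  set W := [set c | _] => HW.
  have mW : measurable (W : set (cycle_space R)).
    apply: measurableI; last exact: mI.
    rewrite -[X in measurable X]setTI.
    by apply: measurable_fun_ltr => //; exact: measurable_cycle_exceedance.
  rewrite mulrBl mul1r lerBlDr.
  apply: le_trans (_ : pr p (U n `|` W) <= _).
    apply: le_pr => //; first exact: measurableU.
    move=> c yc; have [h|h] := ltP (cycle_exceedance y c) (v * e x).
      by left; split.
    by right; split => //; exact: lt_le_trans h.
  by apply: le_trans (pr_setU_le _ (mU n) mW) _; rewrite lerD2l.
have hS : (1 - theta) * ((1 - theta) / b *
    (tail H (x + K) - tail H (x + K + b * n2%:R))) <=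
    \sum_(0 <= n < n2) pr p (U n).
  apply: le_trans (ler_wpM2l th1 S1) _.
  rewrite mulr_sumr !big_mkord; apply: ler_sum => n _; exact: hU.
have hD : ((1 - tail G t') - 2 * theta) * tail H x <=
    tail H (x + K) - tail H (x + K + b * n2%:R).
  have -> : (1 - tail G t' - 2 * theta) * tail H x =
    (1 - theta) * tail H x - (tail G t' + theta) * tail H x by ring.
  exact: lerB.
apply: (jump_bound a0 hth hb hg (ltW (Hpos x)) Vx hS hD _ (pr_ge0 _ _)).
apply: le_trans big _.
apply: pr_big_jump_le => //.
  apply: measurableI; first exact: measurable_sup_exceeds.
  rewrite -[X in measurable X]setTI.
  exact: emeasurable_fun_infty_c (measurable_hitting_time Z0 reg x) _.
move=> w n /andP[_ nn2] jn; split.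
  apply/(process_sup_gtP Z0 reg); exists n.
  have Uinc m c : U m c -> x + K + (a + eps) * m%:R < inc c by case.
  exact: (first_big_jump_exceeds cycle_increment_le_top Uinc jn).
have [[Sn _ Ln] _ [yinc yexc]] := jn.
have xS : x - partial_sum inc n (cycle_seq Z T w) <= x + K + b * n%:R.
  by rewrite -addrA lerD2l lerNl opprD addrC -mulNr.
apply: le_trans (hitting_time_le Z0 reg xS yinc yexc) _.
rewrite lee_fin -(partial_sum_len reg) -vE 2!mulrDl lerD2r.
apply: le_trans Ln _; apply: lerD; last by rewrite mulrC.
have -> : s * e x = (mu + eps) / b * (t' * e x) by rewrite /s; ring.
have -> : (mu + eps) * n%:R = (mu + eps) / b * (b * n%:R).
  by rewrite mulrA divfK// gt_eqF.
by rewrite ler_wpM2l ?n2_le// divr_ge0 ?addr_ge0 ?ltW.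
Unshelve. all: by end_near. Qed.

End hitting_lower_bounds.

(** As q <= 1, (q - 3 delta) (1 + delta) <= q - 2 delta: dividing by the upper bound costs one more
    delta. *)
Lemma ratio_bound (R : realType) (a h q N D delta : R) : 0 < a -> 0 < h ->
  0 < delta -> q <= 1 -> a^-1 * (q - 2 * delta) * h <= N ->
  D <= (a^-1 + a^-1 * delta) * h -> 0 < D -> 0 <= N ->
  q - 3 * delta <= N / D.
Proof.
move=> a0 h0 d0 q1 hN hD D0 N0; rewrite ler_pdivlMr//.
have [qd|qd] := leP (q - 3 * delta) 0.
  by apply: le_trans N0; rewrite mulr_le0_ge0// ltW.
apply: le_trans hN.
apply: le_trans (_ : (q - 3 * delta) * ((a^-1 + a^-1 * delta) * h) <= _).
  by rewrite ler_pM2l.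
have -> : (q - 3 * delta) * ((a^-1 + a^-1 * delta) * h) =
  a^-1 * ((q - 3 * delta) * (1 + delta)) * h by ring.
by rewrite ler_pM2r// ler_pM2l ?invr_gt0//; nra.
Qed.

Section hitting_events.
Context d (Omega : measurableType d) (R : realType) (P : probability Omega R).
Variables (Z : R -> {RV P >-> R}) (T : nat -> {RV P >-> R}).
Hypotheses (Z0 : forall w, Z 0 w = 0) (reg : regenerative_increments Z T).

Local Notation inc := (@cycle_increment R : cycle_space R -> R).
Local Notation len := (@cycle_length R : cycle_space R -> R).
Local Notation top := (cycle_top (R:=R)).
Local Notation p := (cycle_law reg).
Local Notation Q := (cycle_seq_law reg).

Lemma cycle_law_integral (f : cycle_space R -> R) : measurable_fun setT f ->
  P.-integrable setT (EFin \o (fun w => f (nth_cycle Z T 0 w))) ->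
  p.-integrable setT (EFin \o f) /\
  (\int[p]_c (f c)%:E = \int[P]_w (f (nth_cycle Z T 0 w))%:E)%E.
Proof.
move=> mf intf; have mphi := measurable_nth_cycle reg 0.
have mEf : measurable_fun setT (EFin \o f) by exact/measurable_EFinP.
split.
  exact: (@integrable_pushforward _ _ _ _ _ _ mphi P setT _ mEf).
exact: (@integral_pushforward _ _ _ _ _ _ mphi P setT _ mEf).
Qed.

Lemma mean_gt0 (X : Omega -> R) (m : R) : (forall w, 0 < X w) ->
  P.-integrable setT (EFin \o X) -> (\int[P]_w (X w)%:E = m%:E)%E -> 0 < m.
Proof.
move=> X0 intX EX.
have m0 : 0 <= m by rewrite -lee_fin -EX integral_ge0// => w _; rewrite lee_fin ltW.
rewrite lt_neqAle m0 andbT; apply/eqP => mE.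
have : (\int[P]_w `|(X w)%:E| = 0)%E.
  by rewrite (eq_integral (EFin \o X)) ?EX -?mE// => w _; rewrite /= gtr0_norm.
move/(ae_eq_integral_abs P measurableT (measurable_int _ intX)) => [N [mN N0 sN]].
have : P setT = 0%E.
  apply/eqP; rewrite -measure_le0 -N0; apply: le_measure; rewrite ?inE//.
  move=> w _; apply: sN => /(_ Logic.I) /= [] Xw.
  by have := X0 w; rewrite Xw ltxx.
by rewrite probability_setT => /eqP; rewrite onee_eq0.
Qed.

Lemma pr_sup_exceeds (x : R) : pr P (sup_exceeds Z x) =
  pr Q [set s | exists n, cycle_exceeds inc top x n s].
Proof.
rewrite (_ : sup_exceeds Z x =
  cycle_seq Z T @^-1` [set s | exists n, cycle_exceeds inc top x n s])//.
by apply/seteqP; split=> w; rewrite /sup_exceeds /= (process_sup_gtP Z0 reg).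
Qed.

(** On M > x, therefore, [fine] in the scaled hitting time does not turn an infinite value into
    0. *)
Lemma hitting_time_fin (x : R) w : sup_exceeds Z x w ->
  hitting_time Z x w \is a fin_num /\ (0 <= hitting_time Z x w)%E.
Proof.
move=> /(process_sup_gtP Z0 reg)/(exceeds_timeP Z0 reg)[t t0 xt].
have h0 : (0 <= hitting_time Z x w)%E.
  rewrite leNgt; apply/negP => /ereal_inf_lt[_ [u [u0 _] <-]].
  by rewrite lte_fin ltNge u0.
split => //; rewrite ge0_fin_numE//.
by apply: le_lt_trans (ltry t); apply: ereal_inf_lbound; exists t.
Qed.

Lemma measurable_scaled_hitting (e : R -> R) (x : R) :
  measurable_fun setT (fun w => fine (hitting_time Z x w) / e x).
Proof.
apply: measurable_funM => //; apply: measurableT_comp => //.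
exact: measurable_hitting_time Z0 reg x.
Qed.

End hitting_events.

Lemma tail_lt0 (R : realType) (G : probability R R) (s : R) :
  on_nonneg G -> s < 0 -> tail G s = 1.
Proof.
move=> G0 s0; apply/eqP; rewrite eq_le tail_le1/=.
rewrite -(congr1 fine G0 : pr G `[0, +oo[%classic = 1).
by apply: le_pr => // y /=; rewrite !in_itv/= !andbT; exact: lt_le_trans.
Qed.

Lemma tail_nonatom (R : realType) (G : probability R R) (s : R) :
  on_nonneg G -> pr G [set s] = 0 -> s <= 0 -> tail G s = 1.
Proof.
move=> G0 Gs; rewrite le_eqVlt => /orP[/eqP s0|]; last exact: tail_lt0.
rewrite -(congr1 fine G0 : pr G `[0, +oo[%classic = 1) -s0.
rewrite -(@setU1itv _ _ +oo%O s false)// -/(pr G _) pr_setU ?Gs ?add0r//.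
by move=> x [/= ->]; rewrite in_itv/= ltxx.
Qed.

(** * Conditional distribution function of the hitting time *)

Section hitting_cdf.
Context d (Omega : measurableType d) (R : realType) (P : probability Omega R).
Variables (Z : R -> {RV P >-> R}) (T : nat -> {RV P >-> R}).
Hypotheses (Z0 : forall w, Z 0 w = 0) (reg : regenerative_increments Z T).
Variables (mu a : R) (H G : probability R R) (e : R -> R).
Hypotheses (mu0 : 0 < mu) (a0 : 0 < a) (G0 : on_nonneg G).
Hypothesis tail_gt0 : forall x, 0 < tail H x.
Hypothesis e_gt0 : forall x, 0 <= x -> 0 < e x.
Hypothesis upper : forall delta, 0 < delta -> \forall x \near +oo,
  pr P (sup_exceeds Z x) <= (a^-1 + delta) * tail H x.
Hypothesis late : forall t t' delta, 0 < t -> a * t / mu < t' -> 0 < delta ->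
  \forall x \near +oo, a^-1 * (tail G t' - delta) * tail H x <=
  pr P (sup_exceeds Z x `&` [set w | ((t * e x)%:E <= hitting_time Z x w)%E]).
Hypothesis early : forall t t' delta, 0 < t' -> t' < a * t / mu -> 0 < delta ->
  \forall x \near +oo, a^-1 * (1 - tail G t' - delta) * tail H x <=
  pr P (sup_exceeds Z x `&` [set w | (hitting_time Z x w <= (t * e x)%:E)%E]).

Let mB x : measurable (sup_exceeds Z x).
Proof. exact: (measurable_sup_exceeds Z0 reg). Qed.

Let mhit x : measurable_fun setT (hitting_time Z x).
Proof. exact: (measurable_hitting_time Z0 reg). Qed.

Let mlate x (s : R) : measurable [set w | (s%:E <= hitting_time Z x w)%E].
Proof.
by rewrite -[X in measurable X]setTI; exact: emeasurable_fun_c_infty (mhit x) _.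
Qed.

Let mearly x (s : R) : measurable [set w | (hitting_time Z x w <= s%:E)%E].
Proof.
by rewrite -[X in measurable X]setTI; exact: emeasurable_fun_infty_c (mhit x) _.
Qed.

(** At t' = a / mu + 1 the late and early bounds have main terms tail G t' and 1 - tail G t', one of
    which is at least 1/2. *)
Lemma pr_sup_exceeds_gt0 : \forall x \near +oo, 0 < pr P (sup_exceeds Z x).
Proof.
have t'0 : 0 < a / mu + 1 by rewrite addr_gt0// divr_gt0.
have d0 : 0 < 1 / 4 :> R by rewrite divr_gt0.
have [Gt|Gt] := leP (1 / 2) (tail G (a / mu + 1)).
  have lt' : a * 1 / mu < a / mu + 1 by rewrite mulr1 ltrDl.
  apply: filterS (late ltr01 lt' d0) => x h.
  have mBx := measurableI _ _ (mB x) (mlate x (1 * e x)).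
  apply: lt_le_trans (le_trans h (le_pr _ mBx (mB x) (@subIsetl _ _ _))).
  by rewrite mulr_gt0// mulr_gt0 ?invr_gt0//; lra.
have lt' : a / mu + 1 < a * ((a / mu + 2) * mu / a) / mu.
  rewrite (_ : a * _ / mu = a / mu + 2); last by field; rewrite !gt_eqF.
  by rewrite ltrD2l ltr1n.
apply: filterS (early t'0 lt' d0) => x h.
have mBx := measurableI _ _ (mB x) (mearly x ((a / mu + 2) * mu / a * e x)).
apply: lt_le_trans (le_trans h (le_pr _ mBx (mB x) (@subIsetl _ _ _))).
by rewrite mulr_gt0// mulr_gt0 ?invr_gt0//; lra.
Qed.

(** The event is disjoint from a late hit at some t1 > t, whose conditional probability is bounded
    below by [late] and [upper]. Right continuity of the tail of [G] provides t'; t1 is halfway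
    between t and mu * t' / a. *)
Lemma hitting_cdf_le (t eps : R) : 0 <= t -> 0 < eps -> \forall x \near +oo,
  pr P ((fun w => fine (hitting_time Z x w) / e x) @^-1` `]-oo, t]%classic
    `&` sup_exceeds Z x) / pr P (sup_exceeds Z x) <=
  1 - tail G (a * t / mu) + eps.
Proof.
move=> t0 eps0; set g := tail G _.
have d0 : 0 < eps / 3 by rewrite divr_gt0.
have [t' tt' gt'] := tail_right_continuous G (a * t / mu) d0.
pose t1 := (t + mu * t' / a) / 2.
have t2 : t < mu * t' / a.
  by rewrite ltr_pdivlMr// [mu * _]mulrC -ltr_pdivrMr// [t * a]mulrC.
have tt1 : t < t1 by rewrite /t1 ltr_pdivlMr// mulr_natr mulr2n ltrD2l.
have t1t' : a * t1 / mu < t'.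
  rewrite ltr_pdivrMr// -ltr_pdivlMl// /t1 ltr_pdivrMr// mulr_natr mulr2n.
  by rewrite [a^-1 * _]mulrC [t' * mu]mulrC ltrD2r.
have t10 : 0 < t1 by exact: le_lt_trans tt1.
have ad0 : 0 < a^-1 * (eps / 3) by rewrite mulr_gt0 ?invr_gt0.
near=> x.
have x0 : 0 <= x by near: x; apply: nbhs_pinfty_ge; rewrite num_real.
have B0 : 0 < pr P (sup_exceeds Z x) by near: x; exact: pr_sup_exceeds_gt0.
have up : pr P (sup_exceeds Z x) <= (a^-1 + a^-1 * (eps / 3)) * tail H x.
  by near: x; exact: upper.
have lo : a^-1 * (tail G t' - eps / 3) * tail H x <= pr P (sup_exceeds Z x `&`
    [set w | ((t1 * e x)%:E <= hitting_time Z x w)%E]).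
  by near: x; exact: late.
have ex := e_gt0 x0.
set L := _ `&` _ in lo.
have mL : measurable L by exact: measurableI.
have gL : g - 3 * (eps / 3) <= pr P L / pr P (sup_exceeds Z x).
  apply: (ratio_bound a0 (tail_gt0 x) d0 (tail_le1 _ _) _ up B0 (pr_ge0 _ _)).
  apply: le_trans lo; rewrite ler_pM2r// ler_pM2l ?invr_gt0//.
  by rewrite /g; lra.
set E := _ `&` _.
have mE : measurable E.
  apply: measurableI => //; rewrite -[X in measurable X]setTI.
  exact: (measurable_scaled_hitting Z0 reg e x).
have : pr P E + pr P L <= pr P (sup_exceeds Z x).
  rewrite -pr_setU//; last first.
    move=> w [[Et Ew] [_ /=]]; have [fin _] := hitting_time_fin Z0 reg Ew.
    rewrite -(fineK fin) lee_fin; move: Et; rewrite /= in_itv/= ler_pdivrMr//.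
    by move=> h1 h2; have := le_trans h2 h1; rewrite ler_pM2r// leNgt tt1.
  apply: le_pr => //; first exact: measurableU.
  by move=> w [[_ Bw]|[Bw _]].
rewrite -lerBrDr -(ler_pM2r (_ : 0 < (pr P (sup_exceeds Z x))^-1)) ?invr_gt0//.
rewrite mulrBl divff ?gt_eqF// => /le_trans; apply.
by rewrite -addrA lerD2l; lra.
Unshelve. all: by end_near. Qed.

(** Quotient of [early] and [upper]. Here t' approaches a t / mu from below, which is why an atom at
    that point is excluded. *)
Lemma hitting_cdf_ge (t eps : R) : pr G [set a * t / mu] = 0 -> 0 < eps ->
  \forall x \near +oo, 1 - tail G (a * t / mu) - eps <=
  pr P ((fun w => fine (hitting_time Z x w) / e x) @^-1` `]-oo, t]%classic
    `&` sup_exceeds Z x) / pr P (sup_exceeds Z x).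
Proof.
move=> Gt eps0; set g := tail G _.
have d0 : 0 < eps / 3 by rewrite divr_gt0.
have [t0|t0] := leP t 0.
  have at0 : a * t / mu <= 0 by rewrite pmulr_lle0 ?invr_gt0// pmulr_rle0.
  have -> : g = 1 by exact: tail_nonatom.
  apply: nearW => x; apply: (@le_trans _ _ 0).
    by rewrite subrr sub0r oppr_le0 ltW.
  by apply: divr_ge0; exact: pr_ge0.
have at0 : 0 < a * t / mu by rewrite divr_gt0// mulr_gt0.
have [t' /andP[t'0 tt'] gt'] := tail_left_continuous Gt at0 d0.
have ad0 : 0 < a^-1 * (eps / 3) by rewrite mulr_gt0 ?invr_gt0.
near=> x.
have x0 : 0 <= x by near: x; apply: nbhs_pinfty_ge; rewrite num_real.
have B0 : 0 < pr P (sup_exceeds Z x) by near: x; exact: pr_sup_exceeds_gt0.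
have up : pr P (sup_exceeds Z x) <= (a^-1 + a^-1 * (eps / 3)) * tail H x.
  by near: x; exact: upper.
have lo : a^-1 * (1 - tail G t' - eps / 3) * tail H x <= pr P (sup_exceeds Z x `&`
    [set w | (hitting_time Z x w <= (t * e x)%:E)%E]).
  by near: x; exact: early.
have ex := e_gt0 x0.
rewrite -[eps](@divfK _ 3)// [_ * 3]mulrC.
apply: (ratio_bound a0 (tail_gt0 x) d0 _ _ up B0 (pr_ge0 _ _)).
  by rewrite gerBl tail_ge0.
apply: (@le_trans _ _ (a^-1 * (1 - tail G t' - eps / 3) * tail H x)).
  by rewrite ler_pM2r// ler_pM2l ?invr_gt0//; rewrite /g; lra.
apply: le_trans lo _; apply: le_pr => //.
- exact: measurableI.
- apply: measurableI => //; rewrite -[X in measurable X]setTI.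
  exact: (measurable_scaled_hitting Z0 reg e x).
move=> w [Bw /=]; have [fin _] := hitting_time_fin Z0 reg Bw.
rewrite -(fineK fin) lee_fin => h; split => //=.
by rewrite in_itv/= ler_pdivrMr.
Unshelve. all: by end_near. Qed.

End hitting_cdf.

Theorem theorem1p3 (R : realType)
    (d : measure_display) (Omega : measurableType d) (P : probability Omega R)
    (Z : R -> {RV P >-> R}) (T : nat -> {RV P >-> R})
    (mu a : R) (F FI G : probability R R) (e : R -> R)
    (d' : measure_display) (Omega' : measurableType d')
    (Q : probability Omega' R) (W : {RV Q >-> R}) :
  let R1 := fun w => cycle_length (nth_cycle Z T 0 w) in
  let xi1 := fun w => cycle_increment (nth_cycle Z T 0 w) in
  let xi1_sup := fun w => cycle_sup (nth_cycle Z T 0 w) in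
  let t1 := fun x w => cycle_exceedance x (nth_cycle Z T 0 w) in
  let M := process_sup Z in
  let tau := hitting_time Z in
  (forall w, Z 0 w = 0) ->
  regenerative_increments Z T ->
  P.-integrable setT (EFin \o R1) -> ('E_P[R1] = mu%:E)%E ->
  on_nonneg F -> F.-integrable setT EFin ->
  asymp (fun x => fine (P [set w | x < xi1 w]))
        (fun x => fine (P [set w | (x%:E < xi1_sup w)%E])) ->
  asymp (fun x => fine (P [set w | (x%:E < xi1_sup w)%E])) (tail F) ->
  integrated_tail_of F FI -> subexponential FI ->
  P.-integrable setT (EFin \o xi1) -> ('E_P[xi1] = (- a)%:E)%E -> 0 < a ->
  increases_to_infty e ->
  on_nonneg G ->
  (forall t : R, 0 < t ->
     tail FI (x + t * e x) / tail FI x @[x --> +oo] --> tail G t) ->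
  (limf_esup (fun x : R => (e (x + e x) / e x)%:E) +oo%R < +oo)%E ->
  (forall y : R, 0 < y ->
     cond_prob P [set w | y * e x < t1 x w] [set w | x < xi1 w]
       @[x --> +oo] --> (0 : R)) ->
  (forall A, measurable A -> distribution Q W A = G A) ->
  weakly_converges
    (fun x => cond_law P [set w | (x%:E < M w)%E]
                (fun w => fine (tau x w) / e x))
    (pushforward Q (fun w => mu * W w / a)).
Proof.
move=> R1 xi1 xi1_sup t1 M tau Z0 reg intR ER F0 Fint asym1 asym2 HF Hsub
  intxi Exi a0 e_inf G0 HG e_lim exc4 WG.
rewrite unlock in ER; rewrite unlock in Exi.
pose p := cycle_law reg; pose S := cycle_seq_law reg.
have [int_inc mean_inc] := cycle_law_integral reg measurable_cycle_increment intxi.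
have [int_len mean_len] := cycle_law_integral reg measurable_cycle_length intR.
rewrite Exi in mean_inc; rewrite ER in mean_len.
have mu0 : 0 < mu.
  apply: (mean_gt0 _ intR ER) => w.
  by rewrite /R1 /cycle_length /= subr_gt0 (epoch_lt reg).
have ai0 : 0 < a^-1 by rewrite invr_gt0.
have inc_tail : asymp (fun x => pr p [set c | x < cycle_increment c]) (tail F).
  exact: asymp_trans asym1 asym2.
have top_tail : asymp (fun x => pr p [set c | (x%:E < cycle_top c)%E]) (tail F).
  rewrite (_ : (fun x => _) = (fun x => fine (P [set w | (x%:E < xi1_sup w)%E])))//.
  apply/funext => x.
  transitivity (fine (P [set w | (x%:E < cycle_top (nth_cycle Z T 0 w))%E])) => //.
  congr (fine (P _)); apply/seteqP; split=> w /=; rewrite (cycle_top_nth reg)//.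
have upper (delta : R) : 0 < delta -> \forall x \near +oo,
    pr P (sup_exceeds Z x) <= (a^-1 + delta) * tail FI x.
  move=> d0; have := exceedance_upper_bound (iid_cycles reg)
    measurable_cycle_increment measurable_cycle_top cycle_increment_le_top
    cycle_top_ge0 top_tail HF Hsub a0 int_inc mean_inc d0.
  by apply: filterS => x; rewrite (pr_sup_exceeds Z0 reg).
have exceeds_small (eta : R) : 0 < eta -> \forall x \near +oo,
    pr S [set s | exists n, cycle_exceeds
      (@cycle_increment R : cycle_space R -> R) (@cycle_top R) x n s] <= eta.
  move=> eta0; have h0 : 0 < eta / (a^-1 + 1) by rewrite divr_gt0// addr_gt0.
  near=> x; rewrite -(pr_sup_exceeds Z0 reg).
  apply: (@le_trans _ _ ((a^-1 + 1) * tail FI x)); first by near: x; exact: upper.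
  rewrite mulrC -ler_pdivlMr ?addr_gt0//; near: x; exact: tail_cvg0.
have [_ Hpos _] := Hsub; have [e_pos _ _] := e_inf.
have exceedance_small (y eta : R) : 0 < y -> 0 < eta -> \forall x \near +oo,
    pr p [set c : cycle_space R | y * e x < cycle_exceedance x c /\
      x < cycle_increment c] <=
    eta * pr p [set c : cycle_space R | x < cycle_increment c].
  move=> y0 eta0; have /cvgrPdist_le/(_ _ eta0) := exc4 y y0.
  apply: filterS => x; rewrite sub0r normrN => /(le_trans (ler_norm _)).
  pose A : set (cycle_space R) :=
    [set c | y * e x < cycle_exceedance x c /\ x < cycle_increment c].
  pose B : set (cycle_space R) := [set c | x < cycle_increment c].
  change (pr p A / pr p B <= eta -> pr p A <= eta * pr p B).
  have mB : measurable B.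
    rewrite -[X in measurable X]setTI.
    by apply: measurable_fun_ltr => //; exact: measurable_cycle_increment.
  have mA : measurable A.
    apply: measurableI => //; rewrite -[X in measurable X]setTI.
    by apply: measurable_fun_ltr => //; exact: measurable_cycle_exceedance.
  (* If [B] is null the conditional probability is 0 by convention and carries no information; the
     claim then follows since [A] is contained in [B]. *)
  have : 0 <= pr p B by exact: pr_ge0.
  rewrite le_eqVlt => /orP[/eqP pB0 _|pB0]; last by rewrite ler_pdivrMr.
  by rewrite -pB0 mulr0 pB0; apply: le_pr => // c [].
have mME x : measurable (sup_exceeds Z x) by exact: (measurable_sup_exceeds Z0 reg).
have mX x := measurable_scaled_hitting Z0 reg e x.
have mu_scale d0 (Y : measurableType d0) (V : Y -> R) :
    measurable_fun setT V -> measurable_fun setT (fun w => mu * V w / a).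
  move=> mV; apply: measurable_funM => //; exact: measurable_funM.
have mW : measurable_fun setT (fun w => mu * W w / a) by exact: mu_scale.
pose nu := image_probability Q mW.
have nuE (A : set R) : measurable A -> pr nu A = pr G [set y | A (mu * y / a)].
  move=> mA; rewrite /pr -WG//.
  rewrite -[X in measurable X]setTI.
  exact: (mu_scale _ R id (@measurable_id _ _ _) measurableT A mA).
have nu0 : on_nonneg nu.
  rewrite /on_nonneg (prE nu)// nuE//.
  rewrite (_ : [set y | _] = `[0, +oo[%classic).
    by rewrite /pr G0.
  apply/seteqP; split=> y /=; rewrite !in_itv/= !andbT.
    by rewrite ler_pdivlMr// mul0r pmulr_rge0.
  by move=> y0; rewrite divr_ge0 ?mulr_ge0// ltW.
have nucdf t : pr nu `]-oo, t]%classic = 1 - tail G (a * t / mu).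
  rewrite nuE// /tail -/(pr G _) -pr_setC// setCitvr.
  congr (pr G _); apply/seteqP; split=> y /=; rewrite !in_itv/=.
    by rewrite ler_pdivrMr// ler_pdivlMr//; lra.
  by rewrite ler_pdivrMr// ler_pdivlMr//; lra.
have nupt t : pr nu [set t] = pr G [set a * t / mu].
  rewrite nuE//; congr (pr G _); apply/seteqP; split=> y /=.
    by move=> <-; field; rewrite !gt_eqF.
  by move=> ->; field; rewrite !gt_eqF.
have late := late_hitting_ge Z0 mu0 a0 int_inc mean_inc int_len mean_len HF
  Hsub inc_tail e_inf HG exceeds_small.
have early := early_hitting_ge Z0 mu0 a0 int_inc mean_inc int_len mean_len HF
  Hsub inc_tail e_inf HG exceeds_small e_lim exceedance_small.
have gt0 := pr_sup_exceeds_gt0 Z0 reg mu0 a0 Hpos late early.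
move=> f cf [C fC].
(* For large x the event M > x has positive probability, and [cond_law] may be replaced by a genuine
   probability. *)
apply: cvg_trans (_ : (\int[cond_law_probability P (mME x) (mX x)]_y (f y)%:E)%E
    @[x --> +oo] --> _).
  apply: near_eq_cvg; near=> x; symmetry; apply: cond_law_integral.
  near: x; exact: gt0.
apply: (@helly_bray _ _ nu _ _ nu0 _ cf fC) => t; rewrite nupt => Gt eps eps0.
have cdf_le := hitting_cdf_le Z0 reg mu0 a0 Hpos e_pos upper late early.
have cdf_ge := hitting_cdf_ge Z0 reg mu0 a0 G0 Hpos e_pos upper late early Gt.
(* An implication, so that [near] can supply it whatever the sign of t. *)
have {}cdf_le : \forall x \near +oo, 0 <= t ->
    pr P ((fun w => fine (hitting_time Z x w) / e x) @^-1` `]-oo, t]%classic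
      `&` sup_exceeds Z x) / pr P (sup_exceeds Z x) <=
    1 - tail G (a * t / mu) + eps.
  have [t0|t0] := leP 0 t; last by apply: nearW.
  by apply: filterS (cdf_le t eps t0 eps0).
near=> x.
have x0 : 0 <= x by near: x; apply: nbhs_pinfty_ge; rewrite num_real.
have B0 : 0 < pr P (sup_exceeds Z x) by near: x; exact: gt0.
rewrite nucdf cond_law_probabilityE// ler_distl; apply/andP; split.
  by near: x; exact: cdf_ge.
(* For t < 0 both distribution functions vanish: the hitting time is nonnegative and [G] has no mass
   below 0. *)
have [t0|t0] := boolP (0 <= t); first by move: t0; near: x.
rewrite -ltNge in t0.
rewrite (tail_lt0 G0); last first.
  by rewrite pmulr_llt0 ?invr_gt0// pmulr_rlt0.
rewrite subrr add0r (_ : _ `&` _ = set0).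
  by rewrite /pr measure0 mul0r ltW.
apply/seteqP; split => // w [] /=; rewrite in_itv/= => Et Ew.
have [_ h0] := hitting_time_fin Z0 reg Ew.
have : 0 <= fine (hitting_time Z x w) / e x.
  by rewrite divr_ge0 ?fine_ge0// ltW// e_pos.
by rewrite leNgt (le_lt_trans Et t0).
Unshelve. all: by end_near. Qed.
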